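(* Let $k_1,k_2:\mathbb{T}\to[0,+\infty]$ be respectively upper- and lower-semicontinuous, and let $$\mathcal{F}_{ad}=\{u\in W^{1,\infty}(\mathbb{T}):k_1\le u\le k_2\text{ and }u>0\}.$$ Let $j:W^{1,\infty}(\mathbb{T})\to\mathbb{R}$ and let $u_0>0$ be a solution of $$j(u_0)=\min\{j(u):u''+u\ge0,\ u\in\mathcal{F}_{ad}\}.$$ Assume that $j$ is $C^2$ around $u_0$ and that there exist $s\in[0,1)$, $\alpha>0$ and $\beta,\gamma\in[0,\infty)$ such that $$\forall v\in W^{1,\infty}(\mathbb{T}),\quad j''(u_0)(v,v)\le-\alpha|v|_{H^1(\mathbb{T})}^2+\gamma|v|_{H^1(\mathbb{T})}\|v\|_{H^s(\mathbb{T})}+\beta\|v\|_{H^s(\mathbb{T})}^2 .$$ If $I$ is a connected component of $\mathbb{T}_{in}=\{\theta\in\mathbb{T}:k_1(\theta)<u_0(\theta)<k_2(\theta)\}$, then $u_0''+u_0$ is a finite sum of Dirac masses in $I$.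
   Context: $\mathbb{T}=[0,2\pi)$, and every function defined on $\mathbb{T}$ is regarded as the restriction of a $2\pi$-periodic function on $\mathbb{R}$ (so $\mathbb{T}$ is identified with the circle). $W^{1,\infty}(\mathbb{T})$ is the space of $2\pi$-periodic functions in $W^{1,\infty}_{loc}(\mathbb{R})$ with its usual norm. For $u\in W^{1,\infty}(\mathbb{T})$, ''$u''+u\ge0$'' means $\int_{\mathbb{T}}(uv-u'v')\,d\theta\ge0$ for all $v\in W^{1,\infty}(\mathbb{T})$ with $v\ge0$; then $u''+u$ is a nonnegative $2\pi$-periodic Radon measure, finite on $[0,2\pi]$. For $s\ge0$, $$|u|_{H^s(\mathbb{T})}^2:=\sum_{n\in\mathbb{Z}}|n|^{2s}|\widehat u(n)|^2,\quad\widehat u(n):=\int_{\mathbb{T}}u(\theta)e^{-in\theta}\frac{d\theta}{2\pi},\quad\|u\|_{H^s(\mathbb{T})}^2:=\|u\|_{L^2(\mathbb{T})}^2+|u|_{H^s(\mathbb{T})}^2 .$$ ''Around $u_0$'' means in a neighborhood of $u_0$ in $W^{1,\infty}(\mathbb{T})$. *)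

(* Defs.v *)
From HB Require Import structures.
From mathcomp Require Import all_boot all_order all_algebra.
From mathcomp Require Import all_classical all_reals all_analysis.
From mathcomp Require Import measurable_realfun ess_sup_inf ring lra.

Set Implicit Arguments.
Unset Strict Implicit.
Unset Printing Implicit Defensive.

Import Order.TTheory GRing.Theory Num.Theory.
Import numFieldNormedType.Exports.

Local Open Scope classical_set_scope.
Local Open Scope ring_scope.

Definition test_C1c {R : realType} (phi : R -> R) : Prop :=
  [/\ forall x, derivable phi x 1,
      continuous (derive1 phi) &
      exists M, forall x, M < `|x| -> phi x = 0].

Definition weak_derivative {R : realType} (u g : R -> R) : Prop :=
  forall phi, test_C1c phi ->
    \int[lebesgue_measure]_x (u x * (derive1 phi) x) =
    - \int[lebesgue_measure]_x (g x * phi x).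

Notation Linfty R := (Lfun (@lebesgue_measure R) +oo%E).

Section test_functions.
Context {R : realType}.
Implicit Types (phi psi u f g : R -> R) (a b x M C : R).
Local Notation mu := (@lebesgue_measure R).

Lemma lebesgue_setT_gt0 : (0 < mu [set: R])%E.
Proof.
apply: (@lt_le_trans _ _ (mu `[0, 1])).
  by rewrite lebesgue_measure_itv/= lte_fin ltr01 sube0 lte_fin.
by apply: le_measure; rewrite ?inE//; exact: measurable_itv.
Qed.

Lemma Linfty_measurable f : f \in Linfty R -> measurable_fun setT f.
Proof. by rewrite inE => /andP[+ _]; rewrite inE. Qed.

Lemma Linfty_bounded f : f \in Linfty R ->
  exists2 B, 0 <= B & \forall x \ae mu, `|f x| <= B.
Proof.
rewrite inE => /andP[_]; rewrite inE/= /finite_norm unlock lebesgue_setT_gt0.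
move=> h; have [B fB] := @ess_supr_bounded _ _ _ mu (Num.norm \o f) h.
exists (Num.max 0 B); first by rewrite le_max lexx.
by apply: filterS fB => x fx; rewrite le_max fx orbT.
Qed.

Lemma Linfty_integrable f psi M C : f \in Linfty R ->
  measurable_fun setT psi ->
  (forall x, `|psi x| <= C) -> (forall x, M < `|x| -> psi x = 0) ->
  mu.-integrable setT (EFin \o (fun x => f x * psi x)).
Proof.
move=> fL mpsi psiC psiM.
have mf := Linfty_measurable fL.
have [B B0 fB] := Linfty_bounded fL.
have C0 : 0 <= C by exact: le_trans (psiC 0).
have mfp : measurable_fun setT (fun x => f x * psi x) by exact: measurable_funM.
apply/integrableP; split; first exact/measurable_EFinP.
apply: (@le_lt_trans _ _ (\int[mu]_x ((B * C)%:E * (\1_`[- M, M]%classic x)%:E))%E).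
  apply: ae_ge0_le_integral => //.
  - by apply/measurable_EFinP; exact: measurableT_comp.
  - by move=> x _; rewrite -EFinM lee_fin mulr_ge0// mulr_ge0.
  - by apply/measurable_EFinP/measurable_funM => //.
  apply: (@filterS _ _ (ae_filter_ringOfSetsType mu)) fB => x fBx _; rewrite /= -EFinM lee_fin.
  rewrite indicE; have [xM|xM] := boolP (x \in `[- M, M]%classic).
    by rewrite mulr1 normrM ler_pM.
  rewrite psiM ?mulr0 ?normr0// ltNge; apply: contra xM.
  by rewrite ler_norml inE/= in_itv.
have BC0 : (0 <= (B * C)%:E)%E by rewrite lee_fin mulr_ge0.
have mI : measurable_fun setT (fun x => (\1_(`[- M, M]%classic) x : R)%:E).
  exact/measurable_EFinP.
have I0 x : setT x -> (0 <= (\1_(`[- M, M]%classic) x : R)%:E)%E by rewrite lee_fin.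
rewrite (@ge0_integralZl_EFin _ _ _ mu _ measurableT _ I0 mI _ (mulr_ge0 B0 C0)).
rewrite integral_indic// setIT lte_mul_pinfty//.
rewrite -[X in (X < _)%E]/(mu `[- M, M]%classic) lebesgue_measure_itv/=.
by case: ifPn => // _; rewrite ltry.
Qed.

Lemma test_C1c_bounded phi : test_C1c phi ->
  exists M C, [/\ continuous phi, continuous (derive1 phi),
     (forall x, `|phi x| <= C), (forall x, `|derive1 phi x| <= C) &
     (forall x, M < `|x| -> phi x = 0) /\
     (forall x, M < `|x| -> derive1 phi x = 0)].
Proof.
move=> [dphi cphi' [M phiM]].
have cphi : continuous phi.
  by move=> x; exact/differentiable_continuous/derivable1_diffP.
have phi'M x : M < `|x| -> derive1 phi x = 0.
  move=> xM; rewrite derive1E.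
  have : \forall y \near x, cst 0 y = phi y.
    near=> y; rewrite phiM//; near: y.
    have : {for x, continuous (fun y : R => `|y|)} by exact: norm_continuous.
    by move/cvgr_gt; apply.
  by move=> /near_eq_derive <-; rewrite derive_cst.
have bnd (h : R -> R) : continuous h -> (forall x, M < `|x| -> h x = 0) ->
    exists C, forall x, `|h x| <= C.
  move=> ch hM.
  have : compact (h @` `[- M, M]).
    apply: continuous_compact; last exact: segment_compact.
    exact: continuous_subspaceT.
  move/compact_bounded => [C [_ hC]]; exists (`|C| + 1) => x.
  have [xM|xM] := leP `|x| M; last by rewrite hM// normr0 addr_ge0.
  apply: (hC (`|C| + 1)); first by rewrite ltr_pwDr// ler_norm.
  by exists x => //=; rewrite in_itv/= -ler_norml.
have [C1 h1] := bnd _ cphi phiM; have [C2 h2] := bnd _ cphi' phi'M.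
exists M, (Num.max C1 C2); split => // x; rewrite le_max ?h1 ?h2 ?orbT//.
Unshelve. all: by end_near. Qed.

Lemma weak_derivativeD a u1 u2 g1 g2 :
  u1 \in Linfty R -> u2 \in Linfty R -> g1 \in Linfty R -> g2 \in Linfty R ->
  weak_derivative u1 g1 -> weak_derivative u2 g2 ->
  weak_derivative (fun x => a * u1 x + u2 x) (fun x => a * g1 x + g2 x).
Proof.
move=> u1L u2L g1L g2L ug1 ug2 phi phi1.
have [M [C [cphi cphi' phiC phi'C [phiM phi'M]]]] := test_C1c_bounded phi1.
have mphi := continuous_measurable_fun cphi.
have mphi' := continuous_measurable_fun cphi'.
have key h1 h2 psi : h1 \in Linfty R -> h2 \in Linfty R ->
    measurable_fun setT psi ->
    (forall x, `|psi x| <= C) -> (forall x, M < `|x| -> psi x = 0) ->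
    \int[mu]_x ((a * h1 x + h2 x) * psi x) =
    a * (\int[mu]_x (h1 x * psi x)) + \int[mu]_x (h2 x * psi x).
  move=> h1L h2L mpsi psiC psiM.
  have i1 := Linfty_integrable h1L mpsi psiC psiM.
  have i2 := Linfty_integrable h2L mpsi psiC psiM.
  rewrite -RintegralZl// -RintegralD//.
    by apply: eq_Rintegral => x _; rewrite mulrDl mulrA.
  rewrite (_ : _ \o _ = (fun x => a%:E * (h1 x * psi x)%:E)%E); last exact/funext.
  exact: integrableZl.
rewrite !key// (ug1 _ phi1) (ug2 _ phi1); ring.
Qed.

Let pos2 x : R := x * Num.max 0 x.

Let pos2_derive x : is_derive x 1 pos2 (2 * Num.max 0 x).
Proof.
have [x0|x0|->] := ltgtP x 0.
- apply: (@near_eq_is_derive _ _ _ (cst 0)) => //.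
  + near=> y; rewrite /pos2 max_l ?mulr0//.
    by apply: ltW; near: y; exact: lt_nbhsl.
  + by rewrite mulr0; exact: is_derive_cst.
- apply: (@near_eq_is_derive _ _ _ (fun y : R => y * y : R)) => //.
  + near=> y; rewrite /pos2 max_r//.
    by apply: ltW; near: y; exact: lt_nbhsr.
  + apply: is_derive_eq.
    by rewrite -[LHS]/(x * 1 + x * 1) mulr1 mulr2n mulrDl mul1r.
- apply/is_derive1_caratheodory; exists (fun z => Num.max 0 z); split.
  + by move=> z; rewrite /pos2 mul0r !subr0 mulrC.
  + by apply: continuous_max; [exact: cvg_cst|exact: cvg_id].
  + by rewrite maxxx mulr0.
Unshelve. all: by end_near. Qed.


Let P a b x : R := pos2 ((x - a) * (b - x)).

Let bump n a b x : R := 1 - (1 + n%:R * P a b x)^-1.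

Let P_ge0 a b x : 0 <= P a b x.
Proof.
rewrite /P /pos2; have [h|h] := leP 0 ((x - a) * (b - x)).
  by rewrite mulr_ge0.
by rewrite mulr0.
Qed.

Let P_out a b x : ~ (a < x < b) -> a < b -> P a b x = 0.
Proof.
move=> xab ab; rewrite /P /pos2 max_l ?mulr0//.
have [ax|xa] := ltP a x; have [xb|bx] := ltP x b; first by rewrite ax xb in xab.
- by rewrite mulr_ge0_le0 ?subr_ge0 ?subr_le0 ?(ltW ax).
- by rewrite mulr_le0_ge0 ?subr_ge0 ?subr_le0 ?(ltW xb).
- by rewrite mulr_le0_ge0 ?subr_ge0 ?subr_le0//; move: (le_trans bx xa); rewrite leNgt ab.
Qed.

Let bump_derive n a b x : is_derive x 1 (bump n a b)
  ((1 + n%:R * P a b x)^-2 *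
   (n%:R * (2 * Num.max 0 ((x - a) * (b - x)) * (a + b - 2 * x)))).
Proof.
have d1 : is_derive x 1 (fun x => (x - a) * (b - x)) (a + b - 2 * x).
  apply: is_derive_eq; rewrite -![_ *: _]/(_ * _); ring.
have d2 : is_derive x 1 (P a b)
    (2 * Num.max 0 ((x - a) * (b - x)) * (a + b - 2 * x)).
  exact: (@is_derive1_comp _ pos2 (fun x => (x - a) * (b - x))).
have d3 : is_derive x 1 (fun x => 1 + n%:R * P a b x)
    (n%:R * (2 * Num.max 0 ((x - a) * (b - x)) * (a + b - 2 * x))).
  apply: is_derive_eq; rewrite -![_ *: _]/(_ * _); ring.
have nz : 1 + n%:R * P a b x != 0.
  by rewrite gt_eqF// ltr_pwDl// mulr_ge0.
have d4 := @is_deriveV _ (fun x => 1 + n%:R * P a b x) x _ 1 nz d3.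
apply: is_derive_eq.
rewrite -![_ *: _]/(_ * _); ring.
Qed.

Let bump_C1c n a b : a < b -> test_C1c (bump n a b).
Proof.
move=> ab; split.
- by move=> x; case: (bump_derive n a b x).
- rewrite (_ : derive1 _ = fun x => (1 + n%:R * P a b x)^-2 *
   (n%:R * (2 * Num.max 0 ((x - a) * (b - x)) * (a + b - 2 * x)))); last first.
    by apply/funext => x; rewrite derive1E; case: (bump_derive n a b x).
  have c1 : continuous (fun x => (x - a) * (b - x)).
    by move=> x; apply: cvgM; apply: cvgB; [exact: cvg_id|exact: cvg_cst|exact: cvg_cst|exact: cvg_id].
  have c2 : continuous (fun x => Num.max 0 ((x - a) * (b - x))).
    by move=> x; apply: (@continuous_max _ _ (cst 0) _ x); [exact: cvg_cst|exact: c1].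
  have c3 : continuous (fun x => 1 + n%:R * P a b x).
    move=> x; apply: cvgD; first exact: cvg_cst.
    apply: cvgM; first exact: cvg_cst.
    by apply: cvgM; [exact: c1|exact: c2].
  move=> x; apply: cvgM.
    apply: cvgV.
      by rewrite expf_neq0// gt_eqF// ltr_pwDl// mulr_ge0.
    by apply: (@continuous_comp _ _ _ (fun y => 1 + n%:R * P a b y) (fun y => y ^+ 2));
      [exact: c3|exact: exprn_continuous].
  apply: cvgM; first exact: cvg_cst.
  apply: cvgM; first by apply: cvgM; [exact: cvg_cst|exact: c2].
  apply: cvgB; first exact: cvg_cst.
  by apply: cvgM; [exact: cvg_cst|exact: cvg_id].
- exists (Num.max `|a| `|b|) => x; rewrite gt_max => /andP[xa xb].
  rewrite /bump P_out ?mulr0 ?addr0 ?invr1 ?subrr// => /andP[ax xb'].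
  have [x0|x0] := leP 0 x.
    move: xb; rewrite (ger0_norm x0) => bx.
    by move: (lt_trans bx xb'); rewrite ltNge ler_norm.
  move: xa; rewrite (ltr0_norm x0) ltNge => /negP; apply.
  rewrite lerNl; apply: (@le_trans _ _ a _); last exact: ltW.
  by rewrite lerNl -normrN ler_norm.
Qed.

Let bump_cvg a b x : a < b ->
  bump n a b x @[n --> \oo] --> (\1_`]a, b[%classic x : R).
Proof.
move=> ab; rewrite indicE; have [xab|xab] := boolP (x \in `]a, b[%classic).
  have P0 : 0 < P a b x.
    move: xab; rewrite inE/= in_itv/= => /andP[ax xb].
    have h : 0 < (x - a) * (b - x) by rewrite mulr_gt0// subr_gt0.
    by rewrite /P /pos2 max_r ?(ltW h)// mulr_gt0.
  rewrite -[X in _ --> X]subr0; apply: cvgB; first exact: cvg_cst.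
  apply/cvgrPdist_le => e e0; near=> n.
  have h : 0 < 1 + n%:R * P a b x by rewrite ltr_pwDl// mulr_ge0.
  rewrite sub0r normrN normfV gtr0_norm// invf_ple ?posrE//.
  rewrite (@le_trans _ _ (n%:R * P a b x))//; last by rewrite lerDr.
  rewrite -ler_pdivrMr//; near: n; exact: nbhs_infty_ger.
rewrite (_ : (fun n => _) = cst 0); first exact: cvg_cst.
apply/funext => n; rewrite /bump P_out ?mulr0 ?addr0 ?invr1 ?subrr//.
by move=> axb; move/negP: xab; apply; rewrite inE/= in_itv/= axb.
Unshelve. all: by end_near. Qed.

Let bump_le n a b x : a < b -> `|bump n a b x| <= \1_(`]a, b[%classic) x.
Proof.
move=> ab; rewrite indicE; have [xab|xab] := boolP (x \in `]a, b[%classic).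
  have nP : 0 <= n%:R * P a b x by rewrite mulr_ge0.
  have h : 0 <= (1 + n%:R * P a b x)^-1 <= 1.
    by rewrite invr_ge0 addr_ge0//= invf_le1 ?lerDl// ltr_pwDl.
  by move: h => /andP[h1 h2]; rewrite /bump ger0_norm ?subr_ge0// gerBl.
rewrite /bump P_out ?mulr0 ?addr0 ?invr1 ?subrr ?normr0//.
by move=> axb; move/negP: xab; apply; rewrite inE/= in_itv/= axb.
Qed.

Let Linfty_indic f a b : f \in Linfty R ->
  mu.-integrable setT (EFin \o (fun x => f x * \1_(`]a, b[%classic) x)).
Proof.
move=> fL; apply: (@Linfty_integrable _ _ (Num.max `|a| `|b|) 1) => //.
  by move=> x; rewrite indicE; case: (_ \in _); rewrite ?normr1 ?normr0.
move=> x; rewrite gt_max => /andP[xa xb].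
rewrite indicE memNset// /= in_itv/= => /andP[ax xb'].
have [x0|x0] := leP 0 x.
  move: xb; rewrite (ger0_norm x0) => bx.
  by move: (lt_trans bx xb'); rewrite ltNge ler_norm.
move: xa; rewrite (ltr0_norm x0) ltNge => /negP; apply.
rewrite lerNl; apply: (@le_trans _ _ a _); last exact: ltW.
by rewrite lerNl -normrN ler_norm.
Qed.

Let Linfty_int_itv f a b : f \in Linfty R ->
  mu.-integrable `]a, b[ (EFin \o f).
Proof.
move=> fL; apply/integrable_mkcond => //.
rewrite (_ : _ \_ _ = EFin \o (fun x => f x * \1_(`]a, b[%classic) x)).
  exact: Linfty_indic.
apply/funext => x; rewrite patchE /comp indicE.
by case: (x \in _); rewrite ?mulr1 ?mulr0.
Qed.

Let bump_int_cvg f a b : f \in Linfty R -> a < b ->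
  (\int[mu]_x (f x * bump n a b x)%:E)%E @[n --> \oo] -->
  (\int[mu]_x (f x * \1_(`]a, b[%classic) x)%:E)%E.
Proof.
move=> fL ab.
have mf := Linfty_measurable fL.
have h1 n : measurable_fun setT (fun x => (f x * bump n a b x)%:E).
  apply/measurable_EFinP; apply: measurable_funM => //.
  apply: continuous_measurable_fun.
  by have [_ [_ [cb _ _ _ _]]] := test_C1c_bounded (bump_C1c n ab).
have h2 : measurable_fun setT (fun x => (f x * \1_(`]a, b[%classic) x)%:E).
  by apply/measurable_EFinP; apply: measurable_funM.
have h3 : {ae mu, forall x, setT x -> (f x * bump n a b x)%:E @[n --> \oo] -->
    (f x * \1_(`]a, b[%classic) x)%:E}.
  apply: aeW => x _; apply: cvg_EFin; first exact: nearW.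
  by apply: cvgM; [exact: cvg_cst|exact: bump_cvg].
have h4 : mu.-integrable setT (fun x => `|(f x * \1_(`]a, b[%classic) x)%:E|%E).
  exact: (integrable_abse (Linfty_indic a b fL)).
have h5 : {ae mu, forall x n, setT x -> (`|(f x * bump n a b x)%:E| <=
     `|(f x * \1_(`]a, b[%classic) x)%:E|)%E}.
  apply: aeW => x n _; rewrite lee_fin !normrM ler_wpM2l//.
  apply: le_trans (bump_le n x ab) _; exact: ler_norm.
by have [] := @dominated_convergence _ _ _ mu setT measurableT _ _ _ h1 h2 h3 h4 h5.
Qed.

Let weak_derivative_int u g1 g2 a b : g1 \in Linfty R -> g2 \in Linfty R ->
  weak_derivative u g1 -> weak_derivative u g2 -> a < b ->
  \int[mu]_(x in `]a, b[) g1 x = \int[mu]_(x in `]a, b[) g2 x.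
Proof.
move=> g1L g2L ug1 ug2 ab.
have E f : \int[mu]_(x in `]a, b[) f x = \int[mu]_x (f x * \1_(`]a, b[%classic) x).
  rewrite Rintegral_mkcond; apply: eq_Rintegral => x _.
  by rewrite patchE indicE; case: (x \in _); rewrite ?mulr1 ?mulr0.
rewrite !E /Rintegral; congr fine.
apply: (cvg_unique _ (bump_int_cvg g1L ab)); first exact: ereal_hausdorff.
rewrite (_ : (fun n => _) = (fun n => \int[mu]_x (g2 x * bump n a b x)%:E)%E).
  exact: bump_int_cvg.
apply/funext => n; have tb := bump_C1c n ab.
have [M [C [cphi _ phiC _ [phiM _]]]] := test_C1c_bounded tb.
have mphi := continuous_measurable_fun cphi.
have i1 := Linfty_integrable g1L mphi phiC phiM.
have i2 := Linfty_integrable g2L mphi phiC phiM.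
have := ug1 _ tb; rewrite (ug2 _ tb) => /oppr_inj; rewrite /Rintegral => h.
rewrite -[LHS]fineK; last exact: integrable_fin_num.
by rewrite -[RHS]fineK; [congr EFin; rewrite h|exact: integrable_fin_num].
Qed.

Lemma weak_derivative_unique u g1 g2 : g1 \in Linfty R -> g2 \in Linfty R ->
  weak_derivative u g1 -> weak_derivative u g2 ->
  \forall x \ae mu, g1 x = g2 x.
Proof.
move=> g1L g2L ug1 ug2.
have intS f a b : f \in Linfty R -> mu.-integrable `]a, b] (EFin \o f).
  move=> fL; apply: (integrableS _ _ _ (Linfty_int_itv a (b + 1) fL)) => //.
  by move=> x /=; rewrite !in_itv/= => /andP[-> /= xb]; rewrite ltr_pwDr.
have locf f : f \in Linfty R -> locally_integrable setT f.
  move=> fL; split; [exact: Linfty_measurable|exact: openT|move=> K _ cK].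
  have [M [_ KM]] := compact_bounded cK.
  have mK : measurable K by exact: compact_measurable.
  have /integrableP[_] : mu.-integrable K (EFin \o f).
    apply: (integrableS _ _ _ (Linfty_int_itv (- (M + 2)) (M + 2) fL)) => //.
    move=> x Kx /=; rewrite in_itv/= -ltr_norml.
    apply: (@le_lt_trans _ _ (M + 1)); last by rewrite ltrD2l ltr1n.
    by apply: (KM (M + 1)) => //; rewrite ltrDl.
  by [].
have key (n : nat) : \forall x \ae mu, - n%:R < x -> g1 x = g2 x.
  have h1 := FTC1 (fun y => intS g1 (- n%:R) y g1L) (locf _ g1L).
  have h2 := FTC1 (fun y => intS g2 (- n%:R) y g2L) (locf _ g2L).
  move: h1 h2 => /=; apply: (@filterS2 _ _ (ae_filter_ringOfSetsType mu)).
  move=> x h1 h2 nx.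
  have [_ <-] := h1 nx; have [_ <-] := h2 nx.
  congr (derive1 _ x); apply/funext => y.
  rewrite -!Rintegral_itv_bndo_bndc; try exact: Linfty_int_itv.
  have [ny|yn] := ltP (- n%:R) y; first exact: (weak_derivative_int g1L g2L ug1 ug2).
  have -> : `]- n%:R, y[%classic = set0 :> set R.
    by apply: set_itv_ge; rewrite bnd_simp -leNgt.
  by rewrite !Rintegral_set0.
move: (ae_foralln key); apply: filterS => x h.
apply: (h (Num.truncn `|x|).+1).
rewrite ltrNl (@le_lt_trans _ _ `|x|) ?truncnS_gt//.
by rewrite -normrN ler_norm.
Qed.
End test_functions.

Lemma Linfty_submod_closed {R : realType} :
  submod_closed (Linfty R : {pred R -> R}).
Proof. exact: (@Lfun_submod_closed _ _ R _ +oo%E (leey 1)). Qed.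

Lemma Linfty_lin {R : realType} (a : R) (f g : R -> R) :
  f \in Linfty R -> g \in Linfty R -> (fun x => a * f x + g x) \in Linfty R.
Proof. by move=> fL gL; exact: (Linfty_submod_closed.2 a _ _ fL gL). Qed.

(* An element of W^{1,oo} of the circle is given by its continuous representative
   on the line; by periodicity W^{1,oo}_loc amounts to global bounds. *)
Definition is_W1inf {R : realType} (u : R -> R) : Prop :=
  [/\ forall x, u (x + 2 * pi) = u x,
      continuous u,
      u \in Linfty R &
      exists2 g, g \in Linfty R & weak_derivative u g].

Definition W1inf_pred {R : realType} : {pred R -> R} := mem [set u | is_W1inf u].

Record W1inf (R : realType) := MkW1inf {
  W1inf_fun :> R -> R;
  W1inf_funP : W1inf_fun \in W1inf_pred
}.

HB.instance Definition _ (R : realType) := [isSub for @W1inf_fun R].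
HB.instance Definition _ (R : realType) := [Choice of W1inf R by <:].

Lemma W1inf_submod_closed (R : realType) : submod_closed (@W1inf_pred R).
Proof.
split.
  rewrite inE; split => //; first exact: cst_continuous.
    exact: Linfty_submod_closed.1.
  exists (fun=> 0); first exact: Linfty_submod_closed.1.
  move=> phi _; under eq_Rintegral do rewrite mul0r.
  by under [in RHS]eq_Rintegral do rewrite mul0r; rewrite Rintegral_cst// mul0r oppr0.
move=> a u v; rewrite !inE => -[up uc uL [g gL ug]] [vp vc vL [h hL vh]].
split.
- by move=> x; rewrite /= -[LHS]/(a * u (x + 2 * pi) + v (x + 2 * pi)) up vp.
- move=> x; apply: cvgD; last exact: vc.
  by apply: cvgM; [exact: cvg_cst|exact: uc].
- exact: Linfty_lin.
exists (fun x => a * g x + h x); first exact: Linfty_lin.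
exact: weak_derivativeD.
Qed.

HB.instance Definition _ (R : realType) :=
  GRing.isSubmodClosed.Build R (R -> R) (@W1inf_pred R) (@W1inf_submod_closed R).
HB.instance Definition _ (R : realType) :=
  [SubChoice_isSubLmodule of W1inf R by <:].

Section W1inf_norm.
Context {R : realType}.
Implicit Types (u v : W1inf R) (a : R) (f g : R -> R).
Local Notation mu := (@lebesgue_measure R).

Definition wderiv u : R -> R :=
  get [set g | g \in Linfty R /\ weak_derivative u g].

Lemma wderivP u : wderiv u \in Linfty R /\ weak_derivative u (wderiv u).
Proof.
apply: (@getPex _ [set g | g \in Linfty R /\ weak_derivative u g]); have := W1inf_funP u; rewrite inE => -[_ _ _ [g gL ug]].
by exists g.
Qed.

Lemma wderiv_ae u g : g \in Linfty R -> weak_derivative u g ->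
  \forall x \ae mu, wderiv u x = g x.
Proof.
by have [h1 h2] := wderivP u => gL ug; apply: weak_derivative_unique ug.
Qed.

Lemma W1inf_Linfty u : (u : R -> R) \in Linfty R.
Proof. by have := W1inf_funP u; rewrite inE => -[]. Qed.

Lemma W1inf_continuous u : continuous (u : R -> R).
Proof. by have := W1inf_funP u; rewrite inE => -[]. Qed.

Definition Linfty_norm f : R := fine 'N[mu]_+oo [EFin \o f].

Definition W1inf_norm u : R := Linfty_norm u + Linfty_norm (wderiv u).

Lemma Linfty_normE f : f \in Linfty R ->
  (Linfty_norm f)%:E = 'N[mu]_+oo [EFin \o f]%E.
Proof.
rewrite inE => /andP[_]; rewrite inE/= /finite_norm => h.
by rewrite /Linfty_norm fineK// ge0_fin_numE// Lnorm_ge0.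
Qed.

Lemma Linfty_norm_ge0 f : 0 <= Linfty_norm f.
Proof. by rewrite /Linfty_norm fine_ge0// Lnorm_ge0. Qed.

Lemma Linfty_norm_ae f g : (\forall x \ae mu, f x = g x) ->
  Linfty_norm f = Linfty_norm g.
Proof.
move=> fg; rewrite /Linfty_norm; congr fine; rewrite unlock lebesgue_setT_gt0.
apply: eq_ess_sup; apply: (@filterS _ _ (ae_filter_ringOfSetsType mu)) fg.
by move=> x /= ->.
Qed.

Lemma Linfty_normD f g : f \in Linfty R -> g \in Linfty R ->
  Linfty_norm (fun x => f x + g x) <= Linfty_norm f + Linfty_norm g.
Proof.
move=> fL gL; rewrite -lee_fin EFinD !Linfty_normE//; last first.
  by have := Linfty_lin 1 fL gL; under eq_fun do rewrite mul1r.
exact: (@eminkowski _ _ _ mu f g +oo%E (Linfty_measurable fL)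
  (Linfty_measurable gL) (leey _)).
Qed.

Lemma Linfty_normZ a f : f \in Linfty R ->
  Linfty_norm (fun x => a * f x) = `|a| * Linfty_norm f.
Proof.
move=> fL; apply: EFin_inj; rewrite EFinM Linfty_normE ?Linfty_normE//.
  rewrite unlock lebesgue_setT_gt0.
  have -> : abse \o (EFin \o (fun x => a * f x)) =
      (cst `|a|%:E \* (abse \o (EFin \o f)))%E.
    by apply/funext => x /=; rewrite normrM EFinM.
  by rewrite ess_supZl//; exact: lebesgue_setT_gt0.
have := Linfty_lin a fL (Linfty_submod_closed.1 : 0 \in Linfty R).
by under eq_fun do rewrite addr0.
Qed.

Lemma W1inf_ler_normD u v : W1inf_norm (u + v) <= W1inf_norm u + W1inf_norm v.
Proof.
have [u1 u2] := wderivP u; have [v1 v2] := wderivP v.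
rewrite addrACA; apply: lerD; first exact: (Linfty_normD (W1inf_Linfty u) (W1inf_Linfty v)).
rewrite (@Linfty_norm_ae _ (fun x => wderiv u x + wderiv v x)).
  exact: Linfty_normD.
have E f g : (fun x => f x + g x) = (fun x => 1 * f x + g x).
  by apply/funext => x; rewrite mul1r.
apply: wderiv_ae; first by rewrite E; exact: Linfty_lin.
rewrite E -[X in weak_derivative X _]/(fun x => u x + v x) E.
by apply: weak_derivativeD => //; exact: W1inf_Linfty.
Qed.

Lemma W1inf_normZ a u : W1inf_norm (a *: u) = `|a| * W1inf_norm u.
Proof.
have [u1 u2] := wderivP u.
rewrite mulrDr -!Linfty_normZ//; last exact: W1inf_Linfty.
congr (_ + _); apply: Linfty_norm_ae.
have z : (fun=> 0 : R) \in Linfty R by exact: Linfty_submod_closed.1.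
have w0 : weak_derivative (fun=> 0 : R) (fun=> 0 : R).
  move=> phi _; under eq_Rintegral do rewrite mul0r.
  by under [in RHS]eq_Rintegral do rewrite mul0r; rewrite Rintegral_cst// mul0r oppr0.
have E f : (fun x => a * f x) = (fun x => a * f x + 0).
  by apply/funext => x; rewrite addr0.
apply: wderiv_ae; first by rewrite E; exact: Linfty_lin.
rewrite E -[X in weak_derivative X _]/(fun x => a * u x) E.
by apply: weak_derivativeD => //; exact: W1inf_Linfty.
Qed.

Lemma W1inf_norm0_eq0 u : W1inf_norm u = 0 -> u = 0.
Proof.
move=> u0; apply: val_inj; apply/funext => x /=.
have : Linfty_norm u = 0.
  apply/eqP; rewrite eq_le Linfty_norm_ge0 andbT -u0.
  by rewrite lerDl Linfty_norm_ge0.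
move=> nu0; have u00 : 'N[mu]_+oo [EFin \o u]%E = 0%E.
  by rewrite -Linfty_normE ?nu0 ?W1inf_Linfty.
have mu_u : measurable_fun setT (EFin \o u).
  by apply/measurable_EFinP; exact: Linfty_measurable (W1inf_Linfty u).
have h := @Lnorm_eq0_eq0 _ _ _ mu (EFin \o u) +oo%E mu_u (ltry 0) u00.
have {}h : \forall y \ae mu, u y = 0.
  apply: (@filterS _ _ (ae_filter_ringOfSetsType mu)) h.
  by move=> y /= /(_ I) [].
apply/eqP; apply: contrapT => /negP ux0.
have : \forall y \near x, u y != 0.
  apply: (@cvgr_neq0 _ R _ (nbhs x) _ u (u x)) => //.
  exact: W1inf_continuous.
move=> /nbhs_ballP[e /= e0 xe].
have [N [mN N0 sN]] := h.
have : (mu (ball x e) <= mu N)%E.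
  apply: le_measure; rewrite ?inE//; first exact: measurable_ball.
  by move=> y /xe uy; apply: sN => /= uy0; rewrite uy0 eqxx in uy.
rewrite N0 lebesgue_measure_ball; last exact: ltW.
by rewrite lee_fin leNgt pmulrn_lgt0// e0.
Qed.

End W1inf_norm.

HB.instance Definition _ (R : realType) := @Lmodule_isNormed.Build R (W1inf R)
  (@W1inf_norm R) (@W1inf_ler_normD R) (@W1inf_normZ R) (@W1inf_norm0_eq0 R).

Section functional_setting.
Context {R : realType}.
Implicit Types (u v : W1inf R) (k : R -> \bar R).
Local Notation leb := (@lebesgue_measure R).

Definition torus : set R := `[0, 2 * pi[%classic.

(* <u'' + u, v>, the weak form on the circle *)
Definition weak_pairing u v : R :=
  \int[leb]_(x in torus) (u x * v x - wderiv u x * wderiv v x).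

Definition weakly_nonneg u : Prop :=
  forall v, (forall x, 0 <= v x) -> 0 <= weak_pairing u v.

(* [mu] is only meaningful on [torus], where it is u'' + u *)
Definition represents_weak u
    (mu : {measure set (measurableTypeR R) -> \bar R}) : Prop :=
  (mu torus < +oo)%E /\
  forall v, \int[mu]_(x in torus) v x = weak_pairing u v.

Definition fourier_re u (n : int) : R :=
  (2 * pi)^-1 * \int[leb]_(x in torus) (u x * cos (n%:~R * x)).

Definition fourier_im u (n : int) : R :=
  - ((2 * pi)^-1 * \int[leb]_(x in torus) (u x * sin (n%:~R * x))).

Definition fourier_abs2 u (n : int) : R :=
  fourier_re u n ^+ 2 + fourier_im u n ^+ 2.

(* Both are used for s <= 1 only, where the series converges; for s = 0 the
   term n = 0 is counted, since 0 `^ 0 = 1. *)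
Definition Hs_semi (s : R) u : R :=
  Num.sqrt (fine (\esum_(n in [set: int])
    (`|n|%N%:R `^ (2 * s) * fourier_abs2 u n)%:E)).

Definition Hs_norm (s : R) u : R :=
  Num.sqrt (\int[leb]_(x in torus) (u x ^+ 2) + Hs_semi s u ^+ 2).

Definition periodic2pi k : Prop := forall x, k (x + 2 * pi) = k x.

Definition upper_semicontinuous k : Prop :=
  lower_semicontinuous (fun x => - k x)%E.

Definition F_ad (k1 k2 : R -> \bar R) : set (W1inf R) :=
  [set u | forall x, [/\ (k1 x <= (u x)%:E)%E, ((u x)%:E <= k2 x)%E & 0 < u x]].

Definition torus_in (k1 k2 : R -> \bar R) u : set R :=
  [set x | torus x /\ (k1 x < (u x)%:E < k2 x)%E].

Definition circle_point (x : R) : R * R := (cos x, sin x).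

(* [torus] carries the topology of the circle, not that of the half-open
   interval: a component may wrap around 0. *)
Definition torus_component (A I : set R) : Prop :=
  exists2 x, A x & I = torus `&` circle_point @^-1`
    connected_component (circle_point @` A) (circle_point x).

Definition finite_dirac_sum_in (I : set R)
    (mu : {measure set (measurableTypeR R) -> \bar R}) : Prop :=
  exists (n : nat) (x : 'I_n -> R) (c : 'I_n -> R),
    (forall i, I (x i) /\ 0 < c i) /\
    forall A : set (measurableTypeR R), measurable A -> A `<=` I ->
      mu A = (\sum_(i < n) (c i)%:E * \d_(x i : measurableTypeR R) A)%E.

End functional_setting.

Section second_derivative.
Context {R : realType} {V : normedModType R}.
Implicit Types (j : V -> R) (u v w : V).

Definition derive2 j u v w : R := 'D_v (fun x => 'D_w j x) u.

(* The fourth clause says that u |-> 'd j u is Frechet differentiable at u for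
   the operator norm, with derivative [derive2 j u]; the last one that
   [derive2 j] is continuous at u for the norm of bilinear forms. *)
Definition C2_around j (u0 : V) : Prop :=
  \forall u \near u0,
    [/\ differentiable j u,
        forall w, linear (fun v => derive2 j u v w : R^o) /\
                  linear (fun v => derive2 j u w v : R^o),
        exists M, forall v w, `|derive2 j u v w| <= M * `|v| * `|w|,
        forall e, 0 < e -> \forall h \near (0 : V), forall w,
          `|'d j (u + h) w - 'd j u w - derive2 j u h w| <= e * `|h| * `|w| &
        forall e, 0 < e -> \forall u' \near u, forall v w,
          `|derive2 j u' v w - derive2 j u v w| <= e * `|v| * `|w|].

End second_derivative.

(* Main.v *)
Require Import Defs.
From HB Require Import structures.
From mathcomp Require Import all_boot all_order all_algebra.
From mathcomp Require Import all_classical all_reals all_analysis.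
From mathcomp Require Import measurable_realfun ess_sup_inf ring lra.

Set Implicit Arguments.
Unset Strict Implicit.
Unset Printing Implicit Defensive.

Import Order.TTheory GRing.Theory Num.Theory.
Import numFieldNormedType.Exports.

Local Open Scope classical_set_scope.
Local Open Scope ring_scope.

(** Write U for the primitive of u0 vanishing at 0 and T for the period.
    Testing u0'' + u0 >= 0 against tents shows that u0 + (primitive of U) is
    convex on short intervals ([weakly_nonneg_loc_convex]); its right derivative
    G is nondecreasing and right-continuous, u0' = G - U almost everywhere, and
    u0'' + u0 is the Stieltjes measure of G ([weakly_nonneg_cumulative],
    [represents_stieltjes]). Finitely many Dirac masses on a component I means
    that G is a step function there.

    Suppose that G takes four values at points x1 < x2 < x3 < x4 of I. The
    measure dG then has three pieces living between x1 and x4, and a combination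
    dN of them with coefficients in [-1, 1] satisfies the two conditions
    int cos dN = int sin dN = 0, under which v'' + v = dN has a solution v
    vanishing outside of [x1, x4]. Both u0 + t v and u0 - t v satisfy the
    differential constraint, since dG + t dN >= 0 for |t| <= 1
    ([perturbation_exists]), and the constraints k1 <= u <= k2 for small t since
    they are inactive on I ([F_ad_perturb]). Minimality of u0 gives
    j''(u0)(v, v) >= 0 ([second_order_condition]).

    If x4 - x1 is small, however, then |v|_{H^1} dominates: the Fourier series of
    v bounds sup |v| by a multiple of |v|_{H^1} ([sup_le_H1]), so that the L^2
    norm of v, and by Young's inequality on each mode its H^s norm, is at most a
    small multiple of |v|_{H^1} ([short_support]), and the assumption on j''(u0)
    makes j''(u0)(v, v) negative. Thus there is e > 0 such that G has at most
    three values on any interval of I of length e not crossing the origin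
    ([few_values_on_short_intervals]).

    An interval on which G has finitely many values is cut into intervals on
    which G is constant, and these only carry mass at an end point
    ([carried_few_values]). Finally I is covered by two points and two intervals
    of ]0, T[ ([component_intervals]), hence by finitely many such pieces. *)

(** * Locally bounded measurable functions and their primitives *)

Section interval_integrals.
Context {R : realType}.
Implicit Types (f g : R -> R) (a b c d x y : R).
Local Notation leb := (@lebesgue_measure R).

(** Integrands are taken in this class since, unlike integrability, it is stable
    under products. *)
Definition loc_bounded f : Prop :=
  measurable_fun setT f /\
  forall M : R, exists C : R, forall x, `|x| <= M -> `|f x| <= C.

Definition itv_int f a b : R := \int[leb]_(x in `]a, b]) f x.

(** For each x one of the two terms is an integral over an empty interval. *)
Definition prim f x : R := itv_int f 0 x - itv_int f x 0.

Lemma loc_boundedD f g : loc_bounded f -> loc_bounded g ->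
  loc_bounded (fun x => f x + g x).
Proof.
move=> [mf bf] [mg bg]; split; first exact: measurable_funD.
move=> M; have [C hC] := bf M; have [D hD] := bg M; exists (C + D) => x xM.
by rewrite (le_trans (ler_normD _ _))// lerD ?hC ?hD.
Qed.

Lemma loc_boundedM f g : loc_bounded f -> loc_bounded g ->
  loc_bounded (fun x => f x * g x).
Proof.
move=> [mf bf] [mg bg]; split; first exact: measurable_funM.
move=> M; have [C hC] := bf M; have [D hD] := bg M; exists (C * D) => x xM.
by rewrite normrM ler_pM ?hC ?hD.
Qed.

Lemma loc_bounded_cst c : loc_bounded (fun=> c).
Proof. by split=> [|M]; [exact: measurable_cst|exists `|c|]. Qed.

Lemma loc_boundedN f : loc_bounded f -> loc_bounded (fun x => - f x).
Proof.
move=> lf; rewrite (_ : (fun x => - f x) = (fun x => -1 * f x)); last first.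
  by apply/funext => x; rewrite mulN1r.
by apply: loc_boundedM => //; exact: loc_bounded_cst.
Qed.

Lemma loc_boundedB f g : loc_bounded f -> loc_bounded g ->
  loc_bounded (fun x => f x - g x).
Proof. by move=> lf lg; apply: loc_boundedD => //; exact: loc_boundedN. Qed.

Lemma loc_bounded_continuous f : continuous f -> loc_bounded f.
Proof.
move=> cf; split; first exact: continuous_measurable_fun.
move=> M; have : compact (f @` `[- M, M]).
  apply: continuous_compact; last exact: segment_compact.
  exact: continuous_subspaceT.
move/compact_bounded => [C [_ hC]]; exists (`|C| + 1) => x xM.
apply: (hC (`|C| + 1)); first by rewrite ltr_pwDr// ler_norm.
by exists x => //=; rewrite in_itv/= -ler_norml.
Qed.

Lemma loc_bounded_nondecreasing f : {homo f : x y / x <= y} -> loc_bounded f.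
Proof.
move=> ndf; split; first by apply: nondecreasing_measurable => // x y _ _; exact: ndf.
move=> M; exists (`|f M| + `|f (- M)|) => x; rewrite ler_norml => /andP[Mx xM].
rewrite ler_norml; apply/andP; split.
  rewrite (le_trans _ (ndf _ _ Mx))// lerNl.
  by rewrite (le_trans (ler_norm _))// normrN lerDr.
by rewrite (le_trans (ndf _ _ xM))// (le_trans (ler_norm _))// lerDl.
Qed.

Lemma itv_norm_le a b x : a < x <= b -> `|x| <= `|a| + `|b|.
Proof.
move=> /andP[ax xb]; rewrite ler_norml; apply/andP; split.
  rewrite lerNl; apply: (@le_trans _ _ (- a)); first by rewrite lerN2 ltW.
  by apply: (le_trans (ler_norm _)); rewrite normrN lerDl.
by apply: (le_trans xb); apply: (le_trans (ler_norm _)); rewrite lerDr.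
Qed.

(** Written for an arbitrary measure because both Lebesgue measure and
    Stieltjes measures are integrated against. *)
Lemma loc_bounded_integrable (m : {measure set (measurableTypeR R) -> \bar R})
    f a b : loc_bounded f -> (m `]a, b]%classic < +oo)%E ->
  m.-integrable `]a, b] (EFin \o f).
Proof.
move=> [mf bf] moo; have [C hC] := bf (`|a| + `|b|).
apply: measurable_bounded_integrable => //.
  exact: measurable_funTS.
exists C; split; first by rewrite num_real.
move=> D CD x /=; rewrite in_itv/= => xab.
by apply: le_trans (ltW CD); apply: hC; exact: itv_norm_le.
Qed.

Lemma leb_itv_ltoo a b : (leb `]a, b]%classic < +oo)%E.
Proof. by rewrite lebesgue_measure_itv/=; case: ifPn => // _; rewrite ltry. Qed.

Lemma loc_bounded_itv f a b : loc_bounded f ->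
  leb.-integrable `]a, b] (EFin \o f).
Proof. by move=> lf; apply: loc_bounded_integrable => //; exact: leb_itv_ltoo. Qed.

Lemma itv_int_ge f a b : b <= a -> itv_int f a b = 0.
Proof.
by move=> ba; rewrite /itv_int set_itv_ge ?Rintegral_set0// bnd_simp -leNgt.
Qed.

Lemma itv_int_cat f a b c : loc_bounded f -> a <= b -> b <= c ->
  itv_int f a b + itv_int f b c = itv_int f a c.
Proof.
move=> lf ab bc; rewrite /itv_int.
have E : `]a, c]%classic = `]a, b]%classic `|` `]b, c]%classic :> set R.
  by apply: itv_bndbnd_setU; rewrite bnd_simp.
rewrite E Rintegral_setU//.
  by rewrite -E; exact: loc_bounded_itv.
apply/disj_setPS => x [] /=; rewrite !in_itv/= => /andP[_ xb] /andP[bx _].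
by move: (le_lt_trans xb bx); rewrite ltxx.
Qed.

Lemma primB f a b : loc_bounded f -> a <= b -> prim f b - prim f a = itv_int f a b.
Proof.
move=> lf ab; rewrite /prim.
have [a0|a0] := leP 0 a.
  rewrite (itv_int_ge f a0) (itv_int_ge f (le_trans a0 ab)).
  by rewrite -(itv_int_cat lf a0 ab); ring.
have [b0|b0] := leP b 0.
  rewrite (itv_int_ge f b0) (itv_int_ge f (ltW a0)).
  by rewrite -(itv_int_cat lf ab b0); ring.
rewrite (itv_int_ge f (ltW b0)) (itv_int_ge f (ltW a0)).
by rewrite -(itv_int_cat lf (ltW a0) (ltW b0)); ring.
Qed.

Lemma prim0 f : prim f 0 = 0.
Proof. by rewrite /prim subrr. Qed.

Lemma itv_intD f g a b : loc_bounded f -> loc_bounded g ->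
  itv_int (fun x => f x + g x) a b = itv_int f a b + itv_int g a b.
Proof. by move=> lf lg; rewrite /itv_int RintegralD//; exact: loc_bounded_itv. Qed.

Lemma itv_intZ c f a b : loc_bounded f ->
  itv_int (fun x => c * f x) a b = c * itv_int f a b.
Proof. by move=> lf; rewrite /itv_int RintegralZl//; exact: loc_bounded_itv. Qed.

Lemma itv_intN f a b : loc_bounded f ->
  itv_int (fun x => - f x) a b = - itv_int f a b.
Proof.
move=> lf; rewrite -mulN1r -itv_intZ//.
by apply: eq_Rintegral => x _; rewrite mulN1r.
Qed.

Lemma itv_intB f g a b : loc_bounded f -> loc_bounded g ->
  itv_int (fun x => f x - g x) a b = itv_int f a b - itv_int g a b.
Proof. by move=> lf lg; rewrite itv_intD ?itv_intN//; exact: loc_boundedN. Qed.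

Lemma itv_int_lin c d f g a b : loc_bounded f -> loc_bounded g ->
  itv_int (fun x => c * f x + d * g x) a b = c * itv_int f a b + d * itv_int g a b.
Proof.
move=> lf lg; rewrite itv_intD ?itv_intZ//.
- by apply: loc_boundedM => //; exact: loc_bounded_cst.
- by apply: loc_boundedM => //; exact: loc_bounded_cst.
Qed.

Lemma itv_int_cst c a b : a <= b -> itv_int (fun=> c) a b = c * (b - a).
Proof.
move=> ab; rewrite /itv_int Rintegral_cst//; congr (_ * _).
rewrite -[X in fine X]/(leb `]a, b]%classic) lebesgue_measure_itv/= lte_fin.
by move: ab; rewrite le_eqVlt => /predU1P[->|->//]; rewrite ltxx subrr.
Qed.

Lemma eq_itv_int f g a b : (forall x, a < x <= b -> f x = g x) ->
  itv_int f a b = itv_int g a b.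
Proof.
move=> fg; apply: eq_Rintegral => x; rewrite inE/= in_itv/=; exact: fg.
Qed.

Lemma ae_eq_itv_int f g a b : loc_bounded f -> measurable_fun setT g ->
  (\forall x \ae leb, a < x <= b -> f x = g x) ->
  itv_int f a b = itv_int g a b.
Proof.
move=> [mf _] mg fg; rewrite /itv_int /Rintegral; congr fine.
apply: ae_eq_integral => //.
- by apply/measurable_EFinP; exact: measurable_funTS.
- by apply/measurable_EFinP; exact: measurable_funTS.
apply: (@filterS _ _ (ae_filter_ringOfSetsType leb)) fg => x h; rewrite /= in_itv/= => xab.
by rewrite h.
Qed.

Lemma le_itv_int f g a b : loc_bounded f -> loc_bounded g ->
  (forall x, a < x <= b -> f x <= g x) -> itv_int f a b <= itv_int g a b.
Proof.
move=> lf lg fg; apply: le_Rintegral => //; first exact: loc_bounded_itv.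
exact: loc_bounded_itv.
Qed.

Lemma itv_int_norm_le f a b C : loc_bounded f -> a <= b ->
  (forall x, a < x <= b -> `|f x| <= C) -> `|itv_int f a b| <= C * (b - a).
Proof.
move=> lf ab fC; rewrite ler_norml; apply/andP; split.
  rewrite -mulNr -itv_int_cst//; apply: le_itv_int => //; first exact: loc_bounded_cst.
  by move=> x /fC; rewrite ler_norml => /andP[].
rewrite -itv_int_cst//; apply: le_itv_int => //; first exact: loc_bounded_cst.
by move=> x /fC; rewrite ler_norml => /andP[].
Qed.

Lemma prim_lipschitz f (M : R) : loc_bounded f -> exists2 C, 0 < C &
  forall x y, `|x| <= M -> `|y| <= M -> `|prim f x - prim f y| <= C * `|x - y|.
Proof.
move=> lf; have [C hC] := lf.2 M; exists (`|C| + 1); first by rewrite ltr_wpDl.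
have key x y : x <= y -> `|x| <= M -> `|y| <= M ->
    `|prim f y - prim f x| <= (`|C| + 1) * `|y - x|.
  move=> xy xM yM; rewrite primB// [X in _ * X]ger0_norm ?subr_ge0//.
  apply: itv_int_norm_le => // t /andP[xt ty].
  rewrite (@le_trans _ _ C)//; last by rewrite ler_wpDr// ler_norm.
  apply: hC; move: xM yM; rewrite !ler_norml => /andP[Mx _] /andP[_ yM].
  by rewrite (le_trans Mx (ltW xt)) (le_trans ty).
move=> x y xM yM; have [xy|/ltW yx] := leP x y; last exact: key.
by rewrite distrC [X in _ * X]distrC; exact: key.
Qed.

Lemma prim_continuous f : loc_bounded f -> continuous (prim f).
Proof.
move=> lf x; have [C C0 hC] := prim_lipschitz (`|x| + 1) lf.
apply/cvgrPdist_le => e e0; near=> y.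
have xy : `|x - y| <= 1 by near: y; apply: cvgr_dist_le => //; exact: cvg_id.
apply: (le_trans (hC _ _ _ _)).
- by rewrite lerDl.
- rewrite (_ : y = x - (x - y)); last by ring.
  by rewrite (le_trans (ler_normB _ _))// lerD2l.
rewrite mulrC -ler_pdivlMr//; near: y.
by apply: cvgr_dist_le; [exact: cvg_id|rewrite divr_gt0].
Unshelve. all: by end_near. Qed.

Lemma loc_bounded_prim f : loc_bounded f -> loc_bounded (prim f).
Proof. by move=> lf; apply: loc_bounded_continuous; exact: prim_continuous. Qed.

Lemma prim_is_derive f x : loc_bounded f -> {for x, continuous f} ->
  is_derive x 1 (prim f) (f x).
Proof.
move=> lf cf; pose a := x - 1.
have ax : a < x by rewrite ltrBlDr ltrDl.
have E : \forall y \near x, (itv_int f a y + prim f a) = prim f y.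
  near=> y; rewrite -primB//; first by rewrite subrK.
  by apply: ltW; near: y; exact: lt_nbhsr.
apply: near_eq_is_derive E _ => //.
have xx1 : x < x + 1 by rewrite ltrDl.
have aBx : (BRight a < BRight x)%O by rewrite bnd_simp.
have [d1 d2] := continuous_FTC1 xx1 (loc_bounded_itv a (x + 1) lf) aBx cf.
rewrite -[f x]addr0; apply: is_deriveD.
by rewrite -d2 derive1E; exact: derivableP.
Unshelve. all: by end_near. Qed.

End interval_integrals.

Ltac loc_bounded_tac := solve [repeat first
  [ assumption | exact: loc_bounded_cst | apply: loc_bounded_prim
  | apply: loc_boundedB | apply: loc_boundedN
  | apply: loc_boundedD | apply: loc_boundedM ]].

(** * Exchanging integrals over a triangle *)

Section triangle.
Context {R : realType}.
Implicit Types (f g : R -> R) (a b c x y : R).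
Local Notation leb := (@lebesgue_measure R).

(** This single exchange of integrals yields integration by parts both for
    Lebesgue integrals of primitives and for Stieltjes measures. *)
Lemma triangle_Fubini
    (m1 m2 : {sigma_finite_measure set (measurableTypeR R) -> \bar R})
    f g a b : loc_bounded f -> loc_bounded g ->
  (m1 `]a, b]%classic < +oo)%E -> (m2 `]a, b]%classic < +oo)%E ->
  \int[m1]_(x in `]a, b]) (f x * \int[m2]_(t in `]a, x[) g t) =
  \int[m2]_(t in `]a, b]) (g t * \int[m1]_(x in `]t, b]) f x).
Proof.
move=> lf lg m1oo m2oo.
pose D : set R := `]a, b]%classic.
have mD : measurable D by exact: measurable_itv.
pose F (z : measurableTypeR R * measurableTypeR R) : R :=
  (f z.1 * \1_D z.1) * (g z.2 * \1_D z.2) * ((z.2 : R) < z.1)%R%:R.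
have [C hC] := lf.2 (`|a| + `|b|); have [K hK] := lg.2 (`|a| + `|b|).
have bnd h (B : R) : (forall x, `|x| <= `|a| + `|b| -> `|h x| <= B) ->
    forall x, `|h x * \1_D x| <= `|B| * \1_D x.
  move=> hB x; rewrite normrM indicE; case: (boolP (x \in D)) => xD.
    rewrite normr1 !mulr1 (le_trans _ (ler_norm B))// hB//.
    by apply: itv_norm_le; move: xD; rewrite inE /D/= in_itv/=.
  by rewrite normr0 !mulr0.
have mind h : loc_bounded h -> measurable_fun setT (fun x => h x * \1_D x).
  by move=> [mh _]; apply: measurable_funM => //; exact: measurable_indic.
have mF : measurable_fun setT (EFin \o F).
  apply/measurable_EFinP; apply: measurable_funM.
    apply: measurable_funM.
      exact: (measurableT_comp (mind _ lf) measurable_fst).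
    exact: (measurableT_comp (mind _ lg) measurable_snd).
  rewrite (_ : (fun z => _) = (fun b : bool => b%:R : R) \o (fun z => (z.2 : R) < z.1)) //.
  apply: measurableT_comp => //.
  by apply: measurable_fun_ltr; [exact: measurable_snd|exact: measurable_fst].
have intF : (m1 \x m2)%E.-integrable setT (EFin \o F).
  apply/integrable12ltyP => //.
  have mI : measurable_fun setT (fun x => (\1_D x : R)%:E).
    by apply/measurable_EFinP; exact: measurable_indic.
  have nI0 (x : measurableTypeR R) : setT x -> (0 <= (\1_D x : R)%:E)%E by rewrite lee_fin.
  have intI (m : {measure set (measurableTypeR R) -> \bar R}) (c : R) :
      (\int[m]_x ((`|c| * \1_D x)%:E) = `|c|%:E * m D)%E.
    under eq_integral do rewrite EFinM.
    have c0 : (0 <= `|c|%:E)%E by rewrite lee_fin.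
    by rewrite (ge0_integralZl m measurableT mI nI0 c0) integral_indic// setIT.
  have mcI c : measurable_fun setT (fun x => (`|c| * \1_D x)%:E).
    by apply/measurable_EFinP; apply: measurable_funM => //; exact: measurable_indic.
  have ncI0 (c : R) (x : measurableTypeR R) : setT x -> (0 <= (`|c| * \1_D x)%:E)%E.
    by rewrite lee_fin mulr_ge0.
  apply: (@le_lt_trans _ _ (\int[m1]_x ((`|C| * \1_D x)%:E * (`|K|%:E * m2 D)))%E).
    apply: ge0_le_integral => //.
    - by move=> x _; exact: integral_ge0.
    - apply: (measurable_fun_fubini_tonelli_F (abse \o (EFin \o F))) => //=.
      exact: measurableT_comp.
    - apply: emeasurable_funM => //.
      by apply/measurable_EFinP; apply: measurable_funM => //; exact: measurable_indic.
    move=> x _; apply: (@le_trans _ _ (\int[m2]_y ((`|C| * \1_D x)%:E * (`|K| * \1_D y)%:E))%E).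
      apply: ge0_le_integral => //.
      - apply: measurableT_comp => //; apply: (measurableT_comp mF) => //.
      - apply: emeasurable_funM => //.
        by apply/measurable_EFinP; apply: measurable_funM => //; exact: measurable_indic.
      move=> y _; rewrite /F/= -EFinM lee_fin !normrM -[X in _ <= X]mulr1 ler_pM//.
      + rewrite -!normrM normrM ler_pM//; first exact: bnd hC x.
        exact: bnd hK y.
      + by rewrite normr_nat lern1; case: (y < x).
    have cI0 : (0 <= (`|C| * \1_D x)%:E)%E by rewrite lee_fin mulr_ge0.
    rewrite (ge0_integralZl m2 measurableT (mcI K) (ncI0 K) cI0).
    by rewrite lee_wpmul2l// intI.
  under eq_integral do rewrite muleC.
  have K0 : (0 <= `|K|%:E * m2 D)%E by rewrite mule_ge0.
  rewrite (ge0_integralZl m1 measurableT (mcI C) (ncI0 C) K0) intI.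
  by rewrite !lte_mul_pinfty// ?mule_ge0// fin_numM// ge0_fin_numE.
have := Fubini intF => FF.
rewrite /Rintegral.
have sub_int (m : {measure set (measurableTypeR R) -> \bar R}) h (E : set R) :
    loc_bounded h -> (m D < +oo)%E -> measurable E -> E `<=` D ->
    m.-integrable E (fun x => (h x)%:E).
  move=> lh moo mE ED; have iD := loc_bounded_integrable lh moo.
  exact: (@integrableS _ _ _ m D E _ _ _ ED iD).
congr fine.
transitivity (\int[m1]_x \int[m2]_y (EFin \o F) (x, y))%E.
  rewrite integral_mkcond; apply: eq_integral => x _.
  rewrite patchE; case: ifPn => xD; last first.
    rewrite (_ : (fun y => _) = cst 0%E) ?integral0//; apply/funext => y /=.
    by rewrite /F/= indicE (negbTE xD) mulr0 !mul0r.
  move: (xD); rewrite inE /D/= in_itv/= => /andP[ax xb].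
  have sD : `]a, x[%classic `<=` D.
    by move=> y/=; rewrite /D/= !in_itv/= => /andP[-> /ltW yx]; rewrite (le_trans yx).
  rewrite EFinM fineK; last by apply: integrable_fin_num => //; exact: sub_int.
  rewrite -integralZl//; last exact: sub_int.
  rewrite integral_mkcond; apply: eq_integral => y _.
  rewrite patchE /F/= !indicE xD mulr1; case: ifPn => yD.
    rewrite (mem_set (sD _ (set_mem yD))) mulr1.
    by move: yD; rewrite inE/= in_itv/= => /andP[_ ->]; rewrite mulr1.
  have [yx|yx] := boolP ((y : R) < x)%R; last by rewrite mulr0.
  case: (boolP (y \in D)) => yD'; last by rewrite !mulr0 mul0r.
  move: yD; rewrite notin_setE/= in_itv/= yx andbT.
  by move: yD'; rewrite inE /D/= in_itv/= => /andP[-> _].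
rewrite FF.
symmetry; rewrite integral_mkcond; apply: eq_integral => y _.
rewrite patchE; case: ifPn => yD; last first.
  rewrite (_ : (fun y => _) = cst 0%E) ?integral0//; apply/funext => x /=.
  by rewrite /F/= !indicE (negbTE yD) !mulr0 !mul0r.
move: (yD); rewrite inE /D/= in_itv/= => /andP[ay yb].
have sD : `]y, b]%classic `<=` D.
  by move=> x/=; rewrite /D/= !in_itv/= => /andP[yx ->]; rewrite (lt_trans ay).
rewrite EFinM fineK; last by apply: integrable_fin_num => //; exact: sub_int.
rewrite -integralZl//; last exact: sub_int.
rewrite integral_mkcond; apply: eq_integral => x _.
rewrite patchE /F/= !indicE yD mulr1; case: ifPn => xD.
  rewrite (mem_set (sD _ (set_mem xD))) mulr1.
  by move: xD; rewrite inE/= in_itv/= => /andP[-> _]; rewrite mulr1 mulrC.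
have [yx|yx] := boolP ((y : R) < x)%R; last by rewrite mulr0.
case: (boolP (x \in D)) => xD'; last by rewrite !mulr0 !mul0r.
move: xD; rewrite notin_setE/= in_itv/= yx /=.
by move: xD'; rewrite inE /D/= in_itv/= => /andP[_ ->].
Qed.

End triangle.

Section integration_by_parts.
Context {R : realType}.
Implicit Types (f g : R -> R) (a b c x y : R) (G : cumulative R R).
Local Notation leb := (@lebesgue_measure R).

Lemma itv_int_open f a b : loc_bounded f -> a <= b ->
  \int[leb]_(x in `]a, b[) f x = prim f b - prim f a.
Proof.
move=> lf ab; rewrite primB// Rintegral_itv_bndo_bndc//.
apply: (@integrableS _ _ _ leb `]a, b]%classic) => //; last exact: loc_bounded_itv.
by move=> x /=; rewrite !in_itv/= => /andP[-> /ltW ->].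
Qed.

Lemma prim_by_parts f g a b : loc_bounded f -> loc_bounded g -> a <= b ->
  itv_int (fun x => f x * prim g x + prim f x * g x) a b =
  prim f b * prim g b - prim f a * prim g a.
Proof.
move=> lf lg ab.
have := triangle_Fubini lf lg (leb_itv_ltoo a b) (leb_itv_ltoo a b).
have lP h : loc_bounded h -> loc_bounded (prim h) by exact: loc_bounded_prim.
have -> : \int[leb]_(x in `]a, b]) (f x * \int[leb]_(t in `]a, x[) g t) =
    itv_int (fun x => f x * prim g x) a b - prim g a * itv_int f a b.
  rewrite -itv_intZ// -itv_intB//.
  - by apply: eq_itv_int => x /andP[ax _]; rewrite itv_int_open ?(ltW ax)//; ring.
  - by apply: loc_boundedM => //; exact: lP.
  - by apply: loc_boundedM => //; exact: loc_bounded_cst.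
have -> : \int[leb]_(t in `]a, b]) (g t * \int[leb]_(x in `]t, b]) f x) =
    prim f b * itv_int g a b - itv_int (fun x => prim f x * g x) a b.
  rewrite -itv_intZ// -itv_intB//.
  - apply: eq_itv_int => x /andP[_ xb]; rewrite -[X in g x * X]/(itv_int f x b) -primB//.
    by ring.
  - by apply: loc_boundedM => //; exact: loc_bounded_cst.
  - by apply: loc_boundedM => //; exact: lP.
rewrite itv_intD//; last 2 first.
- by apply: loc_boundedM => //; exact: lP.
- by apply: loc_boundedM => //; exact: lP.
by rewrite -(primB lf ab) -(primB lg ab) => h; lra.
Qed.

Lemma stieltjes_itv G a b : a <= b ->
  lebesgue_stieltjes_measure G `]a, b]%classic = (G b - G a)%:E.
Proof.
move=> ab; rewrite /lebesgue_stieltjes_measure/= /measure_extension/=.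
rewrite -[RHS](wlength_itv_bnd G false false ab).
by rewrite measurable_mu_extE//; exact: is_ocitv.
Qed.

Lemma stieltjes_itv_ltoo G a b : (lebesgue_stieltjes_measure G `]a, b]%classic < +oo)%E.
Proof.
have [ab|/ltW ba] := leP a b; first by rewrite stieltjes_itv// ltry.
by rewrite set_itv_ge ?measure0// bnd_simp -leNgt.
Qed.

Lemma stieltjes_cst G c a b : a <= b ->
  \int[lebesgue_stieltjes_measure G]_(x in `]a, b]) c = c * (G b - G a).
Proof.
move=> ab; rewrite Rintegral_cst//; congr (_ * _).
by rewrite -[X in fine X]/(lebesgue_stieltjes_measure G `]a, b]%classic) stieltjes_itv.
Qed.

Lemma loc_bounded_cumulative G : loc_bounded G.
Proof. apply: loc_bounded_nondecreasing; exact: cumulative_is_nondecreasing. Qed.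

(** There is no jump term because [prim f] is continuous. *)
Lemma stieltjes_by_parts G f a b : loc_bounded f -> a <= b ->
  \int[lebesgue_stieltjes_measure G]_(x in `]a, b]) prim f x =
  prim f b * G b - prim f a * G a - itv_int (fun x => f x * G x) a b.
Proof.
move=> lf ab.
have := triangle_Fubini (loc_bounded_cst 1) lf (stieltjes_itv_ltoo G a b) (leb_itv_ltoo a b).
have intS h : loc_bounded h ->
    (lebesgue_stieltjes_measure G).-integrable `]a, b] (EFin \o h).
  by move=> lh; apply: loc_bounded_integrable => //; exact: stieltjes_itv_ltoo.
have -> : \int[lebesgue_stieltjes_measure G]_(x in `]a, b]) (1 * \int[leb]_(t in `]a, x[) f t) =
   \int[lebesgue_stieltjes_measure G]_(x in `]a, b]) prim f x - prim f a * (G b - G a).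
  have -> : prim f a * (G b - G a) = \int[lebesgue_stieltjes_measure G]_(x in `]a, b]) prim f a.
    by rewrite stieltjes_cst.
  rewrite -RintegralB//; last 2 first.
  - by apply: intS; exact: loc_bounded_prim.
  - by apply: intS; exact: loc_bounded_cst.
  apply: eq_Rintegral => x; rewrite inE/= in_itv/= => /andP[ax _].
  by rewrite mul1r itv_int_open// ltW.
have -> : \int[leb]_(t in `]a, b])
    (f t * \int[lebesgue_stieltjes_measure G]_(x in `]t, b]) 1) =
   G b * itv_int f a b - itv_int (fun x => f x * G x) a b.
  rewrite -itv_intZ// -itv_intB//; last 2 first.
  - by apply: loc_boundedM => //; exact: loc_bounded_cst.
  - by apply: loc_boundedM => //; exact: loc_bounded_cumulative.
  apply: eq_itv_int => x /andP[_ xb].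
  by rewrite stieltjes_cst//; ring.
by rewrite -primB// => h; lra.
Qed.

End integration_by_parts.

(** * Weak derivatives of continuous functions *)

Section weak_derivatives.
Context {R : realType}.
Implicit Types (f g u w k phi : R -> R) (a b c d x y M C : R).
Local Notation leb := (@lebesgue_measure R).

Lemma Rintegral_compact f M : (forall x, M <= `|x| -> f x = 0) ->
  \int[leb]_x f x = itv_int f (- M) M.
Proof.
move=> f0; rewrite /itv_int Rintegral_mkcond [RHS]Rintegral_mkcond.
apply: eq_Rintegral => x _; rewrite !patchE in_setT.
case: ifPn => //; rewrite notin_setE/= in_itv/= => /negP xM.
rewrite f0// leNgt; apply: contra xM; rewrite ltr_norml => /andP[-> /ltW].
by [].
Qed.

Lemma is_derive_primE f g : continuous g -> (forall x, is_derive x 1 f (g x)) ->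
  forall x, f x = f 0 + prim g x.
Proof.
move=> cg df x; apply/eqP; rewrite -subr_eq; apply/eqP.
have lg := loc_bounded_continuous cg.
have d y : is_derive y 1 (fun x => f x - prim g x) 0.
  rewrite -[0](subrr (g y)); apply: is_deriveB.
  by apply: prim_is_derive => //; exact: cg.
by rewrite (is_derive_0_is_cst x 0 d) prim0 subr0.
Qed.

Lemma test_C1c_prim phi : test_C1c phi ->
  exists k M, [/\ continuous k, forall x, phi x = phi 0 + prim k x, derive1 phi = k &
    0 <= M /\ forall x, M <= `|x| -> phi x = 0 /\ k x = 0].
Proof.
move=> tphi; have [M [C [_ ck _ _ [phiM kM]]]] := test_C1c_bounded tphi.
exists (derive1 phi), (`|M| + 1); split => //.
- apply: is_derive_primE => // x; rewrite derive1E; apply: derivableP.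
  by case: tphi.
- split; first by rewrite addr_ge0.
  move=> x Mx; have {}Mx : M < `|x|.
    by apply: lt_le_trans Mx; rewrite ltr_pwDr// ler_norm.
  by rewrite phiM ?kM.
Qed.

(** Subtracting [prim k M] makes the primitive vanish on both sides of the
    support of [k]. *)
Lemma prim_test_C1c k M : continuous k -> 0 <= M ->
  (forall x, M <= `|x| -> k x = 0) -> itv_int k (- M) M = 0 ->
  test_C1c (fun x => prim k x - prim k M) /\
  derive1 (fun x => prim k x - prim k M) = k.
Proof.
move=> ck M0 kM k0; have lk := loc_bounded_continuous ck.
have d x : is_derive x 1 (fun x => prim k x - prim k M) (k x).
  rewrite -[k x]subr0; apply: is_deriveB.
  by apply: prim_is_derive => //; exact: ck.
have dE : derive1 (fun x => prim k x - prim k M) = k.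
  by apply/funext => x; rewrite derive1E; case: (d x).
split => //; split.
- by move=> x; case: (d x).
- by rewrite dE.
have primM : prim k (- M) = prim k M.
  by apply/eqP; rewrite eq_sym -subr_eq0 primB ?k0// ge0_cp.
exists M => x Mx; have [x0|x0] := leP 0 x.
  move: Mx; rewrite ger0_norm// => Mx; rewrite primB ?ltW//.
  rewrite (@eq_itv_int _ _ (fun=> 0)) ?itv_int_cst ?mul0r ?ltW//.
  move=> t /andP[Mt _]; apply: kM; rewrite ger0_norm ?ltW//.
  exact: le_lt_trans Mt.
move: Mx; rewrite ltr0_norm// => Mx.
have xM : x <= - M by lra.
rewrite -primM -opprB primB//.
rewrite (@eq_itv_int _ _ (fun=> 0)) ?itv_int_cst ?mul0r ?oppr0//.
move=> t /andP[_ tM]; apply: kM; rewrite ler0_norm; lra.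
Qed.

Let tent c d x : R := Num.max 0 (d - `|x - c|).

Let tent_ge0 c d x : 0 <= tent c d x.
Proof. by rewrite /tent le_max lexx. Qed.

Let tent_eq0 c d x : d <= `|x - c| -> tent c d x = 0.
Proof. by move=> h; rewrite /tent max_l// subr_le0. Qed.

Let tent_continuous c d : continuous (tent c d).
Proof.
move=> x; apply: (@continuous_max _ _ (cst 0) _ x); first exact: cvg_cst.
apply: cvgB; first exact: cvg_cst.
apply: cvg_norm; apply: cvgB; [exact: cvg_id|exact: cvg_cst].
Qed.

Let tent_int_gt0 c d M : 0 < d -> `|c| + d <= M -> 0 < itv_int (tent c d) (- M) M.
Proof.
move=> d0 cdM; have lt := loc_bounded_continuous (@tent_continuous c d).
have [cM Mc] : c + d <= M /\ - M <= c - d.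
  split; first by rewrite (le_trans _ cdM)// lerD2r ler_norm.
  by have := ler_norm (- c); rewrite normrN; lra.
have d20 : 0 < d / 2 by rewrite divr_gt0.
have h1 : - M <= c - d / 2 by lra.
have h2 : c - d / 2 <= c + d / 2 by lra.
have h3 : c + d / 2 <= M by lra.
have pos a b : a <= b -> 0 <= itv_int (tent c d) a b.
  move=> ab; rewrite -[0](mul0r (b - a)) -itv_int_cst//.
  by apply: le_itv_int => //; exact: loc_bounded_cst.
rewrite -(itv_int_cat lt h1 (le_trans h2 h3)) -(itv_int_cat lt h2 h3).
have : d / 2 * (c + d / 2 - (c - d / 2)) <= itv_int (tent c d) (c - d / 2) (c + d / 2).
  rewrite -itv_int_cst//; apply: le_itv_int => //; first exact: loc_bounded_cst.
  move=> x /andP[x1 x2]; rewrite /tent le_max; apply/orP; right.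
  have : `|x - c| <= d / 2 by rewrite ler_norml; apply/andP; split; lra.
  lra.
have : 0 < d / 2 * (c + d / 2 - (c - d / 2)) by rewrite mulr_gt0//; lra.
have := pos _ _ h1; have := pos _ _ h3; lra.
Qed.

(** Du Bois-Reymond's lemma: comparing the means of [w] over two small tents
    shows that [w] takes the same value at any two points. *)
Lemma continuous_orthogonal_cst w : continuous w ->
  (forall k M, continuous k -> 0 <= M -> (forall x, M <= `|x| -> k x = 0) ->
     itv_int k (- M) M = 0 -> itv_int (fun x => w x * k x) (- M) M = 0) ->
  forall x y, w x = w y.
Proof.
move=> cw ortho; suff lt x y : w x < w y -> False.
  by move=> x y; apply/eqP; rewrite eq_le !leNgt; apply/andP; split; apply/negP; exact: lt.
move=> wxy; pose m1 := (2 * w x + w y) / 3; pose m2 := (w x + 2 * w y) / 3.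
have wx1 : w x < m1 by rewrite /m1; lra.
have w2y : m2 < w y by rewrite /m2; lra.
have m12 : m1 < m2 by rewrite /m1 /m2; lra.
have /nbhs_ballP[d1 /= d10 hd1] : \forall z \near x, w z < m1.
  exact: (cvgr_lt (w x) (cw x)).
have /nbhs_ballP[d2 /= d20 hd2] : \forall z \near y, m2 < w z.
  exact: (cvgr_gt (w y) (cw y)).
pose d := Num.min d1 d2; have d0 : 0 < d by rewrite lt_min d10.
pose M := `|x| + `|y| + d.
have M0 : 0 <= M by rewrite !addr_ge0// ltW.
have xM : `|x| + d <= M by rewrite /M lerD2r lerDl.
have yM : `|y| + d <= M by rewrite /M lerD2r lerDr.
have NM : - M <= M by rewrite ge0_cp.
have ctx := @tent_continuous x d; have cty := @tent_continuous y d.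
have lx := loc_bounded_continuous ctx; have ly := loc_bounded_continuous cty.
have lw := loc_bounded_continuous cw.
have A0 := tent_int_gt0 d0 xM; have B0 := tent_int_gt0 d0 yM.
set A := itv_int _ _ _ in A0; set B := itv_int _ _ _ in B0.
have out c z : `|c| + d <= M -> M <= `|z| -> tent c d z = 0.
  move=> cM Mz; apply: tent_eq0; have := lerB_dist z c; lra.
have e : B * itv_int (fun z => w z * tent x d z) (- M) M =
    A * itv_int (fun z => w z * tent y d z) (- M) M.
  apply/eqP; rewrite -subr_eq0 -mulNr; apply/eqP.
  rewrite -(@itv_int_lin _ _ _ (fun z => w z * tent x d z) (fun z => w z * tent y d z));
    try loc_bounded_tac.
  transitivity (itv_int (fun z => w z * (B * tent x d z + - A * tent y d z)) (- M) M).
    by apply: eq_itv_int => z _; ring.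
  apply: ortho => //.
  - by move=> z; apply: cvgD; apply: cvgM; [exact: cvg_cst|exact: ctx|exact: cvg_cst|exact: cty].
  - by move=> z Mz; rewrite !out// !mulr0 addr0.
  - by rewrite itv_int_lin// -/A -/B mulNr mulrC subrr.
have h1 : itv_int (fun z => w z * tent x d z) (- M) M <= m1 * A.
  rewrite -itv_intZ//; apply: le_itv_int; try loc_bounded_tac.
  move=> z _; have [zd|zd] := leP d `|z - x|; first by rewrite tent_eq0// !mulr0.
  apply: ler_wpM2r => //; apply/ltW/hd1; rewrite /ball/= distrC.
  by apply: (lt_le_trans zd); rewrite ge_min lexx.
have h2 : m2 * B <= itv_int (fun z => w z * tent y d z) (- M) M.
  rewrite -itv_intZ//; apply: le_itv_int; try loc_bounded_tac.
  move=> z _; have [zd|zd] := leP d `|z - y|; first by rewrite tent_eq0// !mulr0.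
  apply: ler_wpM2r => //; apply/ltW/hd2; rewrite /ball/= distrC.
  by apply: (lt_le_trans zd); rewrite ge_min lexx orbT.
have := ler_wpM2l (ltW B0) h1; rewrite e => h1'.
have := le_trans (ler_wpM2l (ltW A0) h2) h1'.
rewrite (_ : A * (m2 * B) = m2 * (A * B)); last by ring.
rewrite (_ : B * (m1 * A) = m1 * (A * B)); last by ring.
by rewrite ler_pM2r ?mulr_gt0// leNgt m12.
Qed.

Lemma prim_weak_derivative g c : loc_bounded g ->
  weak_derivative (fun x => c + prim g x) g.
Proof.
move=> lg phi /test_C1c_prim[k [M [ck phiE -> [M0 hM]]]].
have lk := loc_bounded_continuous ck; have lpg := loc_bounded_prim lg.
have lpk := loc_bounded_prim lk.
rewrite (@Rintegral_compact _ M); last by move=> x /hM[_ ->]; rewrite mulr0.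
rewrite (@Rintegral_compact _ M); last by move=> x /hM[-> _]; rewrite mulr0.
have NM : - M <= M by rewrite ge0_cp.
have phiM : phi M = 0 by apply: (hM _ _).1; rewrite ler_norm.
have phiNM : phi (- M) = 0 by apply: (hM _ _).1; rewrite normrN ler_norm.
have IP := prim_by_parts lk lg NM.
rewrite (_ : (fun x => (c + prim g x) * k x) = (fun x => c * k x + k x * prim g x));
  last by apply/funext => x; ring.
rewrite (_ : (fun x => g x * phi x) = (fun x => phi 0 * g x + prim k x * g x));
  last by apply/funext => x; rewrite phiE; ring.
rewrite !itv_intD ?itv_intZ; try loc_bounded_tac.
move: IP; rewrite itv_intD; try loc_bounded_tac.
rewrite -(primB lk NM) -(primB lg NM).
have -> : prim k M = - phi 0 by have := phiE M; rewrite phiM; lra.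
have -> : prim k (- M) = - phi 0 by have := phiE (- M); rewrite phiNM; lra.
by move=> h; lra.
Qed.

(** The difference of u and [prim g] is continuous with zero weak derivative. *)
Lemma weak_derivative_primE u g : continuous u -> loc_bounded g ->
  weak_derivative u g -> forall x, u x = u 0 + prim g x.
Proof.
move=> cu lg ug x; have lu := loc_bounded_continuous cu.
have lpg := loc_bounded_prim lg.
suff /(_ x 0) : forall x y, u x - prim g x = u y - prim g y by rewrite prim0; lra.
apply: continuous_orthogonal_cst.
  by move=> y; apply: cvgB; [exact: cu|exact: prim_continuous].
move=> k M ck M0 kM k0; have lk := loc_bounded_continuous ck.
have [tk dk] := prim_test_C1c ck M0 kM k0.
have := ug _ tk; rewrite dk.
have : weak_derivative (fun x => 0 + prim g x) g by exact: prim_weak_derivative.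
move=> /(_ _ tk); rewrite dk => <-.
rewrite (@Rintegral_compact _ M); last by move=> y /kM ->; rewrite mulr0.
rewrite (@Rintegral_compact _ M); last by move=> y /kM ->; rewrite mulr0.
rewrite (_ : (fun x => (u x - prim g x) * k x) =
  (fun x => u x * k x - (0 + prim g x) * k x)); last by apply/funext => y; ring.
by rewrite itv_intB; try loc_bounded_tac; move=> ->; rewrite subrr.
Qed.

(** Truncation at the essential bound turns an essentially bounded function into
    one that is bounded everywhere. *)
Lemma Linfty_trunc g : g \in Linfty R ->
  exists2 h, loc_bounded h & \forall x \ae leb, g x = h x.
Proof.
move=> gL; have mg := Linfty_measurable gL; have [B B0 gB] := Linfty_bounded gL.
exists (fun x => Num.max (- B) (Num.min B (g x))).
  split.
    apply: measurable_maxr => //; apply: measurable_minr => //.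
  move=> M0; exists B => x _; rewrite ler_norml le_max lexx /= ge_max ge_min lexx /=.
  by rewrite andbT ge0_cp.
apply: (@filterS _ _ (ae_filter_ringOfSetsType leb)) gB => x.
by rewrite ler_norml => /andP[h1 h2]; rewrite min_r// max_r.
Qed.

Lemma weak_derivative_ae u g h : g \in Linfty R -> loc_bounded h ->
  (\forall x \ae leb, g x = h x) -> weak_derivative u g -> weak_derivative u h.
Proof.
move=> gL [mh _] gh ug phi tphi; rewrite (ug _ tphi); congr (- _).
have [k [M [ck phiE _ _]]] := test_C1c_prim tphi.
have mphi : measurable_fun setT phi.
  have lk := loc_bounded_prim (loc_bounded_continuous ck).
  rewrite (_ : phi = (fun x => phi 0 + prim k x)); last exact/funext.
  by case: (loc_boundedD (loc_bounded_cst (phi 0)) lk).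
rewrite /Rintegral; congr fine; apply: ae_eq_integral => //.
- apply/measurable_EFinP; apply: measurable_funM => //; exact: Linfty_measurable.
- by apply/measurable_EFinP; apply: measurable_funM.
by apply: (@filterS _ _ (ae_filter_ringOfSetsType leb)) gh => x -> _.
Qed.

Lemma bounded_Linfty f C : measurable_fun setT f -> (forall x, `|f x| <= C) ->
  f \in Linfty R.
Proof.
move=> mf fC; rewrite inE; apply/andP; split; rewrite inE//=.
rewrite /finite_norm unlock lebesgue_setT_gt0.
by apply: (@le_lt_trans _ _ C%:E); [apply: ess_sup_ler => x; rewrite lee_fin|rewrite ltry].
Qed.

End weak_derivatives.

(** * Periodic primitives and functions on the circle *)

Section periodic.
Context {R : realType}.
Implicit Types (f g h : R -> R) (a b c d x y M C : R) (u v : W1inf R).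
Local Notation leb := (@lebesgue_measure R).
Local Notation T := (2 * pi : R).

Definition periodicT (X : Type) (f : R -> X) : Prop := forall x, f (x + T) = f x.

Lemma period_gt0 : 0 < T.
Proof. by rewrite mulr_gt0// pi_gt0. Qed.

Lemma itv_int_translate f a b c : loc_bounded f ->
  itv_int f (a + c) (b + c) = itv_int (fun x => f (x + c)) a b.
Proof.
move=> lf; rewrite /itv_int /Rintegral; congr fine.
pose tr (x : measurableTypeR R) : measurableTypeR R := (x : R) + c.
have mt : measurable_fun setT tr by exact: measurable_funD.
have preE d e : tr @^-1` `]d, e] = `]d - c, e - c]%classic.
  by apply/seteqP; split => x /=; rewrite !in_itv/= ltrBlDr lerBrDr.
set a' := a + c; set b' := b + c.
transitivity (\int[pushforward leb tr]_(x in `]a', b']) (f x)%:E)%E.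
  apply: eq_measure_integral => A mA _.
  apply: lebesgue_measure_unique => //.
  move=> X /ocitvP[->|[[d e] /= de ->]]; first by rewrite !measure0.
  rewrite [RHS]/pushforward preE !lebesgue_measure_itv/= !lte_fin ltrD2r.
  by rewrite de -!EFinD; congr EFin; ring.
have E : tr @^-1` `]a', b'] =
    `]a, b]%classic by rewrite preE /a' /b' !addrK.
rewrite integral_pushforward ?E//.
- by apply/measurable_EFinP; case: lf.
apply: (@loc_bounded_itv _ (fun x => f (x + c))); split.
  apply: (measurableT_comp _ mt); by case: lf.
move=> M; have [C hC] := lf.2 (M + `|c|); exists C => x xM.
by apply: hC; rewrite (le_trans (ler_normD _ _))// lerD2r.
Qed.

(** The representative modulo [T] is taken in ]0, T], to match the intervals of
    [itv_int]. *)
Definition wrapT x : R := x - T * (Num.ceil (x / T) - 1)%:~R.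

Lemma wrap_itv x : 0 < wrapT x <= T.
Proof.
have /andP[h1 h2] := ceil_itv (x / T); have T0 := period_gt0.
rewrite /wrapT subr_gt0 mulrC -ltr_pdivlMr// h1 /= lerBlDr.
rewrite ler_pdivrMr// in h2.
by rewrite intrB; lra.
Qed.

Lemma wrap_id x : 0 < x <= T -> wrapT x = x.
Proof.
have T0 := period_gt0; move=> /andP[x0 xT].
rewrite /wrapT (_ : Num.ceil (x / T) = 1%Z) ?subrr ?mulr0 ?subr0//.
apply/eqP; rewrite ceil_eq subrr divr_gt0//=.
by rewrite ler_pdivrMr// mul1r.
Qed.

Lemma wrap_shift x : wrapT (x + T) = wrapT x.
Proof.
have T0 := period_gt0; have Tn0 : T != 0 by rewrite gt_eqF.
rewrite /wrapT (_ : Num.ceil ((x + T) / T) = Num.ceil (x / T) + 1); last first.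
  have -> : (x + T) / T = x / T + 1 by rewrite [LHS]mulrDl divff.
  apply/eqP; rewrite ceil_eq addrK intrD lerD2r.
  have /andP[h1 h2] := ceil_itv (x / T); rewrite h2 andbT.
  by move: h1; rewrite intrB; lra.
by rewrite addrK intrB; ring.
Qed.

Lemma periodic_int (X : Type) (f : R -> X) (n : int) x : periodicT f -> f (x + T * n%:~R) = f x.
Proof.
move=> pf; have pn (k : nat) y : f (y + T * k%:R) = f y.
  elim: k y => [|k IH] y; first by rewrite mulr0 addr0.
  have -> : y + T * k.+1%:R = y + T * k%:R + T by rewrite -[k.+1%:R]natr1; ring.
  by rewrite pf IH.
case: n => k; first exact: pn.
rewrite NegzE mulrNz mulrN -[LHS](pn k.+1).
by rewrite subrK.
Qed.

Lemma periodic_wrap (X : Type) (f : R -> X) x : periodicT f -> f (wrapT x) = f x.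
Proof. by move=> pf; rewrite /wrapT -mulrN -mulrNz periodic_int. Qed.

Lemma measurable_wrap : measurable_fun setT wrapT.
Proof.
apply: measurable_funB => //; apply: measurable_funM => //.
apply: nondecreasing_measurable => // x y xy.
by rewrite ler_int lerD2r le_ceil// ler_pM2r// invr_gt0 period_gt0.
Qed.

Lemma wrap_norm_le x : `|wrapT x| <= T.
Proof. by have /andP[h1 h2] := wrap_itv x; rewrite gtr0_norm. Qed.

Lemma periodic_bounded f : loc_bounded f -> periodicT f -> exists C, forall x, `|f x| <= C.
Proof.
move=> lf pf; have [C hC] := lf.2 T; exists C => x.
by rewrite -(periodic_wrap x pf) hC// wrap_norm_le.
Qed.

Lemma loc_bounded_periodize f : loc_bounded f -> loc_bounded (f \o wrapT).
Proof.
move=> [mf bf]; split; first exact: (measurableT_comp mf measurable_wrap).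
by move=> M; have [C hC] := bf T; exists C => x _; rewrite hC// wrap_norm_le.
Qed.

Lemma periodic_periodize f : periodicT (f \o wrapT).
Proof. by move=> x; rewrite /= wrap_shift. Qed.

Lemma itv_int_periodize f a b : 0 <= a -> b <= T ->
  itv_int (f \o wrapT) a b = itv_int f a b.
Proof.
move=> a0 bT; apply: eq_itv_int => x /andP[ax xb] /=.
by rewrite wrap_id// (le_lt_trans a0 ax) (le_trans xb bT).
Qed.

Lemma prim_period f x : loc_bounded f -> periodicT f ->
  prim f (x + T) - prim f x = prim f T.
Proof.
move=> lf pf; have key a b : a <= b ->
    prim f (a + T) - prim f a = prim f (b + T) - prim f b.
  move=> ab; have : itv_int f (a + T) (b + T) = itv_int f a b.
    by rewrite itv_int_translate//; apply: eq_itv_int => y _; exact: pf.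
  have abT : a + T <= b + T by rewrite lerD2r.
  rewrite -(primB lf ab) -(primB lf abT).
  by move: (prim f _) (prim f _) (prim f _) (prim f _) => p q r t h; lra.
have -> : prim f T = prim f (0 + T) - prim f 0 by rewrite prim0 subr0 add0r.
by have [/key|/ltW/key] := leP x 0.
Qed.

Lemma primE_pos f x : 0 <= x -> prim f x = itv_int f 0 x.
Proof. by move=> x0; rewrite /prim (itv_int_ge f x0) subr0. Qed.

Lemma itv_int_period f a : loc_bounded f -> periodicT f ->
  itv_int f a (a + T) = itv_int f 0 T.
Proof.
move=> lf pf; have T0 := ltW period_gt0.
by rewrite -primB ?lerDl// prim_period// primE_pos.
Qed.

Lemma W1inf_periodic u : periodicT u.
Proof. by have := W1inf_funP u; rewrite inE => -[]. Qed.

(** Tents and perturbations are built by prescribing their derivative on a period;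
    the mean value must vanish for the primitive to be periodic. *)
Lemma W1inf_of_prim c f : loc_bounded f -> itv_int f 0 T = 0 ->
  exists u : W1inf R, (forall x, u x = c + prim (f \o wrapT) x) /\
    \forall x \ae leb, wderiv u x = f (wrapT x).
Proof.
move=> lf f0; have T0 := ltW period_gt0.
have lg := loc_bounded_periodize lf; have pg := periodic_periodize f.
set g := f \o wrapT in lg pg *.
have g0 : prim g T = 0 by rewrite primE_pos// itv_int_periodize.
pose w x := c + prim g x.
have pw : periodicT w by move=> x; rewrite /w; have := prim_period x lg pg; rewrite g0; lra.
have cw : continuous w.
  by move=> x; apply: cvgD; [exact: cvg_cst|exact: prim_continuous].
have gL : g \in Linfty R.
  by have [C hC] := periodic_bounded lg pg; apply: bounded_Linfty hC; case: lg.
have lw : loc_bounded w by exact: loc_bounded_continuous.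
have wg : weak_derivative w g by exact: prim_weak_derivative.
have ww : w \in @W1inf_pred R.
  rewrite inE; split => //; last by exists g.
  by have [C hC] := periodic_bounded lw pw; apply: bounded_Linfty hC; case: lw.
exists (MkW1inf ww); split => //.
exact: (@wderiv_ae _ (MkW1inf ww) g).
Qed.

Definition is_deriv u f : Prop :=
  [/\ loc_bounded f, periodicT f, forall x, u x = u 0 + prim f x &
      \forall x \ae leb, wderiv u x = f x].

(** The weak derivative has an everywhere defined representative which is
    bounded and periodic, so pairings can be computed on any period. *)
Lemma W1inf_deriv u : exists f, is_deriv u f.
Proof.
have T0 := ltW period_gt0; have [dL wd] := wderivP u.
have [h lh dh] := Linfty_trunc dL.
have uh := weak_derivative_primE (@W1inf_continuous _ u) lh (weak_derivative_ae dL lh dh wd).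
have h0 : itv_int h 0 T = 0.
  rewrite -primE_pos//; have := uh T.
  by have := W1inf_periodic u 0; rewrite add0r => ->; lra.
have [v [vE vh]] := W1inf_of_prim (u 0) lh h0.
have uv : v = u.
  apply: val_inj; apply/funext => x /=.
  rewrite -(periodic_wrap x (W1inf_periodic u)) -(periodic_wrap x (W1inf_periodic v)).
  have /andP[/ltW w0 wT] := wrap_itv x.
  by rewrite vE [RHS]uh !primE_pos// itv_int_periodize.
rewrite -uv in vE vh *; exists (h \o wrapT); split => //.
- exact: loc_bounded_periodize.
- exact: periodic_periodize.
Qed.

Lemma loc_bounded_W1inf u : loc_bounded u.
Proof. by apply: loc_bounded_continuous; exact: W1inf_continuous. Qed.

Lemma torus_itv_int f g : measurable_fun setT f -> loc_bounded g ->
  (\forall x \ae leb, f x = g x) ->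
  \int[leb]_(x in @torus R) f x = itv_int g 0 T.
Proof.
move=> mf lg fg; have intg D : D `<=` `[0, T] -> measurable D -> leb.-integrable D (EFin \o g).
  move=> DT mD; apply: (@integrableS _ _ _ leb `]-1, T]%classic) => //.
    move=> x /DT /=; rewrite !in_itv/= => /andP[x0 ->]; rewrite andbT; lra.
  exact: loc_bounded_itv.
transitivity (\int[leb]_(x in @torus R) g x).
  rewrite /Rintegral; congr fine; apply: ae_eq_integral => //.
  - exact: measurable_itv.
  - by apply/measurable_EFinP; exact: measurable_funTS.
  - by apply/measurable_EFinP; apply: measurable_funTS; case: lg.
  by apply: (@filterS _ _ (ae_filter_ringOfSetsType leb)) fg => x -> _.
rewrite /torus /itv_int Rintegral_itv_bndo_bndc; last first.
  apply: intg => //= x /=; rewrite !in_itv/= => /andP[-> /ltW ->//].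
rewrite Rintegral_itv_obnd_cbnd//.
by apply: intg => //= x /=; rewrite !in_itv/= => /andP[/ltW -> ->].
Qed.

Lemma weak_pairingE u v f g : is_deriv u f -> is_deriv v g ->
  weak_pairing u v = itv_int (fun x => u x * v x - f x * g x) 0 T.
Proof.
move=> [lf _ _ uf] [lg _ _ vg].
have lu := loc_bounded_W1inf u; have lv := loc_bounded_W1inf v.
have mw w := Linfty_measurable (wderivP w).1.
rewrite /weak_pairing; apply: torus_itv_int.
- apply: measurable_funB; [apply: measurable_funM; [by case: lu|by case: lv]|by apply: measurable_funM; exact: mw].
- loc_bounded_tac.
move: uf vg; apply: (@filterS2 _ _ (ae_filter_ringOfSetsType leb)) => x.
by move=> -> ->.
Qed.

Lemma is_deriv_period u v f g a : is_deriv u f -> is_deriv v g ->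
  weak_pairing u v = itv_int (fun x => u x * v x - f x * g x) a (a + T).
Proof.
move=> uf vg; rewrite (weak_pairingE uf vg) itv_int_period//.
- case: uf => lf _ _ _; case: vg => lg _ _ _.
  have lu := loc_bounded_W1inf u; have lv := loc_bounded_W1inf v.
  loc_bounded_tac.
- move=> x; rewrite !W1inf_periodic; case: uf => _ -> _ _.
  by case: vg => _ -> _ _.
Qed.

Lemma is_deriv_lin u v f g c : is_deriv u f -> is_deriv v g ->
  is_deriv (u + c *: v) (fun x => f x + c * g x).
Proof.
move=> [lf pf uf duf] [lg pg vg dvg]; split.
- loc_bounded_tac.
- by move=> x; rewrite pf pg.
- move=> x; change (u x + c * v x = u 0 + c * v 0 + prim (fun x => f x + c * g x) x).
  rewrite (uf x) (vg x).
  have lc : loc_bounded (fun x => c * g x) by loc_bounded_tac.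
  by rewrite /prim !itv_intD// !itv_intZ//; ring.
have [du wu] := wderivP u; have [dv wv] := wderivP v.
have E h k : (fun x => h x + c * k x) = (fun x : R => c * k x + h x) :> (R -> R).
  by apply/funext => x; rewrite addrC.
have := @wderiv_ae _ (u + c *: v) (fun x => wderiv u x + c * wderiv v x).
rewrite E -[X in weak_derivative X _]/(fun x => u x + c * v x) E => h.
have {}h := h (Linfty_lin c dv du)
   (weak_derivativeD c (W1inf_Linfty v) (W1inf_Linfty u) dv du wv wu).
move: h duf dvg; apply: (@filterS3 _ _ (ae_filter_ringOfSetsType leb)) => x.
by move=> -> -> ->; rewrite addrC.
Qed.

End periodic.

(** * Primitives and test functions localised in a period *)

Section primitives.
Context {R : realType}.
Implicit Types (f g h F H : R -> R) (a b c d x y z M C : R) (u v : W1inf R).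
Local Notation leb := (@lebesgue_measure R).
Local Notation T := (2 * pi : R).

(** A relation rather than an operation on f, to leave the constant of integration
    free. *)
Definition is_prim F f : Prop :=
  loc_bounded f /\ forall a b, a <= b -> F b - F a = itv_int f a b.

Lemma is_prim_prim f : loc_bounded f -> is_prim (prim f) f.
Proof. by move=> lf; split => // a b ab; rewrite primB. Qed.

Lemma is_primE F f x : is_prim F f -> F x = F 0 + prim f x.
Proof.
move=> [lf Ff]; have [x0|/ltW x0] := leP 0 x.
  by have := Ff _ _ x0; rewrite -primB// prim0; lra.
by have := Ff _ _ x0; rewrite -primB// prim0; lra.
Qed.

Lemma is_prim_cst_add F f c : loc_bounded f -> (forall x, F x = c + prim f x) ->
  is_prim F f.
Proof. by move=> lf FE; split => // a b ab; rewrite !FE -primB//; ring. Qed.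

Lemma is_deriv_prim u f : is_deriv u f -> is_prim u f.
Proof. by case=> lf _ uE _; exact: is_prim_cst_add uE. Qed.

Lemma loc_bounded_is_prim F f : is_prim F f -> loc_bounded F.
Proof.
move=> Ff; rewrite (_ : F = fun x => F 0 + prim f x); last first.
  by apply/funext => x; exact: is_primE.
case: Ff => lf _; loc_bounded_tac.
Qed.

Lemma continuous_is_prim F f : is_prim F f -> continuous F.
Proof.
move=> Ff; rewrite (_ : F = fun x => F 0 + prim f x); last first.
  by apply/funext => x; exact: is_primE.
move=> x; apply: cvgD; first exact: cvg_cst.
by apply: prim_continuous; case: Ff.
Qed.

Lemma is_prim_lin F f H h c d : is_prim F f -> is_prim H h ->
  is_prim (fun x => c * F x + d * H x) (fun x => c * f x + d * h x).
Proof.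
move=> [lf Ff] [lh Hh]; split; first by loc_bounded_tac.
by move=> a b ab; rewrite itv_int_lin// -Ff// -Hh//; ring.
Qed.

Lemma is_primD F f H h : is_prim F f -> is_prim H h ->
  is_prim (fun x => F x + H x) (fun x => f x + h x).
Proof.
move=> [lf Ff] [lh Hh]; split; first by loc_bounded_tac.
by move=> a b ab; rewrite itv_intD// -Ff// -Hh//; ring.
Qed.

Lemma is_primM F f H h : is_prim F f -> is_prim H h ->
  is_prim (fun x => F x * H x) (fun x => f x * H x + F x * h x).
Proof.
move=> Ff Hh; have lF := loc_bounded_is_prim Ff; have lH := loc_bounded_is_prim Hh.
have [lf Fi] := Ff; have [lh Hi] := Hh; split; first by loc_bounded_tac.
move=> a b ab; have lpf := loc_bounded_prim lf; have lph := loc_bounded_prim lh.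
transitivity (itv_int (fun x => (f x * prim h x + prim f x * h x) +
   (H 0 * f x + F 0 * h x)) a b); last first.
  by apply: eq_itv_int => x _; rewrite (is_primE x Ff) (is_primE x Hh); ring.
rewrite itv_intD; try loc_bounded_tac.
rewrite prim_by_parts// itv_int_lin// -Fi// -Hi//.
rewrite (is_primE a Ff) (is_primE b Ff) (is_primE a Hh) (is_primE b Hh); ring.
Qed.

(** By Lebesgue's differentiation theorem. *)
Lemma is_prim_ae_derive F f : is_prim F f -> \forall x \ae leb, is_derive (x : R) 1 F (f x).
Proof.
move=> Ff; have [lf _] := Ff.
have locf : locally_integrable setT f.
  split; [by case: lf|exact: openT|move=> K _ cK].
  have [M [_ KM]] := compact_bounded cK.
  have mK : measurable K by exact: compact_measurable.
  have : leb.-integrable K (EFin \o f).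
    apply: (@integrableS _ _ _ leb `](- (M + 2)), (M + 2)]%classic) => //.
      move=> x Kx /=; rewrite in_itv/=.
      have : `|x| < M + 2.
        by apply: (@le_lt_trans _ _ (M + 1)); [apply: (KM (M + 1)) => //; rewrite ltrDl|rewrite ltrD2l ltr1n].
      by rewrite ltr_norml => /andP[-> /ltW ->].
    exact: loc_bounded_itv.
  by case/integrableP.
have key (n : nat) : \forall x \ae leb, - n%:R < x -> is_derive (x : R) 1 F (f x).
  have := FTC1 (fun y => loc_bounded_itv (- n%:R) y lf) locf.
  apply: (@filterS _ _ (ae_filter_ringOfSetsType leb)) => x h nx.
  have aBx : (BRight (- n%:R) < BRight x)%O by rewrite bnd_simp.
  have [d1 d2] := h aBx.
  have E : \forall y \near x, (itv_int f (- n%:R) y + F (- n%:R)) = F y.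
    near=> y; case: Ff => _ <-; first by rewrite subrK.
    by apply: ltW; near: y; exact: lt_nbhsr.
  apply: near_eq_is_derive E _ => //.
  rewrite -[f x]addr0; apply: is_deriveD.
  by rewrite -d2 derive1E; exact: derivableP.
move: (ae_foralln key); apply: (@filterS _ _ (ae_filter_ringOfSetsType leb)) => x h.
apply: (h (Num.truncn `|x|).+1).
rewrite ltrNl (@le_lt_trans _ _ `|x|) ?truncnS_gt//.
by rewrite -normrN ler_norm.
Unshelve. all: by end_near. Qed.

(** The base point [a] is arbitrary: a test function may have to live around
    the origin of the circle. *)
Lemma W1inf_on_period a c h : loc_bounded h -> itv_int h a (a + T) = 0 ->
  exists v g, [/\ is_deriv v g, v a = c, (forall t, a < t <= a + T -> g t = h t) &
    forall t, a <= t <= a + T -> v t = c + itv_int h a t].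
Proof.
move=> lh h0; have T0 := ltW (@period_gt0 R).
pose g t := h (a + wrapT (t - a)).
have lg : loc_bounded g.
  split.
    apply: (measurableT_comp lh.1) => //; apply: measurable_funD => //.
    by apply: (measurableT_comp (@measurable_wrap R)); apply: measurable_funB.
  move=> M; have [C hC] := lh.2 (`|a| + T); exists C => x _; apply: hC.
  by rewrite (le_trans (ler_normD _ _))// lerD2l wrap_norm_le.
have pg : periodicT g by move=> x; rewrite /g addrAC wrap_shift.
have gh t : a < t <= a + T -> g t = h t.
  by move=> /andP[t1 t2]; rewrite /g wrap_id ?subrKC//; apply/andP; split; lra.
have g0 : itv_int g 0 T = 0.
  by rewrite -(itv_int_period a lg pg) -[RHS]h0; exact: eq_itv_int.
have [v [vE vg]] := W1inf_of_prim (c - prim g a) lg g0.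
have wg : g \o wrapT = g by apply/funext => x; exact: periodic_wrap.
rewrite wg in vE; exists v, g; split => //.
- split => //; first by move=> x; rewrite !vE prim0 addr0.
  apply: (@filterS _ _ (ae_filter_ringOfSetsType leb)) vg => x ->.
  exact: periodic_wrap.
- by rewrite vE; ring.
move=> t /andP[t1 t2]; rewrite vE.
have -> : itv_int h a t = itv_int g a t.
  by apply: eq_itv_int => x /andP[x1 x2]; rewrite gh// x1 (le_trans x2).
by rewrite -primB//; ring.
Qed.

Lemma periodic_from a f (P : R -> Prop) : periodicT f ->
  (forall t, a <= t <= a + T -> P (f t)) -> forall t, P (f t).
Proof.
move=> pf h t; have -> : f t = f (a + wrapT (t - a)).
  rewrite -[LHS](periodic_int (- (Num.ceil ((t - a) / T) - 1)) _ pf).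
  by congr f; rewrite /wrapT mulrNz; ring.
have /andP[h1 h2] := wrap_itv (t - a).
by apply: h; rewrite lerDl ltW//= lerD2l.
Qed.

End primitives.

(** * The measure u'' + u *)

Section stieltjes_representation.
Context {R : realType}.
Implicit Types (f g h F H : R -> R) (a b c d x y z M C : R) (u v : W1inf R).
Implicit Types (G : cumulative R R).
Local Notation leb := (@lebesgue_measure R).
Local Notation T := (2 * pi : R).
Local Notation LS := lebesgue_stieltjes_measure.

(** As u' = G - prim u, the measure dG is u'' + u on a period. Both integrations by
    parts, of [prim u] against v' and of v against dG, produce boundary terms,
    which cancel when G and [prim u] have the same increment over the period. *)
Lemma pairing_stieltjes u v f G : is_deriv u f ->
  (\forall x \ae leb, 0 < x <= T -> f x = G x - prim u x) ->
  weak_pairing u v =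
  \int[LS G]_(x in `]0, T]) v x + v 0 * (prim u T - (G T - G 0)).
Proof.
move=> uf fG; have [g vg] := W1inf_deriv v; have T0 := ltW (@period_gt0 R).
rewrite (weak_pairingE uf vg).
have lu := loc_bounded_W1inf u; have lv := loc_bounded_W1inf v.
have [lf _ _ _] := uf; have [lg _ vE _] := vg.
have lG := loc_bounded_cumulative G; have lU := loc_bounded_prim lu.
have lpg := loc_bounded_prim lg.
have vT : v T = v 0 by rewrite -[T]add0r W1inf_periodic.
have -> : itv_int (fun x => u x * v x - f x * g x) 0 T =
    itv_int (fun x => (u x * v x + prim u x * g x) - g x * G x) 0 T.
  apply: ae_eq_itv_int.
  - by loc_bounded_tac.
  - have : loc_bounded (fun x => (u x * v x + prim u x * g x) - g x * G x) by loc_bounded_tac.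
    by case.
  apply: (@filterS _ _ (ae_filter_ringOfSetsType leb)) fG => x fx x0T.
  by rewrite fx//; ring.
rewrite itv_intB; try loc_bounded_tac.
have [_ <-//] := is_primM (is_prim_prim lu) (is_deriv_prim vg).
rewrite prim0 mul0r subr0 vT.
have -> : \int[LS G]_(x in `]0, T]) v x = v 0 * (G T - G 0) + \int[LS G]_(x in `]0, T]) prim g x.
  rewrite -stieltjes_cst// -RintegralD//.
  - by apply: eq_Rintegral => x _; exact: vE.
  - by apply: loc_bounded_integrable; [exact: loc_bounded_cst|exact: stieltjes_itv_ltoo].
  - by apply: loc_bounded_integrable => //; exact: stieltjes_itv_ltoo.
rewrite stieltjes_by_parts// prim0.
have -> : prim g T = 0 by have := vE T; rewrite vT; lra.
by ring.
Qed.

(** Nonnegativity of u'' + u read off the derivative: it only asks that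
    u' + (a primitive of u) be nondecreasing on a period, and that the jump
    of that function over the period be the one required by periodicity. *)
Lemma weakly_nonneg_stieltjes u f G : is_deriv u f ->
  (\forall x \ae leb, 0 < x <= T -> f x = G x - prim u x) ->
  G T - G 0 = prim u T -> weakly_nonneg u.
Proof.
move=> uf fG GT v v0; rewrite (pairing_stieltjes v uf fG) GT subrr mulr0 addr0.
exact: Rintegral_ge0.
Qed.

(** Moves an atom from T to 0: the integration by parts is carried out on ]0, T],
    while the torus is [0, T[. *)
Lemma stieltjes_set1_period G c a : (forall x, G (x + T) = G x + c) ->
  LS G [set a] = LS G [set a + T].
Proof.
move=> GT.
have key b : (LS G \o (fun n => `]b - n.+1%:R^-1, b]%classic)) n @[n --> \oo] --> LS G [set b].
  rewrite set1_bigcap_oc; apply: nonincreasing_cvg_mu.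
  - exact: stieltjes_itv_ltoo.
  - by move=> i; exact: measurable_itv.
  - by apply: bigcap_measurable => // i _; exact: measurable_itv.
  move=> n m nm; apply/subsetPset => x /=; rewrite !in_itv/= => /andP[h ->].
  rewrite andbT (le_lt_trans _ h)// lerD2l lerN2 lef_pV2 ?posrE//.
  by rewrite ler_nat ltnS.
apply: (cvg_unique _ (key a)); first exact: ereal_hausdorff.
rewrite (_ : _ \o _ = (LS G \o (fun n => `]a + T - n.+1%:R^-1, a + T]%classic))); first exact: key.
apply/funext => n /=; rewrite !stieltjes_itv ?gerBl//; congr EFin.
by rewrite addrAC !GT; ring.
Qed.

Lemma represents_stieltjes u f G : is_deriv u f ->
  (\forall x \ae leb, 0 < x <= T -> f x = G x - prim u x) ->
  (forall x, G (x + T) = G x + prim u T) -> represents_weak u (LS G).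
Proof.
move=> uf fG GT; have T0 := @period_gt0 R.
have tor : @torus R `<=` `](-1), T]%classic.
  by move=> x; rewrite /torus/= !in_itv/= => /andP[h /ltW ->]; rewrite andbT; lra.
have mtor : measurable (@torus R) by exact: measurable_itv.
split.
  apply: le_lt_trans (stieltjes_itv_ltoo G (-1) T).
  by apply: le_measure; rewrite ?inE.
move=> v; rewrite (pairing_stieltjes v uf fG).
have -> : G T = G 0 + prim u T by rewrite -GT add0r.
rewrite (addrC (G 0)) addrK subrr mulr0 addr0.
have lv := loc_bounded_W1inf v.
have iv D : measurable D -> D `<=` `](-1), T]%classic -> (LS G).-integrable D (EFin \o v).
  move=> mD DT; have iD := loc_bounded_integrable lv (stieltjes_itv_ltoo G (-1) T).
  exact: (@integrableS _ _ _ (LS G) `](-1), T]%classic D _ _ _ DT iD).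
have set1 x : \int[LS G]_(y in [set x]) v y = v x * fine (LS G [set x]).
  by rewrite -Rintegral_cst//; apply: eq_Rintegral => y; rewrite inE => ->.
have E1 : @torus R = [set 0] `|` `]0, T[%classic.
  by rewrite /torus setU1itv// bnd_simp.
have E2 : `]0, T]%classic = `]0, T[%classic `|` [set T] :> set R.
  by rewrite setUitv1// bnd_simp.
have s2 : (`]0, T]%classic : set R) `<=` `](-1), T]%classic.
  by move=> x /=; rewrite !in_itv/= => /andP[h ->]; rewrite andbT; lra.
rewrite E1 E2 !Rintegral_setU//.
- rewrite !set1 (stieltjes_set1_period 0 GT) add0r.
  by rewrite -[T in RHS]add0r W1inf_periodic add0r addrC.
- by rewrite -E2; exact: iv.
- by apply/disj_setPS => x [/=]; rewrite in_itv/= => /andP[_ h] e; rewrite e ltxx in h.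
- by rewrite -E1; exact: iv.
- by apply/disj_setPS => x [/= -> ]; rewrite in_itv/= ltxx.
Qed.

End stieltjes_representation.

Section right_derivative.
Context {R : realType}.
Implicit Types (P : R -> R) (a b c d h p x y z : R).

Definition slope P x y : R := (P y - P x) / (y - x).

(** Convexity is only asked on intervals of length 2, so that the tents used as
    test functions fit in one period. *)
Definition loc_convex P : Prop :=
  forall x y z, x < y -> y < z -> z <= x + 2 -> slope P x y <= slope P y z.

(** The slopes increase with h, so that this infimum is the right derivative. *)
Definition right_derive P x : R :=
  inf [set slope P x (x + h) | h in [set h | 0 < h <= 1]].

Let slopes_nonempty P x : [set slope P x (x + h) | h in [set h | 0 < h <= 1]] !=set0.
Proof. by exists (slope P x (x + 1)); exists 1 => //=; rewrite ltr01 lexx. Qed.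

Let slopes_lbound P x w : loc_convex P -> x - 1 <= w -> w < x ->
  lbound [set slope P x (x + h) | h in [set h | 0 < h <= 1]] (slope P w x).
Proof.
move=> cP xw wx _ [h /= /andP[h0 h1] <-]; apply: cP => //.
  by rewrite ltrDl.
lra.
Qed.

Lemma le_right_derive P w x : loc_convex P -> x - 1 <= w -> w < x ->
  slope P w x <= right_derive P x.
Proof. by move=> cP xw wx; apply: lb_le_inf => //; exact: slopes_lbound. Qed.

Lemma right_derive_le P x y : loc_convex P -> x < y -> y <= x + 1 ->
  right_derive P x <= slope P x y.
Proof.
move=> cP xy yx; apply: ge_inf; last first.
  by exists (y - x); rewrite /= ?subrKC// subr_gt0 xy lerBlDl.
by exists (slope P (x - 1) x); apply: slopes_lbound => //; rewrite ltrBlDr ltrDl.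
Qed.

Lemma right_derive_nondecreasing P : loc_convex P ->
  {homo right_derive P : x y / x <= y}.
Proof.
move=> cP; have step x y : x <= y -> y <= x + 1 -> right_derive P x <= right_derive P y.
  rewrite le_eqVlt => /predU1P[->//|xy yx].
  apply: (le_trans (right_derive_le cP xy yx)); apply: le_right_derive => //.
  by rewrite lerBlDr.
move=> x y xy; pose n := (Num.truncn (y - x)).+1.
have n0 : 0 < n%:R :> R by rewrite ltr0n.
pose d := (y - x) / n%:R.
have d0 : 0 <= d by rewrite divr_ge0 ?subr_ge0// ltW.
have d1 : d <= 1.
  by rewrite ler_pdivrMr// mul1r ltW// truncnS_gt.
have -> : y = x + n%:R * d by rewrite /d mulrCA divff ?gt_eqF// mulr1 subrKC.
elim: n {n0 d0 d1 d} (d) (d0) (d1) => [|n IH] d d0 d1; first by rewrite mul0r addr0.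
apply: le_trans (IH _ d0 d1) _; apply: step.
  by rewrite lerD2l ler_wpM2r// ler_nat.
by rewrite -natr1 mulrDl mul1r addrA lerD2l.
Qed.

(** An infimum of continuous functions is upper semicontinuous; together with
    monotonicity this is continuity from the right. *)
Lemma right_derive_right_continuous P : loc_convex P -> continuous P ->
  right_continuous (right_derive P).
Proof.
move=> cP coP x; apply/cvgrPdist_lt => e e0.
have hi : has_inf [set slope P x (x + h) | h in [set h | 0 < h <= 1]].
  split => //; exists (slope P (x - 1) x).
  by apply: slopes_lbound => //; rewrite ltrBlDr ltrDl.
have [_ [h /= /andP[h0 h1] <-] hlt] := inf_adherent e0 hi.
have cs : {for x, continuous (fun y => slope P y (y + h))}.
  apply: cvgM.
    apply: cvgB; last exact: coP.
    apply: (@continuous_comp _ _ _ (fun y => y + h) P); last exact: coP.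
    by apply: cvgD; [exact: cvg_id|exact: cvg_cst].
  have E y : (y + h - y)^-1 = h^-1 :> R by rewrite addrAC subrr add0r.
  by rewrite E; under eq_fun do rewrite E; exact: cvg_cst.
have hn : \forall y \near x, slope P y (y + h) < right_derive P x + e.
  exact: (cvgr_lt (slope P x (x + h)) cs).
near=> y.
have xy : x < y by near: y; exact: nbhs_right_gt.
have mono : right_derive P x <= right_derive P y.
  by apply: right_derive_nondecreasing => //; exact: ltW.
rewrite ler0_norm ?subr_le0// opprB ltrBlDl.
have : slope P y (y + h) < right_derive P x + e.
  near: y; exact: cvg_within hn.
apply: le_lt_trans; apply: right_derive_le => //; first by rewrite ltrDl.
by rewrite lerD2l.
Unshelve. all: by end_near. Qed.

Lemma right_derive_is_derive P x d : loc_convex P -> is_derive x 1 P d ->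
  right_derive P x = d.
Proof.
move=> cP /is_derive1_caratheodory[g [gE cg <-]].
have sr h : 0 < h -> slope P x (x + h) = g (x + h).
  move=> h0; rewrite /slope gE addrAC subrr add0r mulfK// gt_eqF//.
have sl h : 0 < h -> slope P (x - h) x = g (x - h).
  move=> h0; rewrite /slope -opprB gE.
  have -> : x - h - x = - h by ring.
  by rewrite subKr mulrN opprK mulfK// gt_eqF.
apply/eqP; rewrite eq_le; apply/andP; split; rewrite leNgt; apply/negP => hlt.
  have /nbhs_ballP[e /= e0 he] : \forall z \near x, g z < right_derive P x by exact: (cvgr_lt (g x) cg).
  pose h := Num.min 1 (e / 2).
  have e20 : 0 < e / 2 by rewrite divr_gt0.
  have h0 : 0 < h by rewrite lt_min ltr01.
  have h1 : h <= 1 by rewrite ge_min lexx.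
  have he2 : h <= e / 2 by rewrite ge_min lexx orbT.
  have : g (x + h) < right_derive P x.
    apply: he; rewrite /ball/= opprD addNKr normrN gtr0_norm//; lra.
  rewrite ltNge => /negP; apply; rewrite -sr//.
  by apply: right_derive_le => //; rewrite ?ltrDl// lerD2l.
have /nbhs_ballP[e /= e0 he] : \forall z \near x, right_derive P x < g z by exact: (cvgr_gt (g x) cg).
pose h := Num.min 1 (e / 2).
have e20 : 0 < e / 2 by rewrite divr_gt0.
have h0 : 0 < h by rewrite lt_min ltr01.
have h1 : h <= 1 by rewrite ge_min lexx.
have he2 : h <= e / 2 by rewrite ge_min lexx orbT.
have : right_derive P x < g (x - h).
  apply: he; rewrite /ball/= subKr gtr0_norm//; lra.
rewrite ltNge => /negP; apply; rewrite -sl//.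
by apply: le_right_derive => //; rewrite ?gtrBl// lerD2l lerN2.
Qed.

Lemma right_derive_shift P p c : loc_convex P ->
  (forall x h, 0 < h -> slope P (x + p) (x + p + h) = slope P x (x + h) + c) ->
  forall x, right_derive P (x + p) = right_derive P x + c.
Proof.
move=> cP sP x; apply/eqP; rewrite eq_le; apply/andP; split.
  rewrite -lerBlDr; apply: lb_le_inf => // _ [h /= /andP[h0 h1] <-].
  rewrite lerBlDr -sP//; apply: right_derive_le => //; first by rewrite ltrDl.
  by rewrite lerD2l.
apply: lb_le_inf => // _ [h /= /andP[h0 h1] <-].
rewrite sP// lerD2r; apply: right_derive_le => //; first by rewrite ltrDl.
by rewrite lerD2l.
Qed.

End right_derivative.

Section weakly_nonneg_convex.
Context {R : realType}.
Implicit Types (f g h F H : R -> R) (a b c d x y z M C : R) (u v : W1inf R).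
Local Notation leb := (@lebesgue_measure R).
Local Notation T := (2 * pi : R).

Lemma loc_bounded_indic (D : set R) : measurable D -> loc_bounded (\1_D : R -> R).
Proof.
move=> mD; split; first exact: measurable_indic.
by move=> M; exists 1 => x _; rewrite indicE; case: (_ \in _); rewrite ?normr1 ?normr0.
Qed.

Lemma itv_int_indic f a b c d : loc_bounded f -> a <= c -> c <= d -> d <= b ->
  itv_int (fun x => f x * \1_(`]c, d]%classic) x) a b = itv_int f c d.
Proof.
move=> lf ac cd db.
have li := @loc_bounded_indic `]c, d]%classic (measurable_itv _).
have lp : loc_bounded (fun x => f x * \1_(`]c, d]%classic) x) by loc_bounded_tac.
rewrite -(itv_int_cat lp ac (le_trans cd db)) -(itv_int_cat lp cd db).
rewrite (@eq_itv_int _ _ (fun=> 0) a c); last first.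
  move=> x /andP[_ xc]; rewrite indicE memNset ?mulr0//= in_itv/= => /andP[cx _].
  by move: (lt_le_trans cx xc); rewrite ltxx.
rewrite [X in _ + (_ + X)](@eq_itv_int _ _ (fun=> 0) d b); last first.
  move=> x /andP[dx _]; rewrite indicE memNset ?mulr0//= in_itv/= => /andP[_ xd].
  by move: (lt_le_trans dx xd); rewrite ltxx.
rewrite !itv_int_cst// !mul0r add0r addr0; apply: eq_itv_int => x xcd.
by rewrite indicE mem_set ?mulr1//= in_itv.
Qed.

(** Its second derivative is u'' + u. *)
Definition potential u x : R := u x + prim (prim u) x.

Lemma potential_is_prim u f : is_deriv u f ->
  is_prim (potential u) (fun x => f x + prim u x).
Proof.
move=> uf; apply: is_primD; first exact: is_deriv_prim.
by apply: is_prim_prim; apply: loc_bounded_prim; exact: loc_bounded_W1inf.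
Qed.

(** Testing u'' + u >= 0 against the tent with base [x, z] and apex y yields the
    difference of the slopes of the potential on [y, z] and [x, y]. *)
Lemma weakly_nonneg_loc_convex u : weakly_nonneg u -> loc_convex (potential u).
Proof.
move=> u0 x y z xy yz zx; have [f uf] := W1inf_deriv u.
have T4 : 4 <= T by have := @pi_ge2 R; lra.
have xT : x <= x + T by lra.
pose A := (y - x)^-1; pose B := (z - y)^-1.
have A0 : 0 < A by rewrite invr_gt0 subr_gt0.
have B0 : 0 < B by rewrite invr_gt0 subr_gt0.
have Ay : A * (y - x) = 1 by rewrite mulVf// subr_eq0 gt_eqF.
have Bz : B * (z - y) = 1 by rewrite mulVf// subr_eq0 gt_eqF.
have lI a b := @loc_bounded_indic `]a, b]%classic (measurable_itv _).
pose h t : R := A * \1_(`]x, y]%classic) t + (- B) * \1_(`]y, z]%classic) t.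
have lxy := lI x y; have lyz := lI y z.
have lh : loc_bounded h by rewrite /h; loc_bounded_tac.
have h1 t : x < t <= y -> h t = A.
  move=> xty; rewrite /h !indicE mem_set ?memNset/= ?in_itv/= ?mulr1 ?mulr0 ?addr0//.
  by move=> /andP[yt _]; move: xty => /andP[_ ty]; move: (lt_le_trans yt ty); rewrite ltxx.
have h2 t : y < t <= z -> h t = - B.
  move=> ytz; rewrite /h !indicE memNset ?mem_set/= ?in_itv/= ?mulr1 ?mulr0 ?add0r//.
  by move=> /andP[_ ty]; move: ytz => /andP[yt _]; move: (lt_le_trans yt ty); rewrite ltxx.
have h3 t : z < t <= x + T -> h t = 0.
  move=> /andP[zt _]; rewrite /h !indicE !memNset/= ?in_itv/= ?mulr0 ?add0r//.
    by move=> /andP[_ tz]; move: (lt_le_trans zt tz); rewrite ltxx.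
  by move=> /andP[_ ty]; move: (lt_le_trans zt (le_trans ty (ltW yz))); rewrite ltxx.
have i1 t : x <= t <= y -> itv_int h x t = A * (t - x).
  move=> /andP[xt ty]; rewrite -itv_int_cst//; apply: eq_itv_int => s /andP[xs st].
  by apply: h1; rewrite xs (le_trans st).
have i2 t : y <= t <= z -> itv_int h x t = 1 - B * (t - y).
  move=> /andP[yt tz]; rewrite -(itv_int_cat lh (ltW xy) yt) i1 ?Ay; last by rewrite (ltW xy) lexx.
  rewrite -mulNr -itv_int_cst//; congr (_ + _); apply: eq_itv_int => s /andP[ys st].
  by apply: h2; rewrite ys (le_trans st).
have i3 t : z <= t <= x + T -> itv_int h x t = 0.
  move=> /andP[zt tx]; rewrite -(itv_int_cat lh (ltW (lt_trans xy yz)) zt).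
  rewrite i2 ?Bz; last by rewrite (ltW yz) lexx.
  rewrite subrr add0r -(mul0r (t - z)) -itv_int_cst//.
  by apply: eq_itv_int => s /andP[zs st]; apply: h3; rewrite zs (le_trans st).
have zT : z <= x + T by lra.
have hT : itv_int h x (x + T) = 0 by apply: i3; rewrite zT lexx.
have [v [g [vg vx gh vE]]] := W1inf_on_period 0 lh hT.
have vT : v (x + T) = 0 by rewrite W1inf_periodic.
have v0 : forall t, 0 <= v t.
  apply: (@periodic_from _ x v (fun y => 0 <= y) (@W1inf_periodic _ v)) => t /andP[xt tT].
  rewrite vE ?xt// add0r; have [ty|/ltW yt] := leP t y.
    by rewrite i1 ?xt// mulr_ge0 ?subr_ge0// ltW.
  have [tz|/ltW zt] := leP t z; last by rewrite i3// zt.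
  rewrite i2 ?yt// subr_ge0 -Bz ler_pM2l// lerD2r//.
have := u0 v v0; rewrite (is_deriv_period x uf vg).
have lu := loc_bounded_W1inf u; have lv := loc_bounded_W1inf v.
have [lf _ _ _] := uf; have [lg _ _ _] := vg; have lU := loc_bounded_prim lu.
have -> : itv_int (fun x => u x * v x - f x * g x) x (x + T) =
   itv_int (fun t => (u t * v t + prim u t * g t) - (f t + prim u t) * g t) x (x + T).
  by apply: eq_itv_int => t _; ring.
rewrite itv_intB; try loc_bounded_tac.
(* the first term is the integral of (prim u * v)', which vanishes as v = 0 at both ends *)
have [_ <-//] := is_primM (is_prim_prim lu) (is_deriv_prim vg).
rewrite vx vT !mulr0 subrr sub0r oppr_ge0.
have -> : itv_int (fun t => (f t + prim u t) * g t) x (x + T) =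
  itv_int (fun t => A * ((f t + prim u t) * \1_(`]x, y]%classic) t) +
    (- B) * ((f t + prim u t) * \1_(`]y, z]%classic) t)) x (x + T).
  by apply: eq_itv_int => t xtT; rewrite gh// /h; ring.
have lfu : loc_bounded (fun t => f t + prim u t) by loc_bounded_tac.
rewrite itv_int_lin; try loc_bounded_tac.
rewrite !itv_int_indic ?(ltW xy) ?(ltW yz) ?(le_trans (ltW yz) zT)//.
have [_ Pf] := potential_is_prim uf.
rewrite -(Pf _ _ (ltW xy)) -(Pf _ _ (ltW yz)) mulNr subr_le0 /slope.
by rewrite /A /B mulrC [X in _ <= X]mulrC.
Qed.

(** The right derivative of the convex potential is the cumulative function of
    u'' + u. *)
Lemma weakly_nonneg_cumulative u f : is_deriv u f -> weakly_nonneg u ->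
  exists G : cumulative R R,
    (\forall x \ae leb, f x = G x - prim u x) /\
    forall x, G (x + T) = G x + prim u T.
Proof.
move=> uf u0; have cP := weakly_nonneg_loc_convex u0.
have PF := potential_is_prim uf; have coP := continuous_is_prim PF.
pose G0 := right_derive (potential u).
pose G : cumulative R R := HB.pack G0 (isCumulative.Build R _ R G0
  (right_derive_nondecreasing cP) (right_derive_right_continuous cP coP)).
exists G; split.
  apply: (@filterS _ _ (ae_filter_ringOfSetsType leb)) (is_prim_ae_derive PF).
  move=> x dx; rewrite -[G x]/(right_derive (potential u) x).
  by rewrite (right_derive_is_derive cP dx) addrK.
have lu := loc_bounded_W1inf u; have lU := loc_bounded_prim lu.
have pU x : prim u (x + T) = prim u x + prim u T.
  by rewrite -(prim_period x lu (@W1inf_periodic _ u)) subrKC.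
have key a b : a <= b ->
    potential u (b + T) - potential u (a + T) = potential u b - potential u a + prim u T * (b - a).
  move=> ab; rewrite /potential !W1inf_periodic.
  have abT : a + T <= b + T by rewrite lerD2r.
  have e1 := primB lU ab; have := primB lU abT.
  rewrite itv_int_translate// (@eq_itv_int _ _ (fun x => prim u x + prim u T)); last by move=> x _; exact: pU.
  rewrite itv_intD ?itv_int_cst//; last exact: loc_bounded_cst.
  rewrite -e1; move: (prim (prim u) _) (prim (prim u) _) (prim (prim u) _) (prim (prim u) _) => p q r s h.
  rewrite opprD addrACA h; ring.
apply: right_derive_shift => // x h h0.
have hE y : y + h - y = h by rewrite addrAC subrr add0r.
rewrite /slope !hE (addrAC x T h) key ?lerDl ?(ltW h0)//.
by rewrite hE mulrDl mulfK// gt_eqF.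
Qed.

End weakly_nonneg_convex.

(** * Two-sided perturbations supported in a short interval *)

Section clamp.
Context {R : realType}.
Implicit Types (a b c d x y z t : R).

(** [clamp a b (G x)] is the cumulative function of the part of dG between the
    levels a and b of G; cutting by levels also splits atoms. *)
Definition clamp a b y : R := Num.min (Num.max y a) b - a.

Lemma clamp_below a b y : a <= b -> y <= a -> clamp a b y = 0.
Proof. by move=> ab ya; rewrite /clamp max_r// min_l// subrr. Qed.

Lemma clamp_above a b y : a <= b -> b <= y -> clamp a b y = b - a.
Proof.
by move=> ab yb; rewrite /clamp max_l ?(le_trans ab)// min_r.
Qed.

Lemma clamp_mid a b y : a <= y -> y <= b -> clamp a b y = y - a.
Proof. by move=> ay yb; rewrite /clamp max_l// min_l. Qed.

Lemma clamp_nondecreasing a b : {homo clamp a b : x y / x <= y}.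
Proof.
move=> x y xy; rewrite /clamp lerD2r le_min !ge_min !ge_max !le_max !lexx !orbT xy.
by rewrite !andbT /= ?orbT.
Qed.

Lemma clamp_increment a b x y : a <= b -> x <= y -> clamp a b y - clamp a b x <= y - x.
Proof.
move=> ab xy; have [xa|/ltW xa] := leP x a; have [ya|/ltW ya] := leP y a.
- by rewrite !clamp_below// subrr subr_ge0.
- rewrite (clamp_below ab xa); have [yb|/ltW yb] := leP y b.
    by rewrite clamp_mid//; lra.
  by rewrite clamp_above//; lra.
- by rewrite !clamp_below ?(le_trans xy)// subrr subr_ge0.
have [xb|/ltW xb] := leP x b; have [yb|/ltW yb] := leP y b.
- by rewrite !clamp_mid//; lra.
- by rewrite (clamp_mid xa xb) clamp_above//; lra.
- by rewrite !clamp_above ?(le_trans xb)// subrr subr_ge0.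
- by rewrite !clamp_above// subrr subr_ge0.
Qed.

Lemma clamp_cat a b c y : a <= b -> b <= c ->
  clamp a b y + clamp b c y = clamp a c y.
Proof.
move=> ab bc; have ac := le_trans ab bc.
have [ya|/ltW ya] := leP y a; first by rewrite !clamp_below ?addr0// (le_trans ya).
have [yb|/ltW yb] := leP y b.
  by rewrite (clamp_below bc yb) addr0 !clamp_mid// (le_trans yb).
have [yc|/ltW yc] := leP y c.
  by rewrite (clamp_above ab yb) !clamp_mid//; ring.
by rewrite !clamp_above//; ring.
Qed.

Lemma clamp_continuous a b : continuous (clamp a b).
Proof.
move=> x; apply: cvgB; last exact: cvg_cst.
apply: (@continuous_min _ _ _ (cst b) x); last exact: cvg_cst.
by apply: (@continuous_max _ _ id (cst a) x); [exact: cvg_id|exact: cvg_cst].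
Qed.

Lemma two_equations_three_unknowns (A B : 'I_3 -> R) :
  exists l : 'I_3 -> R, [/\ exists i, l i != 0, forall i, `|l i| <= 1,
    \sum_i l i * A i = 0 & \sum_i l i * B i = 0].
Proof.
pose M : 'M[R]_(3, 2) := \matrix_(i, j) (if j == 0 then A i else B i).
have : kermx M != 0.
  by rewrite -mxrank_eq0 mxrank_ker subn_eq0 -ltnNge ltnS rank_leq_col.
move=> /rowV0Pn[v /sub_kermxP vM v0].
have [i vi] : exists i, v 0 i != 0.
  apply: contrapT => h; move/negP: v0; apply; apply/eqP/rowP => i; rewrite mxE.
  by apply/eqP; apply: contrapT => /negP vi; apply: h; exists i.
pose s := \sum_i `|v 0 i|.
have vs k : `|v 0 k| <= s by rewrite /s (bigD1 k)//= lerDl sumr_ge0.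
have s0 : 0 < s by apply: lt_le_trans (vs i); rewrite normr_gt0.
have eqn (D : 'I_3 -> R) j : (forall i, M i j = D i) -> \sum_i v 0 i / s * D i = 0.
  move=> DE; have /rowP/(_ j) := vM; rewrite !mxE => e.
  transitivity ((\sum_i v 0 i * M i j) / s); last by rewrite e mul0r.
  by rewrite mulr_suml; apply: eq_bigr => k _; rewrite DE mulrAC.
exists (fun k => v 0 k / s); split.
- by exists i; rewrite mulf_neq0// invr_eq0 gt_eqF.
- by move=> k; rewrite normrM normfV (gtr0_norm s0) ler_pdivrMr// mul1r.
- by apply: (eqn A 0) => k; rewrite mxE.
- by apply: (eqn B 1) => k; rewrite mxE.
Qed.

End clamp.

Section perturbation.
Context {R : realType}.
Implicit Types (f g h F H N : R -> R) (a b c d x y z t : R) (u v : W1inf R).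
Implicit Types (G : cumulative R R).
Local Notation leb := (@lebesgue_measure R).
Local Notation T := (2 * pi : R).

Lemma sinT : sin T = 0.
Proof. by rewrite mulrC mulr_natr sin2pi. Qed.

Lemma cosT : cos T = 1.
Proof. by rewrite mulrC mulr_natr cos2pi. Qed.

Lemma is_prim_sin : is_prim (@sin R) cos.
Proof.
have cc : continuous (@cos R) by exact: continuous_cos.
apply: (@is_prim_cst_add _ _ _ (sin 0)); first exact: loc_bounded_continuous.
by apply: is_derive_primE => // x; exact: is_derive_sin.
Qed.

Lemma is_prim_cos : is_prim (@cos R) (fun x => - sin x).
Proof.
have cc : continuous (fun x : R => - sin x).
  by move=> x; apply: cvgN; exact: continuous_sin.
apply: (@is_prim_cst_add _ _ _ (cos 0)); first exact: loc_bounded_continuous.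
by apply: is_derive_primE => // x; exact: is_derive_cos.
Qed.

Lemma right_continuous_int0 N b : loc_bounded N -> right_continuous N ->
  (forall x y, 0 <= x -> x <= y -> y <= b -> itv_int N x y = 0) ->
  forall x, 0 <= x -> x < b -> N x = 0.
Proof.
suff pos N' : loc_bounded N' -> right_continuous N' ->
    (forall x y, 0 <= x -> x <= y -> y <= b -> itv_int N' x y = 0) ->
    forall x, 0 <= x -> x < b -> ~ 0 < N' x.
  move=> lN rN N0 x x0 xb; have [/(pos _ lN rN N0 _ x0 xb)[]| Nx|//] := ltgtP 0 (N x).
  exfalso; apply: (pos (fun x => - N x) _ _ _ x x0 xb); rewrite ?oppr_gt0//.
  - exact: loc_boundedN.
  - by move=> z; apply: cvgN; exact: rN.
  - by move=> y z y0 yz zb; rewrite itv_intN// N0// oppr0.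
move=> lN rN N0 x x0 xb Nx.
have : \forall y \near x^'+, N' x / 2 < N' y.
  by apply: (cvgr_gt (N' x) (rN x)); lra.
move=> [e /= e0 he].
pose y := Num.min b (x + e / 2).
have e20 : 0 < e / 2 by rewrite divr_gt0.
have xy : x < y by rewrite lt_min xb ltrDl.
have yb : y <= b by rewrite ge_min lexx.
have yx : y <= x + e / 2 by rewrite ge_min lexx orbT.
have : N' x / 2 * (y - x) <= itv_int N' x y.
  rewrite -(itv_int_cst _ (ltW xy)); apply: le_itv_int => //; first exact: loc_bounded_cst.
  move=> z /andP[xz zy]; apply/ltW/he => //=.
  by rewrite ltr0_norm; lra.
rewrite N0 ?(ltW xy)// leNgt => /negP; apply.
by rewrite mulr_gt0 ?subr_gt0// divr_gt0.
Qed.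

(** Solving v'' + v = N' on [0, T] by variation of constants: [v] and the
    primitive of [v] are the two trigonometric combinations below. *)
Lemma variation_of_constants N : loc_bounded N ->
  let C := prim (fun t => cos t * N t) in
  let S := prim (fun t => sin t * N t) in
  is_prim (fun x => cos x * C x + sin x * S x)
          (fun x => N x - (sin x * C x - cos x * S x)) /\
  is_prim (fun x => sin x * C x - cos x * S x)
          (fun x => cos x * C x + sin x * S x).
Proof.
move=> lN C S.
have lc := loc_bounded_is_prim is_prim_cos; have ls := loc_bounded_is_prim is_prim_sin.
have lcN : loc_bounded (fun t => cos t * N t) by loc_bounded_tac.
have lsN : loc_bounded (fun t => sin t * N t) by loc_bounded_tac.
have CP := is_prim_prim lcN; have SP := is_prim_prim lsN.
split.
  have [l i] := is_primD (is_primM is_prim_cos CP) (is_primM is_prim_sin SP).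
  have E : (fun x => N x - (sin x * C x - cos x * S x)) =
      (fun x => - sin x * C x + cos x * (cos x * N x) + (cos x * S x + sin x * (sin x * N x))).
    apply/funext => x; rewrite -[N x in LHS]mul1r -(cos2Dsin2 x); ring.
  by rewrite E; split.
have [l i] := is_prim_lin 1 (-1) (is_primM is_prim_sin CP) (is_primM is_prim_cos SP).
have E : (fun x => cos x * C x + sin x * S x) =
    (fun x => 1 * (cos x * C x + sin x * (cos x * N x)) + -1 * (- sin x * S x + cos x * (sin x * N x))).
  by apply/funext => x; ring.
rewrite E; split=> // a b ab; have := i a b ab; rewrite -/C -/S => <-; ring.
Qed.

(** Four values of the cumulative function of u'' + u give three pieces of this
    measure between x1 and x4. Two linear conditions on their weights make the
    response [v] vanish outside of the interval, and weights of absolute value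
    at most 1 keep (u + t v)'' + u + t v nonnegative for |t| <= 1. *)
Lemma perturbation_exists u f G (x1 x2 x3 x4 : R) : is_deriv u f ->
  (\forall x \ae leb, f x = G x - prim u x) -> G T - G 0 = prim u T ->
  0 < x1 -> x1 < x2 -> x2 < x3 -> x3 < x4 -> x4 < T ->
  G x1 < G x2 -> G x2 < G x3 -> G x3 < G x4 ->
  exists v, [/\ exists x, v x != 0,
    forall x, 0 <= x <= T -> ~ (x1 < x < x4) -> v x = 0 &
    forall t, `|t| <= 1 -> weakly_nonneg (u + t *: v)].
Proof.
move=> uf fG GT x10 x12 x23 x34 x4T G12 G23 G34.
have T0 := ltW (@period_gt0 R).
have l12 := ltW G12; have l23 := ltW G23; have l34 := ltW G34.
have l13 := le_trans l12 l23; have l24 := le_trans l23 l34.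
have l14 := le_trans l13 l34.
have ndG : {homo G : x y / x <= y} by exact: cumulative_is_nondecreasing.
pose c (i : 'I_3) : R -> R :=
  if i == 0 then clamp (G x1) (G x2) else if i == 1 then clamp (G x2) (G x3)
  else clamp (G x3) (G x4).
have cab i : exists a b, a <= b /\ c i = clamp a b.
  rewrite /c; case: ifP => _; first by exists (G x1), (G x2).
  by case: ifP => _; [exists (G x2), (G x3)|exists (G x3), (G x4)].
have cnd i : {homo c i : x y / x <= y}.
  by have [a [b [ab ->]]] := cab i; exact: clamp_nondecreasing.
have sumc y : \sum_i c i y = clamp (G x1) (G x4) y.
  rewrite !big_ord_recl big_ord0 /c/= addr0.
  by rewrite clamp_cat// clamp_cat.
have lc i : loc_bounded (fun x => c i (G x)).
  by apply: loc_bounded_nondecreasing => x y xy; apply: cnd; exact: ndG.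
have lcos := loc_bounded_is_prim is_prim_cos.
have lsin := loc_bounded_is_prim is_prim_sin.
(* With N the cumulative function of the weighted pieces, v vanishes after x4 if
   cos and sin integrate to 0 against dN; by parts this reads: cos * N has
   integral 0 and sin * N has integral - N x4. *)
have [l [[i0 li0] l1 lA lB]] := two_equations_three_unknowns
  (fun i => itv_int (fun t => cos t * c i (G t)) 0 T)
  (fun i => itv_int (fun t => sin t * c i (G t)) 0 T + c i (G x4)).
pose F y := \sum_i l i * c i y.
pose N x := F (G x).
pose d := N x4.
have NE x : N x = l 0 * c 0 (G x) + l 1 * c 1 (G x) + l 2 * c 2 (G x).
  rewrite /N /F !big_ord_recl big_ord0 addr0 addrA.
  by congr (_ + _ + _); congr (l _ * c _ _); apply/val_inj.
have lN : loc_bounded N.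
  have -> : N = fun x => l 0 * c 0 (G x) + l 1 * c 1 (G x) + l 2 * c 2 (G x).
    by apply/funext => x; exact: NE.
  have lc0 := lc 0; have lc1 := lc 1; have lc2 := lc 2; loc_bounded_tac.
have itvN h : loc_bounded h ->
    itv_int (fun t => h t * N t) 0 T = \sum_i l i * itv_int (fun t => h t * c i (G t)) 0 T.
  move=> lh; rewrite !big_ord_recl big_ord0 addr0.
  have lh0 i : loc_bounded (fun t => h t * c i (G t)).
    by have := lc i => lci; loc_bounded_tac.
  have h0 := lh0 ord0; have h1 := lh0 (lift ord0 ord0); have h2 := lh0 (lift ord0 (lift ord0 ord0)).
  rewrite -!itv_intZ// -!itv_intD; try loc_bounded_tac.
  apply: eq_itv_int => t _; rewrite /N /F !big_ord_recl big_ord0 addr0; ring.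
have intcos : itv_int (fun t => cos t * N t) 0 T = 0 by rewrite itvN.
have intsin : itv_int (fun t => sin t * N t) 0 T = - d.
  move: lB; under eq_bigr do rewrite mulrDr; rewrite big_split/= => e.
  by apply/eqP; rewrite itvN// -addr_eq0; apply/eqP; exact: e.
have N0 x : x <= x1 -> N x = 0.
  move=> xx1; have h := ndG _ _ xx1; rewrite NE /c/= !clamp_below ?mulr0 ?addr0//.
    exact: le_trans h _.
  exact: le_trans h _.
have Nd x : x4 <= x -> N x = d.
  move=> xx4; have h := ndG _ _ xx4; rewrite /d !NE /c/=.
  by rewrite !(@clamp_above _ _ _ (G x)) ?(le_trans _ h)// !(@clamp_above _ _ _ (G x4)).
have [vP VP] := variation_of_constants lN.
set C := prim (fun t => cos t * N t) in vP VP *.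
set S := prim (fun t => sin t * N t) in vP VP *.
set v0 := (fun x => cos x * C x + sin x * S x) in vP VP *.
set V0 := (fun x => sin x * C x - cos x * S x) in vP VP *.
have lcN : loc_bounded (fun t => cos t * N t) by loc_bounded_tac.
have lsN : loc_bounded (fun t => sin t * N t) by loc_bounded_tac.
have CT : C T = 0 by rewrite /C primE_pos.
have ST : S T = - d by rewrite /S primE_pos.
have left x : 0 <= x <= x1 -> C x = 0 /\ S x = 0.
  move=> /andP[x0 xx1]; rewrite /C /S !primE_pos//.
  by split; rewrite (@eq_itv_int _ _ (fun=> 0)) ?itv_int_cst ?mul0r//
    => t /andP[_ tx]; rewrite N0 ?mulr0// (le_trans tx).
have right x : x4 <= x <= T -> C x = d * sin x /\ S x = - d * cos x.
  move=> /andP[xx4 xT].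
  have e1 : C T - C x = d * (sin T - sin x).
    rewrite /C primB//; have [_ ->//] := is_prim_sin.
    rewrite -itv_intZ//; apply: eq_itv_int => t /andP[xt _].
    by rewrite Nd 1?mulrC// (le_trans xx4)// ltW.
  have e2 : S T - S x = - d * (cos T - cos x).
    rewrite /S primB//; have [_ ->//] := is_prim_cos.
    rewrite -itv_intZ//; last exact: loc_boundedN.
    apply: eq_itv_int => t /andP[xt _].
    by rewrite Nd 1?mulrC ?mulrNN// (le_trans xx4)// ltW.
  by move: e1 e2; rewrite CT ST sinT cosT; split; lra.
have v0_out x : 0 <= x <= T -> ~ (x1 < x < x4) -> v0 x = 0.
  move=> /andP[x0 xT] xo; rewrite /v0; have [xx1|x1x] := leP x x1.
    by have [|-> ->] := left x; rewrite ?x0// !mulr0 addr0.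
  have [xx4|x4x] := ltP x x4; first by rewrite x1x xx4 in xo.
  by have [|-> ->] := right x; rewrite ?x4x//; ring.
have V0T : V0 T = d.
  by rewrite /V0 sinT cosT ST; ring.
have V00 : V0 0 = 0.
  by rewrite /V0 sin0 mul0r /S prim0 mulr0 subrr.
have h0 : itv_int (fun x => N x - V0 x) 0 (0 + T) = 0.
  case: vP => _ <-; rewrite ?add0r//.
  rewrite !v0_out ?subrr ?lexx ?T0//; first by move=> /andP[h _]; lra.
  by move=> /andP[_ h]; lra.
have [v [g [vg v00 gh vE]]] := W1inf_on_period 0 vP.1 h0.
rewrite !add0r in gh vE.
have vv0 x : 0 <= x <= T -> v x = v0 x.
  move=> xT; rewrite vE// add0r; case: vP => _ <-; last by case/andP: xT.
  rewrite (v0_out 0) ?subr0 ?lexx ?T0//.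
  by move=> /andP[h _]; lra.
have lv0 := loc_bounded_is_prim vP.
have pv x : 0 <= x <= T -> prim v x = V0 x.
  move=> /andP[x0 xT]; rewrite primE_pos//.
  rewrite (@eq_itv_int _ v v0); last first.
    by move=> t /andP[t1 t2]; apply: vv0; rewrite ltW//= (le_trans t2).
  by case: VP => _ <-//; rewrite V00 subr0.
have cF : continuous F.
  have cc i : continuous (c i).
    by have [a [b [_ ->]]] := cab i; exact: clamp_continuous.
  rewrite (_ : F = fun y => l ord0 * c ord0 y + (l (lift ord0 ord0) * c (lift ord0 ord0) y + l (lift ord0 (lift ord0 ord0)) * c (lift ord0 (lift ord0 ord0)) y)).
    move=> y; do !apply: cvgD; apply: cvgM; [exact: cvg_cst|exact: cc|exact: cvg_cst|exact: cc|exact: cvg_cst|exact: cc].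
  by apply/funext => y; rewrite /F !big_ord_recl big_ord0 addr0.
have rN : right_continuous N.
  move=> x; apply: (@cvg_comp _ _ _ G F); first exact: cumulative_is_right_continuous.
  exact: cF.
exists v; split.
- apply: contrapT => vz.
  have {}vz x : v x = 0 by apply/eqP; apply: contrapT => /negP h; apply: vz; exists x.
  have Nz x y : 0 <= x -> x <= y -> y <= T -> itv_int N x y = 0.
    move=> x0 xy yT; have [_ vi] := vP.
    have yi : 0 <= y <= T by rewrite yT (le_trans x0).
    have xi : 0 <= x <= T by rewrite x0 (le_trans xy).
    have lV := loc_bounded_is_prim VP.
    have := vi _ _ xy; rewrite -!vv0// !vz subrr itv_intB//.
    rewrite (@eq_itv_int _ V0 (fun=> 0)) ?itv_int_cst ?mul0r ?subr0//.
    move=> t /andP[xt ty]; have ti : 0 <= t <= T by rewrite (le_trans ty)// (le_trans x0)//= ltW.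
    rewrite -pv// primE_pos; last by case/andP: ti.
    rewrite (@eq_itv_int _ v (fun=> 0)) ?itv_int_cst ?mul0r//.
    by case/andP: ti.
  (* N vanishes on [0, T[; evaluated at x2, x3 and x4 it gives the weights in turn *)
  have NN := right_continuous_int0 lN rN Nz.
  have x20 : 0 <= x2 by lra.
  have x30 : 0 <= x3 by lra.
  have x40 : 0 <= x4 by lra.
  have h2 := NN _ x20 (lt_trans x23 (lt_trans x34 x4T)).
  have h3 := NN _ x30 (lt_trans x34 x4T); have h4 := NN _ x40 x4T.
  move: h2 h3 h4; rewrite !NE /c/=.
  rewrite (clamp_above l12 (lexx _)) (clamp_above l12 l23) (clamp_above l12 l24).
  rewrite (clamp_below l23 (lexx _)) (clamp_above l23 (lexx _)) (clamp_above l23 l34).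
  rewrite (clamp_below l34 l23) (clamp_below l34 (lexx _)) (clamp_above l34 (lexx _)).
  rewrite !mulr0 !addr0 => h2.
  have z0 : l 0 = 0.
    by apply/eqP; move/eqP: h2; rewrite mulf_eq0 subr_eq0 (gt_eqF G12) orbF.
  rewrite z0 !mul0r !add0r => h3.
  have z1 : l 1 = 0.
    by apply/eqP; move/eqP: h3; rewrite mulf_eq0 subr_eq0 (gt_eqF G23) orbF.
  rewrite z1 !mul0r !add0r => h4.
  have z2 : l 2 = 0.
    by apply/eqP; move/eqP: h4; rewrite mulf_eq0 subr_eq0 (gt_eqF G34) orbF.
  move/negP: li0; apply; apply/eqP.
  case: i0 => [[|[|[|//]]] hi].
  - by rewrite -z0; congr l; apply/val_inj.
  - by rewrite -z1; congr l; apply/val_inj.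
  - by rewrite -z2; congr l; apply/val_inj.
- by move=> x xT xo; rewrite vv0// v0_out.
(* the increments of N are dominated by those of G *)
move=> t t1; pose H0 x := G x + t * N x.
have ndH : {homo H0 : x y / x <= y}.
  move=> x y xy; have Gxy := ndG _ _ xy.
  suff : `|N y - N x| <= G y - G x.
    move=> h; rewrite -subr_ge0 /H0 opprD addrACA -mulrBr.
    have : `|t * (N y - N x)| <= G y - G x.
      by rewrite normrM (le_trans _ h)// ler_piMl.
    by rewrite ler_norml => /andP[h1 _]; rewrite -lerBlDl sub0r.
  rewrite /N /F -sumrB; apply: le_trans (ler_norm_sum _ _ _) _.
  apply: (@le_trans _ _ (\sum_i (c i (G y) - c i (G x)))).
    apply: ler_sum => i _; rewrite -mulrBr normrM.
    have ci := cnd i _ _ Gxy.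
    by rewrite [X in _ * X]ger0_norm ?subr_ge0// ler_piMl ?subr_ge0.
  by rewrite sumrB !sumc; exact: clamp_increment.
have rH : right_continuous H0.
  move=> x; apply: cvgD; first exact: cumulative_is_right_continuous.
  by apply: cvgM; [exact: cvg_cst|exact: rN].
pose H : cumulative R R := HB.pack H0 (isCumulative.Build R _ R H0 ndH rH).
have HE y : H y = G y + t * N y by [].
have lu := loc_bounded_W1inf u; have lv := loc_bounded_W1inf v.
have ltv : loc_bounded (fun x => t * v x) by loc_bounded_tac.
have pE x : prim (u + t *: v) x = prim u x + t * prim v x.
  rewrite -[LHS]/(prim (fun x => u x + t * v x) x) /prim !itv_intD// !itv_intZ//; ring.
apply: (@weakly_nonneg_stieltjes _ _ _ H (is_deriv_lin t uf vg)).
  apply: (@filterS _ _ (ae_filter_ringOfSetsType leb)) fG => x -> xT.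
  rewrite pE gh// pv; last by case/andP: xT => /ltW -> ->.
  by rewrite HE /V0; ring.
rewrite pE pv ?T0 ?lexx// V0T !HE.
by rewrite (N0 0 (ltW x10)) (Nd T (ltW x4T)) -GT; ring.
Qed.

End perturbation.

(** * Fourier series: Bessel's inequality and Dirichlet's kernel *)

Section fourier.
Context {R : realType}.
Implicit Types (f g h p q r w : R -> R) (a b c x y z s t m A B : R) (n k N : nat).
Local Notation leb := (@lebesgue_measure R).
Local Notation T := (2 * pi : R).

Definition cos_coef f n a : R := itv_int (fun x => f x * cos (n%:R * x)) a (a + T).
Definition sin_coef f n a : R := itv_int (fun x => f x * sin (n%:R * x)) a (a + T).

Lemma sin_natT n : sin (n%:R * T) = 0.
Proof.
suff [] : sin (n%:R * T) = 0 /\ cos (n%:R * T) = 1 by [].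
elim: n => [|n [s c]]; first by rewrite mul0r sin0 cos0.
by rewrite -natr1 mulrDl mul1r sinD cosD s c sinT cosT; split; ring.
Qed.

Lemma cos_natT n : cos (n%:R * T) = 1.
Proof.
elim: n => [|n c]; first by rewrite mul0r cos0.
by rewrite -natr1 mulrDl mul1r cosD c sin_natT sinT cosT; ring.
Qed.

Lemma continuous_cosM m : continuous (fun x : R => cos (m * x)).
Proof.
move=> x; apply: (@continuous_comp _ _ _ (fun x => m * x) cos); last exact: continuous_cos.
by apply: cvgM; [exact: cvg_cst|exact: cvg_id].
Qed.

Lemma continuous_sinM m : continuous (fun x : R => sin (m * x)).
Proof.
move=> x; apply: (@continuous_comp _ _ _ (fun x => m * x) sin); last exact: continuous_sin.
by apply: cvgM; [exact: cvg_cst|exact: cvg_id].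
Qed.

Lemma loc_bounded_cosM m : loc_bounded (fun x => cos (m * x)).
Proof. apply: loc_bounded_continuous; exact: continuous_cosM. Qed.

Lemma loc_bounded_sinM m : loc_bounded (fun x => sin (m * x)).
Proof. apply: loc_bounded_continuous; exact: continuous_sinM. Qed.

Let is_derive_mul m x : is_derive x 1 (fun x : R => m * x) m.
Proof.
have := is_deriveZ m (is_derive_id x 1).
by rewrite (_ : m *: 1 = m) //; rewrite -[LHS]/(m * 1) mulr1.
Qed.

Lemma is_prim_sinM m : is_prim (fun x => sin (m * x)) (fun x => m * cos (m * x)).
Proof.
have cc : continuous (fun x => m * cos (m * x)).
  by move=> x; apply: cvgM; [exact: cvg_cst|exact: continuous_cosM].
apply: (@is_prim_cst_add _ _ _ (sin (m * 0))); first exact: loc_bounded_continuous.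
apply: is_derive_primE => // x.
have := @is_derive1_comp _ sin (fun x => m * x) x _ _ (is_derive_sin (m * x)) (is_derive_mul m x).
by rewrite mulrC.
Qed.

Lemma is_prim_cosM m : is_prim (fun x => cos (m * x)) (fun x => - m * sin (m * x)).
Proof.
have cc : continuous (fun x => - m * sin (m * x)).
  by move=> x; apply: cvgM; [exact: cvg_cst|exact: continuous_sinM].
apply: (@is_prim_cst_add _ _ _ (cos (m * 0))); first exact: loc_bounded_continuous.
apply: is_derive_primE => // x.
have := @is_derive1_comp _ cos (fun x => m * x) x _ _ (is_derive_cos (m * x)) (is_derive_mul m x).
by rewrite mulNr mulrC -mulNr.
Qed.

Lemma itv_int_cosM m a : m != 0 -> sin (m * T) = 0 -> cos (m * T) = 1 ->
  itv_int (fun x => cos (m * x)) a (a + T) = 0.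
Proof.
move=> m0 s c; have aT : a <= a + T by rewrite lerDl ltW// period_gt0.
apply: (mulfI m0); rewrite mulr0 -itv_intZ; last exact: loc_bounded_cosM.
have [_ <-//] := is_prim_sinM m.
by rewrite mulrDr sinD s c; ring.
Qed.

Lemma itv_int_sinM m a : sin (m * T) = 0 -> cos (m * T) = 1 ->
  itv_int (fun x => sin (m * x)) a (a + T) = 0.
Proof.
move=> s c; have aT : a <= a + T by rewrite lerDl ltW// period_gt0.
have [->|m0] := eqVneq m 0.
  rewrite (@eq_itv_int _ _ (fun=> 0)) ?itv_int_cst ?mul0r// => x _.
  by rewrite mul0r sin0.
apply: (mulfI (_ : - m != 0)); first by rewrite oppr_eq0.
rewrite mulr0 -itv_intZ; last exact: loc_bounded_sinM.
have [_ <-//] := is_prim_cosM m.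
by rewrite mulrDr cosD s c; ring.
Qed.

Lemma natB_T n k : sin ((n%:R - k%:R) * T) = 0 /\ cos ((n%:R - k%:R) * T) = 1.
Proof. by rewrite mulrBl sinB cosB !sin_natT !cos_natT; split; ring. Qed.

Lemma natD_T n k : sin ((n%:R + k%:R) * T) = 0 /\ cos ((n%:R + k%:R) * T) = 1.
Proof. by rewrite mulrDl sinD cosD !sin_natT !cos_natT; split; ring. Qed.

Lemma int_cos_cos n k a : (0 < n)%N ->
  itv_int (fun x => cos (n%:R * x) * cos (k%:R * x)) a (a + T) =
  if n == k then pi else 0.
Proof.
move=> n0; have aT : a <= a + T by rewrite lerDl ltW// period_gt0.
have [sB cB] := natB_T n k; have [sD cD] := natD_T n k.
have nk0 : n%:R + k%:R != 0 :> R by rewrite -natrD pnatr_eq0 addn_eq0 negb_and -lt0n n0.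
transitivity (itv_int (fun x => 2^-1 * cos ((n%:R - k%:R) * x) + 2^-1 * cos ((n%:R + k%:R) * x)) a (a + T)).
  by apply: eq_itv_int => x _; rewrite mulrBl mulrDl cosB cosD; field.
rewrite itv_int_lin; [|exact: loc_bounded_cosM|exact: loc_bounded_cosM].
rewrite (itv_int_cosM a nk0 sD cD) mulr0 addr0; have [<-|nk] := eqVneq n k.
  rewrite (@eq_itv_int _ _ (fun=> 1)) ?itv_int_cst//; first by field.
  by move=> x _; rewrite subrr mul0r cos0.
by rewrite itv_int_cosM ?mulr0// subr_eq0 eqr_nat.
Qed.

Lemma int_sin_sin n k a : (0 < n)%N ->
  itv_int (fun x => sin (n%:R * x) * sin (k%:R * x)) a (a + T) =
  if n == k then pi else 0.
Proof.
move=> n0; have aT : a <= a + T by rewrite lerDl ltW// period_gt0.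
have [sB cB] := natB_T n k; have [sD cD] := natD_T n k.
have nk0 : n%:R + k%:R != 0 :> R by rewrite -natrD pnatr_eq0 addn_eq0 negb_and -lt0n n0.
transitivity (itv_int (fun x => 2^-1 * cos ((n%:R - k%:R) * x) + - 2^-1 * cos ((n%:R + k%:R) * x)) a (a + T)).
  by apply: eq_itv_int => x _; rewrite mulrBl mulrDl cosB cosD; field.
rewrite itv_int_lin; [|exact: loc_bounded_cosM|exact: loc_bounded_cosM].
rewrite (itv_int_cosM a nk0 sD cD) mulr0 addr0; have [<-|nk] := eqVneq n k.
  rewrite (@eq_itv_int _ _ (fun=> 1)) ?itv_int_cst//; first by field.
  by move=> x _; rewrite subrr mul0r cos0.
by rewrite itv_int_cosM ?mulr0// subr_eq0 eqr_nat.
Qed.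

Lemma int_sin_cos n k a :
  itv_int (fun x => sin (n%:R * x) * cos (k%:R * x)) a (a + T) = 0.
Proof.
have [sB cB] := natB_T n k; have [sD cD] := natD_T n k.
transitivity (itv_int (fun x => 2^-1 * sin ((n%:R - k%:R) * x) + 2^-1 * sin ((n%:R + k%:R) * x)) a (a + T)).
  by apply: eq_itv_int => x _; rewrite mulrBl mulrDl sinB sinD; field.
rewrite itv_int_lin; [|exact: loc_bounded_sinM|exact: loc_bounded_sinM].
by rewrite !itv_int_sinM// !mulr0 addr0.
Qed.

Let trig (n : nat) (A B : R) (x : R) : R := A * cos (n%:R * x) + B * sin (n%:R * x).

Let loc_bounded_trig n A B : loc_bounded (trig n A B).
Proof.
have lc := @loc_bounded_cosM n%:R; have ls := @loc_bounded_sinM n%:R.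
by rewrite /trig; loc_bounded_tac.
Qed.

Let int_trig f n A B a : loc_bounded f ->
  itv_int (fun x => trig n A B x * f x) a (a + T) = A * cos_coef f n a + B * sin_coef f n a.
Proof.
have lc := @loc_bounded_cosM n%:R; have ls := @loc_bounded_sinM n%:R.
move=> lf; rewrite -itv_int_lin; try loc_bounded_tac.
by apply: eq_itv_int => x _; rewrite /trig; ring.
Qed.

Let cos_coef_trig n k A B a : (0 < n)%N ->
  cos_coef (trig n A B) k a = A * (if n == k then pi else 0).
Proof.
move=> n0; have lc := @loc_bounded_cosM k%:R.
rewrite /cos_coef int_trig// /cos_coef /sin_coef.
rewrite -(int_cos_cos k a n0) -[RHS]addr0; congr (_ * _ + _).
  by apply: eq_itv_int => x _; rewrite mulrC.
by rewrite -(mulr0 B) -(int_sin_cos n k a); congr (_ * _); apply: eq_itv_int => x _; rewrite mulrC.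
Qed.

Let sin_coef_trig n k A B a : (0 < n)%N ->
  sin_coef (trig n A B) k a = B * (if n == k then pi else 0).
Proof.
move=> n0; have ls := @loc_bounded_sinM k%:R.
rewrite /sin_coef int_trig// /cos_coef /sin_coef.
rewrite -(int_sin_sin k a n0) -[RHS]add0r; congr (_ + _ * _).
  by rewrite int_sin_cos mulr0.
by apply: eq_itv_int => x _; rewrite mulrC.
Qed.

Lemma cos_coefB f g n a : loc_bounded f -> loc_bounded g ->
  cos_coef (fun x => f x - g x) n a = cos_coef f n a - cos_coef g n a.
Proof.
move=> lf lg; have lc := @loc_bounded_cosM n%:R.
rewrite /cos_coef -itv_intB; try loc_bounded_tac.
by apply: eq_itv_int => x _; rewrite mulrBl.
Qed.

Lemma sin_coefB f g n a : loc_bounded f -> loc_bounded g ->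
  sin_coef (fun x => f x - g x) n a = sin_coef f n a - sin_coef g n a.
Proof.
move=> lf lg; have ls := @loc_bounded_sinM n%:R.
rewrite /sin_coef -itv_intB; try loc_bounded_tac.
by apply: eq_itv_int => x _; rewrite mulrBl.
Qed.

(** Bessel's inequality, by removing the projections on successive modes. *)
Lemma bessel f n a : loc_bounded f ->
  \sum_(k < n) (cos_coef f k.+1 a ^+ 2 + sin_coef f k.+1 a ^+ 2) <=
  pi * itv_int (fun x => f x * f x) a (a + T).
Proof.
move=> lf; suff key (m : nat) : \sum_(k < n) (cos_coef f (m.+1 + k) a ^+ 2 + sin_coef f (m.+1 + k) a ^+ 2) <=
  pi * itv_int (fun x => f x * f x) a (a + T) by exact: (key 0).
have p0 := pi_gt0 R; have aT : a <= a + T by rewrite lerDl ltW// period_gt0.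
elim: n m f lf => [|n IH] m f lf.
  rewrite big_ord0; apply: mulr_ge0; first exact: ltW.
  by apply: Rintegral_ge0 => x _; rewrite -expr2 sqr_ge0.
pose A := cos_coef f m.+1 a; pose B := sin_coef f m.+1 a.
pose p := trig m.+1 (A / pi) (B / pi).
have lp : loc_bounded p by exact: loc_bounded_trig.
have lfp : loc_bounded (fun x => f x - p x) by loc_bounded_tac.
rewrite big_ord_recl addn0 -/A -/B.
have -> : \sum_(i < n) (cos_coef f (m.+1 + lift ord0 i) a ^+ 2 + sin_coef f (m.+1 + lift ord0 i) a ^+ 2) =
    \sum_(k < n) (cos_coef (fun x => f x - p x) (m.+2 + k) a ^+ 2 + sin_coef (fun x => f x - p x) (m.+2 + k) a ^+ 2).
  apply: eq_bigr => i _; rewrite cos_coefB// sin_coefB// cos_coef_trig// sin_coef_trig//.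
  have -> : (m.+1 + lift ord0 i = m.+2 + i)%N by rewrite /lift/= /bump/= addnA addn1.
  have -> : (m.+1 == m.+2 + i)%N = false by rewrite addSn ltn_eqF// ltnS leq_addr.
  by rewrite !mulr0 !subr0.
apply: le_trans (lerD (lexx _) (IH m.+1 _ lfp)) _.
suff -> : itv_int (fun x => (f x - p x) * (f x - p x)) a (a + T) =
    itv_int (fun x => f x * f x) a (a + T) - (A ^+ 2 + B ^+ 2) / pi.
  by rewrite mulrBr mulrCA divff ?gt_eqF// mulr1 subrKC.
transitivity (itv_int (fun x => 1 * (f x * f x) + 1 * ((-2) * (p x * f x) + 1 * (p x * p x))) a (a + T)).
  by apply: eq_itv_int => x _; ring.
rewrite itv_int_lin ?itv_int_lin; try loc_bounded_tac.
rewrite !int_trig// cos_coef_trig// sin_coef_trig// eqxx -/A -/B.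
by rewrite !divfK ?gt_eqF//; ring.
Qed.

(** By Bessel's inequality the squares of the coefficients have bounded sums. *)
Lemma riemann_lebesgue f a : loc_bounded f ->
  cos_coef f n a @[n --> \oo] --> 0 /\ sin_coef f n a @[n --> \oo] --> 0.
Proof.
move=> lf; pose u n := cos_coef f n.+1 a ^+ 2 + sin_coef f n.+1 a ^+ 2.
have u0 n : 0 <= u n by rewrite addr_ge0 ?sqr_ge0.
have cu : cvgn (series u).
  apply: nondecreasing_is_cvgn.
    by apply/nondecreasing_seqP => n; rewrite !seriesEnat/= big_nat_recr//= lerDl.
  exists (pi * itv_int (fun x => f x * f x) a (a + T)) => _ [n _ <-].
  by rewrite /series/= big_mkord; exact: bessel.
have {cu} u_cvg := cvg_series_cvg_0 cu.
suff key (c : nat -> R) : (forall n, c n.+1 ^+ 2 <= u n) -> c n @[n --> \oo] --> 0.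
  by split; apply: key => n; rewrite /u ?lerDl ?lerDr sqr_ge0.
move=> cu; rewrite -cvg_shiftS; apply/cvgr0Pnorm_lt => e e0.
have e20 : 0 < e ^+ 2 by rewrite exprn_gt0.
move/cvgr0Pnorm_lt : u_cvg => /(_ _ e20); apply: filterS => n /=.
rewrite ger0_norm// => /(le_lt_trans (cu n)).
by rewrite -real_normK ?num_real// ltr_pXn2r ?nnegrE// ltW.
Qed.

Definition dirichlet N s : R := 1 + 2 * \sum_(k < N) cos (k.+1%:R * s).

Lemma dirichletS N s : dirichlet N.+1 s = dirichlet N s + 2 * cos (N.+1%:R * s).
Proof. by rewrite /dirichlet big_ord_recr/= mulrDr addrA. Qed.

Lemma loc_bounded_dirichlet N x : loc_bounded (fun t => dirichlet N (t - x)).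
Proof.
elim: N => [|N IH].
  rewrite (_ : (fun t => _) = fun=> 1); first exact: loc_bounded_cst.
  by apply/funext => t; rewrite /dirichlet big_ord0 mulr0 addr0.
have lc := @loc_bounded_cosM N.+1%:R; have ls := @loc_bounded_sinM N.+1%:R.
rewrite (_ : (fun t => _) = fun t => dirichlet N (t - x) +
  2 * (cos (N.+1%:R * t) * cos (N.+1%:R * x) + sin (N.+1%:R * t) * sin (N.+1%:R * x))).
  by loc_bounded_tac.
by apply/funext => t; rewrite dirichletS [N.+1%:R * (t - x)]mulrBr cosB.
Qed.

Lemma dirichletE N s : sin (2^-1 * s) * dirichlet N s = sin ((N%:R + 2^-1) * s).
Proof.
elim: N => [|N IH]; first by rewrite /dirichlet big_ord0 mulr0 addr0 mulr1 add0r.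
rewrite dirichletS mulrDr IH.
have -> : (N%:R + 2^-1) * s = N.+1%:R * s - 2^-1 * s by rewrite -natr1; field.
rewrite sinB [in RHS]mulrDl sinD; ring.
Qed.

Lemma le_sin_half y : 0 <= y <= pi / 2 -> y / 2 <= sin y.
Proof.
move=> /andP[y0 yp].
have key (z : R) : 0 <= z <= pi / 4 -> z * cos (pi / 4) <= sin z.
  move=> /andP[z0 zp]; have [_ /(_ _ _ z0)] := @is_prim_sin R.
  rewrite sin0 subr0 => ->; rewrite mulrC -[z in X in X <= _]subr0 -itv_int_cst//.
  apply: le_itv_int; [exact: loc_bounded_cst|exact: loc_bounded_is_prim is_prim_cos|].
  move=> x /andP[x0 xz]; rewrite leNgt; apply/negP => h.
  have p0 := pi_gt0 R.
  have xz4 : x <= pi / 4 by exact: le_trans zp.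
  move: h; rewrite ltr_cos ?in_itv/= ?ltNge ?xz4//.
    by apply/andP; split; lra.
  by apply/andP; split; lra.
have c2 : cos (pi / 4) ^+ 2 = 2^-1 :> R.
  have : cos (pi / 2) = 0 :> R by exact: cos_pihalf.
  have -> : pi / 2 = pi / 4 + pi / 4 :> R by field.
  rewrite cosD -!expr2 sin2cos2; lra.
have p0 := pi_gt0 R.
have yz : 0 <= y / 2 <= pi / 4 by apply/andP; split; lra.
have c0 : 0 <= cos (pi / 4) :> R by apply: cos_ge0_pihalf; apply/andP; split; lra.
have cy : cos (pi / 4) <= cos (y / 2).
  rewrite leNgt ltr_cos ?in_itv/= -?leNgt; try (apply/andP; split; lra).
  by case/andP: yz.
have -> : sin y = 2 * (sin (y / 2) * cos (y / 2)).
  have {1}-> : y = y / 2 + y / 2 by field.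
  by rewrite sinD; ring.
have h1 := key _ yz; have := ler_pM _ c0 h1 cy.
have -> : y / 2 * cos (pi / 4) * cos (pi / 4) = y / 2 / 2.
  by rewrite -[LHS]mulrA -expr2 c2.
move=> h.
have {}h : y / 2 / 2 <= sin (y / 2) * cos (y / 2).
  by apply: h; rewrite mulr_ge0//; case/andP: yz.
lra.
Qed.

Lemma measurable_inv : measurable_fun setT (fun x : R => x^-1).
Proof.
have -> : [set: R] = [set x | x != 0] `|` [set 0].
  by apply/seteqP; split => x //= _; have [->|] := eqVneq x 0; [right|left].
have o : open [set x : R | x != 0] by exact: open_neq.
apply/measurable_funU => //; first exact: open_measurable.
split; last exact: measurable_fun_set1.
apply: open_continuous_measurable_fun => //.
by move=> x; rewrite inE => /= x0; exact: inv_continuous.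
Qed.

(** Localisation: dividing by sin (s / 2) turns the Dirichlet integral of a
    function that is O(s) into a Fourier coefficient of a bounded function. *)
Lemma dirichlet_cvg0 w C : loc_bounded w -> (forall s, `|s| <= pi -> `|w s| <= C * `|s|) ->
  itv_int (fun s => w s * dirichlet N s) (- pi) (- pi + T) @[N --> \oo] --> 0.
Proof.
move=> lw wC; have p0 := pi_gt0 R.
have C0 : 0 <= C.
  have := wC 1; rewrite normr1 mulr1 => h; apply: le_trans (h _) => //.
  by have := @pi_ge2 R; lra.
have half s : `|s| <= pi -> `|s| / 4 <= `|sin (2^-1 * s)|.
  have pos z : 0 <= z <= pi -> z / 4 <= sin (2^-1 * z).
    move=> /andP[z0 zp]; have := @le_sin_half (2^-1 * z).
    have -> : z / 4 = 2^-1 * z / 2 by field.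
    by apply; apply/andP; split; lra.
  move=> sp; have [s0|/ltW s0] := leP 0 s.
    by rewrite ger0_norm// (le_trans (pos _ _)) ?ler_norm// s0 -[s]ger0_norm.
  rewrite -[X in _ <= X]normrN -sinN -mulrN ler0_norm// (le_trans (pos _ _)) ?ler_norm//.
  by rewrite oppr_ge0 s0 -ler0_norm.
pose q s := w s / sin (2^-1 * s) * \1_(`](- pi), pi]%classic) s.
have lq : loc_bounded q.
  split.
    apply: measurable_funM; last exact: measurable_indic.
    apply: measurable_funM; first by case: lw.
    apply: (measurableT_comp measurable_inv).
    by apply: continuous_measurable_fun; exact: continuous_sinM.
  move=> M; exists (C * 4) => s _; rewrite /q indicE.
  have [|_] := boolP (s \in _); last by rewrite mulr0 normr0 mulr_ge0.
  rewrite inE/= in_itv/= => /andP[/ltW s1 s2]; rewrite mulr1.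
  have sp : `|s| <= pi by rewrite ler_norml s1.
  have [->|s0] := eqVneq s 0.
    by rewrite mulr0 sin0 invr0 mulr0 normr0 mulr_ge0.
  have sn0 : 0 < `|sin (2^-1 * s)|.
    by apply: lt_le_trans (half _ sp); rewrite divr_gt0// normr_gt0.
  rewrite normrM normfV ler_pdivrMr//; apply: le_trans (wC _ sp) _.
  rewrite -mulrA ler_wpM2l//; have := half _ sp; lra.
have lc := @loc_bounded_cosM 2^-1; have ls := @loc_bounded_sinM 2^-1.
pose q1 s := q s * cos (2^-1 * s); pose q2 s := q s * sin (2^-1 * s).
have lq1 : loc_bounded q1 by rewrite /q1; loc_bounded_tac.
have lq2 : loc_bounded q2 by rewrite /q2; loc_bounded_tac.
have E N : itv_int (fun s => w s * dirichlet N s) (- pi) (- pi + T) =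
    sin_coef q1 N (- pi) + cos_coef q2 N (- pi).
  have lcN := @loc_bounded_cosM N%:R; have lsN := @loc_bounded_sinM N%:R.
  rewrite /sin_coef /cos_coef -itv_intD; try loc_bounded_tac.
  apply: eq_itv_int => s /andP[s1 s2].
  have {}s2 : s <= pi by lra.
  have sp : `|s| <= pi by rewrite ler_norml (ltW s1).
  have -> : w s = q s * sin (2^-1 * s).
    rewrite /q indicE mem_set/= ?in_itv/= ?s1// mulr1.
    have [->|s0] := eqVneq s 0.
      have := wC 0; rewrite normr0 mulr0 normr_le0 => /(_ (ltW p0)) /eqP ->.
      by rewrite !mul0r.
    rewrite divfK// -normr_gt0; apply: lt_le_trans (half _ sp).
    by rewrite divr_gt0// normr_gt0.
  by rewrite -mulrA dirichletE mulrDl sinD /q1 /q2; ring.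
under eq_fun do rewrite E.
rewrite -[0]addr0; apply: cvgD.
  exact: (riemann_lebesgue _ lq1).2.
exact: (riemann_lebesgue _ lq2).1.
Qed.

Lemma dirichlet_int f x N : loc_bounded f ->
  itv_int (fun t => f t * dirichlet N (t - x)) 0 T =
  itv_int f 0 T + 2 * \sum_(k < N) (cos_coef f k.+1 0 * cos (k.+1%:R * x) +
    sin_coef f k.+1 0 * sin (k.+1%:R * x)).
Proof.
move=> lf; elim: N => [|N IH].
  by rewrite big_ord0 mulr0 addr0; apply: eq_itv_int => t _; rewrite /dirichlet big_ord0 mulr0 addr0 mulr1.
have lcN := @loc_bounded_cosM N.+1%:R; have lsN := @loc_bounded_sinM N.+1%:R.
have ld := loc_bounded_dirichlet N x.
rewrite [in RHS]big_ord_recr/=; set S := \sum_(k < N) _ in IH *.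
rewrite (_ : forall z, itv_int f 0 T + 2 * (S + z) = itv_int f 0 T + 2 * S + 2 * z); last by move=> z; ring.
rewrite -IH /cos_coef /sin_coef !add0r.
transitivity (itv_int (fun t => 1 * (f t * dirichlet N (t - x)) +
   2 * (cos (N.+1%:R * x) * (f t * cos (N.+1%:R * t)) + sin (N.+1%:R * x) * (f t * sin (N.+1%:R * t)))) 0 T).
  apply: eq_itv_int => t _.
  by rewrite dirichletS [N.+1%:R * (t - x)]mulrBr cosB; ring.
rewrite itv_int_lin ?itv_int_lin; try loc_bounded_tac.
ring.
Qed.

(** Subtracting the constant f(x), which the constant mode reproduces, leaves a
    function that vanishes linearly at x, to which localisation applies. *)
Lemma fourier_pointwise f x C : loc_bounded f -> periodicT f ->
  (forall s, `|s| <= pi -> `|f (x + s) - f x| <= C * `|s|) ->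
  itv_int f 0 T + 2 * \sum_(k < N) (cos_coef f k.+1 0 * cos (k.+1%:R * x) +
    sin_coef f k.+1 0 * sin (k.+1%:R * x)) @[N --> \oo] --> T * f x.
Proof.
move=> lf pf fC; have T0 := ltW (@period_gt0 R).
have lfx : loc_bounded (fun t => f t - f x).
  by have := loc_bounded_cst (f x); move=> ?; loc_bounded_tac.
have lw : loc_bounded (fun s => f (s + x) - f x).
  split.
    apply: measurable_funB => //; apply: (measurableT_comp lf.1).
    exact: measurable_funD.
  move=> M; have [K hK] := lfx.2 (M + `|x|); exists K => s sM; apply: hK.
  by rewrite (le_trans (ler_normD _ _))// lerD2r.
have pdir N s : dirichlet N (s + T) = dirichlet N s.
  rewrite /dirichlet; congr (1 + 2 * _); apply: eq_bigr => k _.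
  by rewrite mulrDr cosD cos_natT sin_natT mulr1 mulr0 subr0.
have E N : itv_int (fun s => (f (s + x) - f x) * dirichlet N s) (- pi) (- pi + T) =
  itv_int f 0 T + 2 * \sum_(k < N) (cos_coef f k.+1 0 * cos (k.+1%:R * x) +
    sin_coef f k.+1 0 * sin (k.+1%:R * x)) - T * f x.
  have ldN := loc_bounded_dirichlet N x.
  have lp : loc_bounded (fun t => (f t - f x) * dirichlet N (t - x)) by loc_bounded_tac.
  transitivity (itv_int (fun t => (f t - f x) * dirichlet N (t - x)) (- pi + x) (- pi + T + x)).
    rewrite itv_int_translate//; apply: eq_itv_int => s _.
    by rewrite addrK.
  rewrite (addrAC (- pi)) itv_int_period//; last first.
    by move=> t; rewrite pf addrAC pdir.
  rewrite dirichlet_int//.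
  have l1 := loc_bounded_cst (f x).
  have cst_coef k : cos_coef (fun=> f x) k.+1 0 = 0 /\ sin_coef (fun=> f x) k.+1 0 = 0.
    rewrite /cos_coef /sin_coef !itv_intZ; [|exact: loc_bounded_sinM|exact: loc_bounded_cosM].
    by rewrite itv_int_cosM ?itv_int_sinM ?mulr0 ?sin_natT ?cos_natT ?pnatr_eq0.
  rewrite itv_intB// itv_int_cst// subr0 addrAC [f x * _]mulrC; congr (_ + _ * _ - _).
  apply: eq_bigr => k _; rewrite cos_coefB// sin_coefB//.
  by have [-> ->] := cst_coef k; rewrite !subr0.
rewrite -[T * f x]add0r.
have wC s : `|s| <= pi -> `|f (s + x) - f x| <= C * `|s|.
  by move=> sp; rewrite (addrC s); exact: fC.
have := dirichlet_cvg0 lw wC; under eq_fun do rewrite E.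
move=> h; rewrite (_ : (fun N => _) = (fun N => itv_int f 0 T + 2 * \sum_(k < N) (cos_coef f k.+1 0 * cos (k.+1%:R * x) +
    sin_coef f k.+1 0 * sin (k.+1%:R * x)) - T * f x + T * f x)); last first.
  by apply/funext => N; rewrite subrK.
by apply: cvgD; [exact: h|exact: cvg_cst].
Qed.

End fourier.

(** * Comparison of Sobolev norms for short supports *)

Section sobolev.
Context {R : realType}.
Implicit Types (f g h : R -> R) (a b c x y s t : R) (u v : W1inf R).
Local Notation leb := (@lebesgue_measure R).
Local Notation T := (2 * pi : R).

Lemma esum_int_even (e : nat -> \bar R) : (forall n, (0 <= e n)%E) ->
  (\esum_(n in [set: int]) e `|n|%N = e 0%N + (\sum_(0 <= k <oo) e k.+1 + \sum_(0 <= k <oo) e k.+1))%E.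
Proof.
move=> e0; rewrite (esumID [set 0])//; congr (_ + _)%E.
  by rewrite setTI esum_set1.
rewrite (esumID (range Negz))//; rewrite addeC; congr (_ + _)%E.
  have -> : [set: int] `&` ~` [set 0] `&` ~` range Negz = range (fun k : nat => Posz k.+1).
    apply/seteqP; split => [[[|k]|k] /=|_ [k _ <-]] //=.
    - by move=> [[_ []]].
    - by move=> _; exists k.
    - by move=> [_ []]; exists k.
    - by split; [split|move=> []].
  rewrite esum_image ?nneseries_esumT//.
  by move=> i j _ _ [].
have -> : [set: int] `&` ~` [set 0] `&` range Negz = range Negz.
  by apply/seteqP; split => [z []//|_ [k _ <-]]; split => //; split.
rewrite esum_image ?nneseries_esumT//.
by move=> i j _ _ [].
Qed.

Lemma nneseries_bounded (w : nat -> R) D : (forall k, 0 <= w k) ->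
  (forall n : nat, \sum_(k < n) w k <= D) ->
  exists S, [/\ (\sum_(0 <= k <oo) (w k)%:E = S%:E)%E, S <= D & forall n : nat, \sum_(k < n) w k <= S].
Proof.
move=> w0 wD; pose S := (\sum_(0 <= k <oo) (w k)%:E)%E.
have partial n : (\sum_(0 <= k < n) (w k)%:E = (\sum_(k < n) w k)%:E)%E.
  by rewrite sumEFin big_mkord.
have SD : (S <= D%:E)%E.
  apply: lime_le; first by apply: is_cvg_nneseries => k _ _; rewrite lee_fin.
  by near=> n; rewrite partial lee_fin.
have S0 : (0 <= S)%E by apply: nneseries_ge0 => k _ _; rewrite lee_fin.
have Sfin : S \is a fin_num by rewrite ge0_fin_numE// (le_lt_trans SD)// ltry.
exists (fine S); split; first by rewrite fineK.
  by rewrite -lee_fin fineK.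
move=> n; rewrite -lee_fin fineK// -partial.
by apply: nneseries_lim_ge => k _ _; rewrite lee_fin.
Unshelve. all: by end_near. Qed.

(** The common value of the squared moduli of the Fourier coefficients of indices
    k and - k. *)
Definition mode_energy f (k : nat) : R :=
  (cos_coef f k 0 ^+ 2 + sin_coef f k 0 ^+ 2) / T ^+ 2.

Lemma mode_energy_ge0 f k : 0 <= mode_energy f k.
Proof. by rewrite divr_ge0 ?sqr_ge0// addr_ge0 ?sqr_ge0. Qed.

Lemma fourier_abs2E v (n : int) : fourier_abs2 v n = mode_energy v `|n|.
Proof.
have lv := loc_bounded_W1inf v.
have key f : continuous f -> \int[leb]_(x in @torus R) (v x * f x) = itv_int (fun x => v x * f x) 0 T.
  move=> cf; have lf := loc_bounded_continuous cf.
  have lp : loc_bounded (fun x => v x * f x) by loc_bounded_tac.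
  by apply: torus_itv_int => //; [case: lp|exact: aeW].
have T0 : T != 0 by rewrite gt_eqF// period_gt0.
rewrite /fourier_abs2 /fourier_re /fourier_im /mode_energy /cos_coef /sin_coef !add0r.
rewrite key; last exact: continuous_cosM.
rewrite key; last exact: continuous_sinM.
rewrite sqrrN !exprMn -mulrDr mulrC exprVn; congr (_ / _).
  case: n => k /=; first by [].
  rewrite NegzE mulrNz; congr (_ ^+ 2 + _).
    by apply: eq_itv_int => x _; rewrite mulNr cosN.
  rewrite -sqrrN; congr (_ ^+ 2); rewrite -itv_intN; last first.
    have ls := @loc_bounded_sinM R (- k.+1%:~R); loc_bounded_tac.
  by apply: eq_itv_int => x _; rewrite mulNr sinN mulrN opprK.
by rewrite exprMn.
Qed.

(** A bound on the partial sums is required because [fine] sends an infinite sum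
    to 0. *)
Lemma Hs_semi_sqr (s D : R) v :
  (forall n : nat, \sum_(k < n) k.+1%:R `^ (2 * s) * mode_energy v k.+1 <= D) ->
  exists S, [/\ Hs_semi s v ^+ 2 = 0 `^ (2 * s) * mode_energy v 0 + 2 * S, S <= D &
    forall n : nat, \sum_(k < n) k.+1%:R `^ (2 * s) * mode_energy v k.+1 <= S].
Proof.
move=> hD; have w0 (k : nat) : 0 <= k%:R `^ (2 * s) * mode_energy v k.
  by rewrite mulr_ge0 ?powR_ge0 ?mode_energy_ge0.
have [S [SE SD Sn]] := nneseries_bounded (fun k => w0 k.+1) hD.
exists S; split => //; rewrite /Hs_semi.
under eq_esum do rewrite fourier_abs2E.
rewrite (esum_int_even (e := fun n => (n%:R `^ (2 * s) * mode_energy v n)%:E)) ?SE; last first.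
  by move=> n; rewrite lee_fin.
rewrite /= sqr_sqrtr.
  ring.
rewrite addr_ge0// addr_ge0//.
  by have := Sn 0%N; rewrite big_ord0.
by have := Sn 0%N; rewrite big_ord0.
Qed.

Lemma deriv_coef v g (n : nat) : is_deriv v g ->
  cos_coef g n 0 = n%:R * sin_coef v n 0 /\ sin_coef g n 0 = - (n%:R * cos_coef v n 0).
Proof.
move=> vg; have T0 := ltW (@period_gt0 R).
have lv := loc_bounded_W1inf v; have [lg _ _ _] := vg.
have lc := @loc_bounded_cosM R n%:R; have ls := @loc_bounded_sinM R n%:R.
have vT : v T = v 0 by rewrite -[T]add0r W1inf_periodic.
rewrite /cos_coef /sin_coef !add0r; split.
  have [_ /(_ _ _ T0)] := is_primM (is_deriv_prim vg) (@is_prim_cosM R n%:R).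
  rewrite vT cos_natT mulr0 cos0 subrr.
  have E : itv_int (fun x => g x * cos (n%:R * x) + v x * (- n%:R * sin (n%:R * x))) 0 T =
     itv_int (fun x => 1 * (g x * cos (n%:R * x)) + (- n%:R) * (v x * sin (n%:R * x))) 0 T.
    by apply: eq_itv_int => x _; ring.
  rewrite E itv_int_lin; try loc_bounded_tac.
  by move=> h; lra.
have [_ /(_ _ _ T0)] := is_primM (is_deriv_prim vg) (@is_prim_sinM R n%:R).
rewrite vT sin_natT !mulr0 sin0 ?mulr0 subrr.
have E : itv_int (fun x => g x * sin (n%:R * x) + v x * (n%:R * cos (n%:R * x))) 0 T =
   itv_int (fun x => 1 * (g x * sin (n%:R * x)) + n%:R * (v x * cos (n%:R * x))) 0 T.
  by apply: eq_itv_int => x _; ring.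
rewrite E itv_int_lin; try loc_bounded_tac.
by move=> h; lra.
Qed.

Lemma powR2 (k : nat) : (k%:R : R) `^ (2 * 1) = k%:R ^+ 2.
Proof. by rewrite mulr1 powR_mulrn. Qed.

(** Bessel's inequality for v' bounds the partial sums, so that the H^1
    seminorm is the genuine value of its defining series. *)
Lemma H1_semi_sqr v : exists S, [/\ Hs_semi 1 v ^+ 2 = 2 * S, 0 <= S &
  forall n : nat, \sum_(k < n) k.+1%:R ^+ 2 * mode_energy v k.+1 <= S].
Proof.
have [g vg] := W1inf_deriv v; have [lg _ _ _] := vg.
have T0 := @period_gt0 R.
have B (n : nat) : \sum_(k < n) k.+1%:R `^ (2 * 1) * mode_energy v k.+1 <=
    pi * itv_int (fun x => g x * g x) 0 T / T ^+ 2.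
  have := @bessel R g n 0 lg; rewrite add0r => b.
  apply: (@le_trans _ _ ((\sum_(k < n) (cos_coef g k.+1 0 ^+ 2 + sin_coef g k.+1 0 ^+ 2)) / T ^+ 2)); last first.
    by rewrite ler_pM2r; [exact: b|rewrite invr_gt0 exprn_gt0].
  rewrite mulr_suml; apply: ler_sum => k _; rewrite powR2 /mode_energy mulrA.
  have [-> ->] := deriv_coef k.+1 vg.
  by rewrite sqrrN !exprMn mulrDr addrC.
have [S [SE _ Sn]] := Hs_semi_sqr B.
exists S; split.
- by rewrite SE mulr1 powR0 ?mul0r ?add0r ?pnatr_eq0.
- by have := Sn 0%N; rewrite big_ord0.
move=> n; apply: le_trans (Sn n); apply: ler_sum => k _.
by rewrite powR2.
Qed.

Lemma sum_inv_sqr (n : nat) : \sum_(k < n) (k.+1%:R ^+ 2)^-1 <= 2 :> R.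
Proof.
case: n => [|n]; first by rewrite big_ord0.
suff : \sum_(k < n.+1) (k.+1%:R ^+ 2)^-1 <= 2 - n.+1%:R^-1 :> R.
  by move=> /le_trans; apply; rewrite gerBl.
elim: n => [|n IH]; first by rewrite big_ord1 expr1n invr1; lra.
rewrite big_ord_recr/=; have := lerD IH (lexx (n.+2%:R ^+ 2)^-1).
move=> /le_trans; apply.
have n1 : 0 < n.+1%:R :> R by rewrite ltr0n.
have n2 : n.+2%:R = n.+1%:R + 1 :> R by rewrite -natr1.
have : (n.+2%:R ^+ 2)^-1 <= n.+1%:R^-1 - n.+2%:R^-1 :> R.
  have -> : n.+1%:R^-1 - n.+2%:R^-1 = (n.+1%:R * n.+2%:R)^-1 :> R.
    by rewrite n2; field; rewrite ?gt_eqF//; lra.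
  rewrite lef_pV2 ?posrE ?exprn_gt0 ?mulr_gt0 ?ltr0n//.
  by rewrite expr2 ler_pM2r ?ltr0n// ler_nat.
by move: (_ ^- 2) (n.+2%:R^-1) (n.+1%:R^-1) => p q r h; lra.
Qed.

(** A Sobolev embedding on the circle, for the seminorm defined by Fourier
    coefficients: sum the Fourier series of v(x) - v(0) and use
    2ab <= d a^2 + b^2 / d on each mode. *)
Lemma sup_le_H1 v x : v 0 = 0 -> `|v x| <= 6 * Hs_semi 1 v.
Proof.
move=> v0; have [g vg] := W1inf_deriv v; have [lg pg _ _] := vg.
have T0 := @period_gt0 R; have lv := loc_bounded_W1inf v.
have [S [hS S0 Sn]] := H1_semi_sqr v.
have [C gC] := periodic_bounded lg pg.
have vlip y t : `|t| <= pi -> `|v (y + t) - v y| <= C * `|t|.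
  move=> _; have [_ vP] := is_deriv_prim vg; have [t0|/ltW t0] := leP 0 t.
    rewrite vP ?lerDl//; apply: le_trans (itv_int_norm_le (C := C) lg _ _) _ => //.
      by rewrite lerDl.
    by rewrite addrAC subrr add0r ger0_norm.
  rewrite -normrN opprB vP ?gerDl//; apply: le_trans (itv_int_norm_le (C := C) lg _ _) _ => //.
    by rewrite gerDl.
  by rewrite opprD addNKr ler0_norm.
pose term y (k : nat) := cos_coef v k.+1 0 * cos (k.+1%:R * y) + sin_coef v k.+1 0 * sin (k.+1%:R * y).
have cx := fourier_pointwise lv (@W1inf_periodic _ v) (vlip x).
have c0 := fourier_pointwise lv (@W1inf_periodic _ v) (vlip 0).
have cdiff : 2 * \sum_(k < N) (term x k - term 0 k) @[N --> \oo] --> T * v x.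
  have -> : T * v x = T * v x - T * v 0 by rewrite v0 mulr0 subr0.
  pose part y (N : nat) := itv_int v 0 T + 2 * \sum_(k < N) term y k.
  have -> : (fun N : nat => 2 * \sum_(k < N) (term x k - term 0 k)) = (fun N => part x N - part 0 N).
    by apply/funext => N; rewrite sumrB /part; ring.
  exact: cvgB cx c0.
have bound d : 0 < d -> T * `|v x| <= d * T ^+ 2 * (2 * S) + 5 / d.
  move=> d0; have cn : `|2 * \sum_(k < N) (term x k - term 0 k)| @[N --> \oo] --> `|T * v x| by exact: cvg_norm cdiff.
  have -> : T * `|v x| = limn (fun N => `|2 * \sum_(k < N) (term x k - term 0 k)|).
    by rewrite (cvg_lim _ cn)// normrM gtr0_norm.
  apply: limr_le; first by apply/cvg_ex; exists `|T * v x|.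
  near=> N; rewrite normrM (@ger0_norm _ 2)//.
  have -> : d * T ^+ 2 * (2 * S) + 5 / d = 2 * (d * T ^+ 2 * S + 5 / (4 * d) * 2).
    by field; rewrite gt_eqF.
  rewrite ler_pM2l//; apply: le_trans (ler_norm_sum _ _ _) _.
  apply: (@le_trans _ _ (\sum_(k < N) (d * T ^+ 2 * (k.+1%:R ^+ 2 * mode_energy v k.+1) + 5 / (4 * d) * (k.+1%:R ^+ 2)^-1))).
    apply: ler_sum => k _.
    set n : R := k.+1%:R; have n0 : 0 < n by rewrite ltr0n.
    have -> : term x k - term 0 k = cos_coef v k.+1 0 * (cos (n * x) - 1) + sin_coef v k.+1 0 * sin (n * x).
      by rewrite /term mulr0 cos0 sin0; ring.
    set A := cos_coef _ _ _; set B := sin_coef _ _ _.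
    have -> : d * T ^+ 2 * (n ^+ 2 * mode_energy v k.+1) = d * n ^+ 2 * (A ^+ 2 + B ^+ 2).
      by rewrite /mode_energy -/A -/B; move: T (gt_eqF T0) => t tz; field; rewrite tz.
    have c1 : `|cos (n * x) - 1| <= 2.
      by rewrite ler_norml; have := cos_le1 (n * x); have := cos_geN1 (n * x); move=> *; apply/andP; split; lra.
    have s1 : `|sin (n * x)| <= 1.
      by rewrite ler_norml sin_le1 sin_geN1.
    apply: (@le_trans _ _ (2 * `|A| + `|B|)).
      apply: le_trans (ler_normD _ _) _; rewrite !normrM lerD//.
        by rewrite mulrC ler_wpM2r.
      by rewrite -[X in _ <= X]mulr1 ler_wpM2l.
    pose q := d * n ^+ 2; have q0 : 0 < q by rewrite mulr_gt0// exprn_gt0.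
    have -> : 5 / (4 * d) * (n ^+ 2)^-1 = q^-1 + (4 * q)^-1.
      by rewrite /q; field; rewrite !gt_eqF.
    have amgm z r : 0 < r -> 2 * z <= q * z ^+ 2 * r + (q * r)^-1.
      move=> r0; have qr : 0 < q * r by rewrite mulr_gt0.
      rewrite -subr_ge0; have -> : q * z ^+ 2 * r + (q * r)^-1 - 2 * z = (q * r) * (z - (q * r)^-1) ^+ 2.
        by field; rewrite !gt_eqF.
      by rewrite mulr_ge0 ?sqr_ge0// ltW.
    have := amgm `|A| 1 ltr01; have := amgm (`|B|) 2 (ltr0Sn R 1).
    rewrite !mulr1 !real_normK ?num_real// => h1 h2.
    have h3 : (q * 2)^-1 = 2 * (4 * q)^-1 by field; rewrite gt_eqF.
    rewrite -/q mulrDr; lra.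
  rewrite big_split/= -!mulr_sumr; apply: lerD.
    by apply: ler_wpM2l; [rewrite mulr_ge0 ?sqr_ge0// ltW|exact: Sn].
  by apply: ler_wpM2l; [rewrite divr_ge0// mulr_ge0// ltW|exact: sum_inv_sqr].
set h := Hs_semi 1 v in hS *; have h0 : 0 <= h by exact: sqrtr_ge0.
rewrite -hS in bound.
have [hpos|h_le0] := ltP 0 h.
  (* this d balances the two terms up to a constant *)
  have := bound (T * h)^-1; rewrite invr_gt0 mulr_gt0// => /(_ isT).
  have -> : (T * h)^-1 * T ^+ 2 * h ^+ 2 + 5 / (T * h)^-1 = T * (6 * h).
    by move: T (gt_eqF T0) (gt_eqF hpos) => t tz hz; field; rewrite tz hz.
  by rewrite ler_pM2l.
have hz : h = 0 by apply/eqP; rewrite eq_le h_le0.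
rewrite hz mulr0 leNgt; apply/negP => vx.
have Tv : 0 < T * `|v x| by rewrite mulr_gt0.
have := bound (10 / (T * `|v x|)); rewrite divr_gt0// hz expr0n/= mulr0 add0r => /(_ isT).
have -> : 5 / (10 / (T * `|v x|)) = T * `|v x| / 2.
  by move: (_ * `|v x|) (gt_eqF Tv) => t tz; field; rewrite tz.
lra.
Unshelve. all: by end_near. Qed.

Lemma H1_semi_gt0 v x : v 0 = 0 -> v x != 0 -> 0 < Hs_semi 1 v.
Proof.
move=> v0 vx; have := sup_le_H1 x v0.
rewrite -normr_gt0 in vx; move=> /(lt_le_trans vx).
by rewrite pmulr_rgt0.
Qed.

(** Young's inequality: the power r < 2 is dominated by a small multiple of the
    square, up to a constant. *)
Lemma powR_le_sqr r d : 0 <= r < 2 -> 0 < d ->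
  exists2 K : R, 0 <= K & forall k : nat, k.+1%:R `^ r <= d * k.+1%:R ^+ 2 + K.
Proof.
move=> /andP[r0 r2] d0; pose M := d^-1 `^ (2 - r)^-1; exists (M ^+ 2); first exact: sqr_ge0.
move=> k; set x : R := k.+1%:R; have x0 : 0 < x by rewrite ltr0n.
have x1 : 1 <= x by rewrite ler1n.
have r20 : 2 - r != 0 by rewrite gt_eqF// subr_gt0.
have x2 : x ^+ 2 = x `^ r * x `^ (2 - r).
  rewrite -powRD; first by rewrite addrC subrK powR_mulrn// ltW.
  by rewrite addrC subrK pnatr_eq0.
have [big|small] := leP d^-1 (x `^ (2 - r)).
  rewrite -[X in X <= _]addr0 lerD ?sqr_ge0// x2 mulrCA ler_peMr ?powR_ge0//.
  by rewrite mulrC -ler_pdivrMr// div1r.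
have xM : x <= M.
  have -> : x = (x `^ (2 - r)) `^ (2 - r)^-1 by rewrite -powRrM mulfV// powRr1// ltW.
  apply: ge0_ler_powR; rewrite ?nnegrE ?powR_ge0 ?invr_ge0 ?subr_ge0// ltW//.
apply: le_trans (_ : x ^+ 2 <= _).
  by rewrite -powR_mulrn ?ler_powR// ltW.
rewrite -[X in X <= _]add0r lerD//; first by rewrite mulr_ge0 ?sqr_ge0// ltW.
by rewrite lerXn2r// nnegrE ?powR_ge0// ltW.
Qed.

Lemma itv_int_supp_le f a b C : loc_bounded f -> 0 <= a -> a <= b -> b <= T ->
  (forall x, `|f x| <= C) -> (forall x, 0 <= x <= T -> ~ (a < x < b) -> f x = 0) ->
  `|itv_int f 0 T| <= C * (b - a).
Proof.
move=> lf a0 ab bT fC fz.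
have aT := le_trans ab bT; have b0 := le_trans a0 ab.
rewrite -(itv_int_cat lf a0 aT) -(itv_int_cat lf ab bT).
have z y z : 0 <= y -> y <= z -> z <= T -> (forall x, y < x <= z -> ~ (a < x < b)) -> itv_int f y z = 0.
  move=> y0 yz zT yzab; rewrite (@eq_itv_int _ _ (fun=> 0)) ?itv_int_cst ?mul0r//.
  move=> x /andP[yx xz]; apply: fz; last by apply: yzab; rewrite yx.
  by rewrite (le_trans y0 (ltW yx)) (le_trans xz zT).
rewrite (z 0 a) ?add0r//; last by move=> x /andP[_ xa] /andP[]; rewrite ltNge xa.
rewrite (z b T) ?addr0//; last by move=> x /andP[bx _] /andP[_]; rewrite ltNge (ltW bx).
exact: itv_int_norm_le.
Qed.

(** For functions with short support the H^1 seminorm controls every H^s norm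
    with s < 1 with a small constant: the supremum is controlled by the former
    and hence so is the L^2 norm, with a factor going to 0 with the length. *)
Lemma short_support s d : 0 <= s < 1 -> 0 < d ->
  exists2 l : R, 0 < l & forall v a b, 0 <= a -> a <= b -> b <= T -> b - a <= l -> v 0 = 0 ->
    (forall x, 0 <= x <= T -> ~ (a < x < b) -> v x = 0) ->
    Hs_norm s v ^+ 2 <= d * Hs_semi 1 v ^+ 2.
Proof.
move=> /andP[s0 s1] d0.
have s2 : 0 <= 2 * s < 2 by apply/andP; split; lra.
have d2 : 0 < d / 2 by rewrite divr_gt0.
have [K K0 pK] := powR_le_sqr s2 d2.
have T0 := @period_gt0 R; have T1 : 1 <= T by have := @pi_ge2 R; lra.
have den0 : 0 < 2 * (72 + 72 * K) by lra.
exists (Num.min 1 (d / (2 * (72 + 72 * K)))).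
  by rewrite lt_min ltr01 divr_gt0.
move=> v a b a0 ab bT; set l := b - a; rewrite le_min => /andP[l1 ld] v0 vz.
have l0 : 0 <= l by rewrite subr_ge0.
have [S [hS S0 Sn]] := H1_semi_sqr v; have lv := loc_bounded_W1inf v.
set h := Hs_semi 1 v in hS *; have h0 : 0 <= h by exact: sqrtr_ge0.
have vh x : `|v x| <= 6 * h by exact: sup_le_H1.
have lvv : loc_bounded (fun x => v x * v x) by loc_bounded_tac.
pose E := itv_int (fun x => v x * v x) 0 T.
have E0 : 0 <= E.
  by apply: (@le_trans _ _ (itv_int (fun=> 0) 0 T)); [rewrite itv_int_cst ?mul0r// ltW|apply: le_itv_int => //; try loc_bounded_tac; move=> x _; rewrite -expr2 sqr_ge0].
have El : E <= 36 * h ^+ 2 * l.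
  apply: le_trans (ler_norm _) _; apply: itv_int_supp_le => //.
    move=> x; rewrite normrM (_ : 36 * h ^+ 2 = (6 * h) * (6 * h)); last by ring.
    by rewrite ler_pM.
  by move=> x x0T xab; rewrite vz// mulr0.
have e0 : mode_energy v 0 <= 36 * h ^+ 2 * l.
  rewrite /mode_energy ler_pdivrMr ?exprn_gt0//.
  have -> : sin_coef v 0 0 = 0.
    rewrite /sin_coef (@eq_itv_int _ _ (fun=> 0)) ?itv_int_cst ?mul0r// ?add0r ?ltW//.
    by move=> x _; rewrite mul0r sin0 mulr0.
  have -> : cos_coef v 0 0 = itv_int v 0 T.
    by rewrite /cos_coef add0r; apply: eq_itv_int => x _; rewrite mul0r cos0 mulr1.
  have := itv_int_supp_le lv a0 ab bT vh vz; rewrite -/l => Iv.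
  rewrite expr0n addr0 -real_normK ?num_real//.
  apply: (@le_trans _ _ ((6 * h * l) ^+ 2)).
    by rewrite lerXn2r// nnegrE// !mulr_ge0.
  rewrite (_ : (6 * h * l) ^+ 2 = 36 * h ^+ 2 * l * l); last by ring.
  apply: ler_wpM2l; first by rewrite !mulr_ge0// sqr_ge0.
  apply: le_trans l1 _; exact: exprn_ege1.
(* Bessel's inequality absorbs the constant of Young's inequality *)
have en (n : nat) : \sum_(k < n) mode_energy v k.+1 <= E.
  rewrite /mode_energy -mulr_suml ler_pdivrMr ?exprn_gt0//.
  have := @bessel R v n 0 lv; rewrite add0r => /le_trans; apply.
  rewrite mulrC; apply: ler_wpM2l => //.
  by rewrite expr2; have := @pi_ge2 R; nra.
have D (n : nat) : \sum_(k < n) k.+1%:R `^ (2 * s) * mode_energy v k.+1 <= d / 2 * S + K * E.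
  apply: (@le_trans _ _ (\sum_(k < n) (d / 2 * (k.+1%:R ^+ 2 * mode_energy v k.+1) + K * mode_energy v k.+1))).
    apply: ler_sum => k _; rewrite [X in _ <= X + _]mulrA -mulrDl.
    by apply: ler_wpM2r; rewrite ?mode_energy_ge0 ?pK.
  rewrite big_split/= -!mulr_sumr; apply: lerD; apply: ler_wpM2l => //.
  - exact: ltW.
  - exact: Sn.
  - exact: en.
have [S' [SE SD S'0]] := Hs_semi_sqr D.
have {}S'0 : 0 <= S' by have := S'0 0%N; rewrite big_ord0.
have p0 : 0 `^ (2 * s) * mode_energy v 0 <= mode_energy v 0.
  rewrite ler_piMl ?mode_energy_ge0//; have [->|sn0] := eqVneq s 0.
    by rewrite mulr0 powRr0.
  by rewrite powR0 ?mulf_neq0.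
have tI : \int[leb]_(x in @torus R) (v x ^+ 2) = E.
  apply: torus_itv_int => //; last by apply: aeW => x; rewrite expr2.
  by case: lvv.
have semi0 := sqr_ge0 (Hs_semi s v).
rewrite /Hs_norm sqr_sqrtr tI ?addr_ge0// SE.
move: ld; rewrite ler_pdivlMr// => ld.
have h2 : 0 <= h ^+ 2 by exact: sqr_ge0.
have := ler_wpM2l K0 El; have := ler_wpM2l h2 ld.
have := mulr_ge0 h2 l0; have := mulr_ge0 K0 (mulr_ge0 h2 l0).
rewrite -/h; move: (mode_energy v 0) (0 `^ _ * _) p0 e0 => m pm p0 e0.
nra.
Qed.

End sobolev.

(** * Second-order optimality *)

Section second_order.
Context {R : realType} {V : normedModType R}.
Implicit Types (j : V -> R) (u v w : V) (t : R).

Lemma is_derive_line j u v t : differentiable j (u + t *: v) ->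
  is_derive t (1 : R) (fun r : R => j (u + r *: v)) ('d j (u + t *: v) v).
Proof.
move=> dj.
have E : (fun h : R => h^-1 *: (((fun r : R => j (u + r *: v)) \o shift t) (h *: 1) - j (u + t *: v))) =
   (fun h : R => h^-1 *: ((j \o shift (u + t *: v)) (h *: v) - j (u + t *: v))).
  apply/funext => h /=; congr (_ *: (j _ - _)).
  by rewrite -[h *: 1]/(h * 1) mulr1 scalerDl addrCA.
apply: DeriveDef; last by rewrite -deriveE// /derive E.
by rewrite /derivable E; exact: diff_derivable.
Qed.

(** Along the line through u in the direction v the derivative is
    t D + o(t), with D the second derivative; a negative D would make the
    function strictly decreasing to the right of its minimum. *)
Lemma second_order_condition j u v : C2_around j u ->
  (\forall t \near (0 : R), j u <= j (u + t *: v)) -> 0 <= derive2 j u v v.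
Proof.
move=> C2 minu; set D := derive2 j u v v; rewrite leNgt; apply/negP => D0.
have [_ lin _ diff2 _] := nbhs_singleton C2.
(* chosen such that the error e |t v| |v| is at most half of |t D| *)
pose e := - D / (2 * (`|v| ^+ 2 + 1)).
have v20 : 0 < `|v| ^+ 2 + 1 by rewrite ltr_wpDl// sqr_ge0.
have e0 : 0 < e by rewrite divr_gt0 ?oppr_gt0// mulr_gt0.
have line_cvg : (fun t : R => u + t *: v) t @[t --> 0] --> u.
  rewrite -[X in _ --> X]addr0 -(scale0r v); apply: cvgD; first exact: cvg_cst.
  by apply: cvgZr_tmp; exact: cvg_id.
have tv_cvg : (fun t : R => t *: v) t @[t --> 0] --> (0 : V).
  by rewrite -[X in _ --> X](scale0r v); apply: cvgZr_tmp; exact: cvg_id.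
have near1 : \forall t \near (0 : R), differentiable j (u + t *: v).
  have nd : \forall u' \near u, differentiable j u' by apply: filterS C2 => u' [].
  exact: (line_cvg _ nd).
have near2 := tv_cvg _ (diff2 _ e0).
have : \forall t \near (0 : R), [/\ j u <= j (u + t *: v), differentiable j (u + t *: v) &
   `|'d j (u + t *: v) v - 'd j u v - derive2 j u (t *: v) v| <= e * `|t *: v| * `|v| ].
  near=> t; split; [by near: t|by near: t|].
  have : forall w, `|'d j (u + t *: v) w - 'd j u w - derive2 j u (t *: v) w| <= e * `|t *: v| * `|w| by near: t.
  exact.
move=> /nbhs_ballP[r /= r0 rP].
have {}rP t : `|t| < r -> [/\ j u <= j (u + t *: v), differentiable j (u + t *: v) &
   `|'d j (u + t *: v) v - 'd j u v - derive2 j u (t *: v) v| <= e * `|t *: v| * `|v| ].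
  by move=> tr; apply: rP; rewrite /ball/= sub0r normrN.
have itvP t : t \in `]- r, r[%R -> `|t| < r by rewrite in_itv/= ltr_norml.
have dj0 : 'd j u v = 0.
  have d0 : is_derive (0 : R) 1 (fun t => j (u + t *: v)) 0.
    apply: (@derive1_at_min _ _ (- r) r 0).
    - by rewrite ge0_cp// ltW.
    - move=> t /itvP/rP[_ dt _]; by have [] := is_derive_line dt.
    - by rewrite in_itv/= r0 oppr_lt0 r0.
    - by move=> t /itvP/rP[+ _ _]; rewrite scale0r addr0.
  have dju : differentiable j (u + 0 *: v) by have [] := rP 0; rewrite ?normr0.
  have [_ +] := is_derive_line dju; have [_ ->] := d0.
  by rewrite scale0r addr0 => <-.
have neg t : 0 < t -> t < r -> 'd j (u + t *: v) v < 0.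
  move=> t0 tr; have [_ _] := rP t ltac:(by rewrite gtr0_norm).
  have -> : derive2 j u (t *: v) v = t * D.
    by have [h _] := lin v; have := linearZ_LR (HB.pack (fun v0 => derive2 j u v0 v : R^o) (GRing.isLinear.Build _ _ _ _ _ h) : {linear V -> R^o}) t v.
  rewrite dj0 subr0 normrZ gtr0_norm// => /(le_trans (ler_norm _)).
  have -> : e * (t * `|v|) * `|v| = t * (e * `|v| ^+ 2) by ring.
  have ev : e * `|v| ^+ 2 <= - D / 2.
    rewrite /e; have -> : - D / (2 * (`|v| ^+ 2 + 1)) * `|v| ^+ 2 = (- D / 2) * (`|v| ^+ 2 / (`|v| ^+ 2 + 1)).
      by field; rewrite gt_eqF.
    rewrite ler_piMr//; first by rewrite divr_ge0// oppr_ge0 ltW.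
    by rewrite ler_pdivrMr// mul1r lerDl.
  have := ler_wpM2l (ltW t0) ev; have : t * D < 0 by rewrite pmulr_rlt0.
  lra.
have r2 : 0 < r / 2 by rewrite divr_gt0.
have hder x : 0 <= x <= r / 2 -> is_derive x (1 : R) (fun t => j (u + t *: v)) ('d j (u + x *: v) v).
  move=> /andP[x0 xr]; apply: is_derive_line; have [] // := rP x.
  by rewrite ger0_norm//; lra.
have [|x|c] := @MVT R (fun t => j (u + t *: v)) (fun t => 'd j (u + t *: v) v) 0 (r / 2) r2.
- by move=> x; rewrite in_itv/= => /andP[x0 xr]; apply: hder; rewrite !ltW.
- apply: derivable_within_continuous => y; rewrite in_itv/= => yI.
  by have [] := hder y yI.
move=> cI; rewrite subr0 scale0r addr0 => E.
move: cI; rewrite in_itv/= => /andP[c0 cr].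
have [] := rP (r / 2); first by rewrite gtr0_norm//; lra.
move=> h _ _; have := neg c c0 ltac:(lra); rewrite -(pmulr_llt0 _ r2) -E.
by rewrite subr_lt0 ltNge h.
Unshelve. all: by end_near. Qed.

End second_order.

Section admissible_perturbations.
Context {R : realType}.
Implicit Types (k : R -> \bar R) (a b c x y s t : R) (u v : W1inf R).
Local Notation leb := (@lebesgue_measure R).
Local Notation T := (2 * pi : R).

(** Small multiples of a function supported where both constraints are inactive
    preserve the constraints, by compactness of the support and semicontinuity
    of the obstacles. *)
Lemma F_ad_perturb k1 k2 u v a b : periodic2pi k1 -> periodic2pi k2 ->
  upper_semicontinuous k1 -> lower_semicontinuous k2 -> F_ad k1 k2 u ->
  [set` `[a, b]] `<=` torus_in k1 k2 u ->
  (forall x, 0 <= x <= T -> ~ (a < x < b) -> v x = 0) ->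
  \forall t \near (0 : R), F_ad k1 k2 (u + t *: v).
Proof.
move=> pk1 pk2 usc lsc uF abin vz.
pose P t x := [/\ (k1 x <= (u x + t * v x)%:E)%E, ((u x + t * v x)%:E <= k2 x)%E & 0 < u x + t * v x].
have cuv (x : R) : (u z.1 + z.2 * v z.1) @[z --> (x, 0 : R)] --> u x.
  suff: (u z.1 + z.2 * v z.1) @[z --> (x, 0 : R)] --> u x + 0 * v x by rewrite mul0r addr0.
  apply: cvgD.
    by apply: (cvg_comp fst u) (@W1inf_continuous R u x); exact: cvg_fst.
  apply: cvgM; first exact: cvg_snd.
  by apply: (cvg_comp fst v) (@W1inf_continuous R v x); exact: cvg_fst.
have loc x : [set` `[a, b]] x -> \forall x' \near x & t \near (0 : R), P t x'.
  move=> /abin[_ /andP[k1u uk2]]; have [_ _ u0] := uF x.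
  have up : \forall x' \near x & t \near (0 : R), ((u x' + t * v x')%:E <= k2 x')%E.
    have [c uc ck] : exists2 c, u x < c & (c%:E < k2 x)%E.
      case: (k2 x) uk2 => [r||//]; last by move=> _; exists (u x + 1); rewrite ?ltrDl ?ltry.
      rewrite lte_fin => ur; exists ((u x + r) / 2); first by rewrite midf_lt.
      by rewrite lte_fin midf_lt.
    have [W xW Wk] := lsc x c ck.
    have h : \forall z \near (x, 0 : R), u z.1 + z.2 * v z.1 < c.
      exact: cvgr_lt (u x) (cuv x) c uc.
    have h2 : \forall z \near (x, 0 : R), W z.1 by apply: (@cvg_fst _ _ (nbhs x) (nbhs (0 : R))).
    near=> z; rewrite (@le_trans _ _ c%:E)//; last first.
      by apply/ltW/Wk; near: z.
    by rewrite lee_fin ltW//; near: z.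
  have lo : \forall x' \near x & t \near (0 : R), (k1 x' <= (u x' + t * v x')%:E)%E.
    have [c uc ck] : exists2 c, c < u x & (k1 x < c%:E)%E.
      case: (k1 x) k1u => [r|//|]; last by move=> _; exists (u x - 1); rewrite ?ltNyr// gtrBl.
      rewrite lte_fin => ur; exists ((r + u x) / 2); first by rewrite midf_lt.
      by rewrite lte_fin midf_lt.
    have [W xW Wk] := usc x (- c) ltac:(by rewrite EFinN lteN2).
    have h : \forall z \near (x, 0 : R), c < u z.1 + z.2 * v z.1.
      exact: cvgr_gt (u x) (cuv x) c uc.
    have h2 : \forall z \near (x, 0 : R), W z.1 by apply: (@cvg_fst _ _ (nbhs x) (nbhs (0 : R))).
    near=> z; rewrite (@le_trans _ _ c%:E)//.
      by rewrite -leeN2 -EFinN; apply/ltW/Wk; near: z.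
    by rewrite lee_fin ltW//; near: z.
  have po : \forall x' \near x & t \near (0 : R), 0 < u x' + t * v x' by exact: cvgr_gt (u x) (cuv x) 0 u0.
  by near=> z; split; near: z.
have := (compact_near_coveringP _).1 (@segment_compact _ a b) _ (nbhs (0 : R)) (fun t x => P t x) _ loc.
move=> /(_ (nbhs_filter _)); apply: filterS => t tP.
have on_period x : 0 <= x <= T -> P t x.
  move=> x0T; have [axb|nax] := pselect (a < x < b).
    by apply: tP; rewrite /= in_itv/= !ltW ?(andP axb).1 ?(andP axb).2.
  by rewrite /P vz// mulr0 addr0; exact: uF.
move=> x; have := on_period (wrapT x); have /andP[h1 h2] := wrap_itv x.
rewrite (ltW h1) h2 /P (periodic_wrap x pk1) (periodic_wrap x pk2).
rewrite (periodic_wrap x (W1inf_periodic u)) (periodic_wrap x (W1inf_periodic v)).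
exact.
Unshelve. all: by end_near. Qed.

(** Where the cumulative function G of u'' + u takes four values on a short
    interval free of the constraints there is an admissible two-sided
    perturbation supported in that interval; its second variation is
    nonnegative by minimality, and negative by the concavity assumption since
    the H^1 seminorm dominates on short supports. *)
Lemma few_values_on_short_intervals k1 k2 (j : W1inf R -> R) u f
    (G : cumulative R R) s alpha beta gamma :
  periodic2pi k1 -> periodic2pi k2 ->
  upper_semicontinuous k1 -> lower_semicontinuous k2 -> F_ad k1 k2 u ->
  (forall w, weakly_nonneg w -> F_ad k1 k2 w -> j u <= j w) ->
  C2_around j u -> 0 <= s < 1 -> 0 < alpha -> 0 <= beta -> 0 <= gamma ->
  (forall v, derive2 j u v v <= - alpha * Hs_semi 1 v ^+ 2 + gamma * Hs_semi 1 v * Hs_norm s v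
     + beta * Hs_norm s v ^+ 2) ->
  is_deriv u f -> (\forall x \ae leb, f x = G x - prim u x) -> G T - G 0 = prim u T ->
  exists2 e : R, 0 < e & forall x1 x2 x3 x4 : R,
    0 < x1 -> x1 < x2 -> x2 < x3 -> x3 < x4 -> x4 < T -> x4 - x1 <= e ->
    [set` `[x1, x4]] `<=` torus_in k1 k2 u ->
    G x1 < G x2 -> G x2 < G x3 -> G x3 < G x4 -> False.
Proof.
move=> pk1 pk2 usc lsc uF minu C2 s01 al0 be0 ga0 concave uf fG GT.
have gb0 : 0 < 2 * (gamma + beta + 1) by rewrite mulr_gt0// ltr_wpDl// addr_ge0.
(* q bounds the H^s norm relatively to the H^1 seminorm; the upper bound of the
   second variation is then at most (q gamma + q beta - alpha) |v|^2 *)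
pose q := Num.min 1 (alpha / (2 * (gamma + beta + 1))).
have q0 : 0 < q by rewrite lt_min ltr01 divr_gt0.
have q1 : q <= 1 by rewrite ge_min lexx.
have qa : q * (2 * (gamma + beta + 1)) <= alpha by rewrite -ler_pdivlMr// ge_min lexx orbT.
have [l l0 short] := short_support s01 (exprn_gt0 2 q0).
exists l => // x1 x2 x3 x4 x10 x12 x23 x34 x4T x14l xin G12 G23 G34.
have [v [[x vx] vz vnn]] := perturbation_exists uf fG GT x10 x12 x23 x34 x4T G12 G23 G34.
have v0 : v 0 = 0.
  by apply: vz; [rewrite lexx ltW// period_gt0|move=> /andP[]; rewrite ltNge ltW].
set h := Hs_semi 1 v; set N := Hs_norm s v.
have h0 : 0 < h by exact: H1_semi_gt0 vx.
have N0 : 0 <= N by exact: sqrtr_ge0.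
have Nh : N <= q * h.
  have : N ^+ 2 <= (q * h) ^+ 2.
    rewrite exprMn; apply: (short v x1 x4) => //.
    - exact: ltW.
    - by rewrite ltW// (lt_trans x12)// (lt_trans x23).
    - exact: ltW.
  by rewrite ler_pXn2r ?nnegrE// mulr_ge0// ltW.
have D0 : 0 <= derive2 j u v v.
  apply: second_order_condition => //.
  have near0 : \forall t \near (0 : R), `|t| <= 1.
    by apply/nbhs_ballP; exists 1 => //= t; rewrite /ball/= sub0r normrN => /ltW.
  have := F_ad_perturb pk1 pk2 usc lsc uF xin vz; apply: filterS2 near0 => t t1 tF.
  by apply: minu => //; exact: vnn.
have := le_trans D0 (concave v); rewrite -/h -/N leNgt => /negP; apply.
have h2 : 0 < h ^+ 2 by exact: exprn_gt0.
have b1 : gamma * h * N <= gamma * q * h ^+ 2.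
  rewrite (_ : gamma * q * h ^+ 2 = gamma * h * (q * h)); last by ring.
  by apply: ler_wpM2l => //; rewrite mulr_ge0// ltW.
have b2 : beta * N ^+ 2 <= beta * q * h ^+ 2.
  rewrite -mulrA; apply: ler_wpM2l => //.
  apply: (@le_trans _ _ ((q * h) ^+ 2)); first by rewrite lerXn2r// nnegrE ?mulr_ge0// ltW.
  by rewrite exprMn ler_pM2r// expr2 ler_piMr// ltW.
have : (gamma * q + beta * q - alpha) * h ^+ 2 < 0.
  rewrite pmulr_llt0//; have : 0 <= q * (gamma + beta) by rewrite mulr_ge0 ?addr_ge0// ltW.
  lra.
lra.
Qed.

End admissible_perturbations.

(** * Measures carried by finitely many points *)

Section carried.
Context {R : realType}.
Implicit Types (a b c x y z w e : R) (A B D I : set R) (S s : seq R).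
Local Notation T := (2 * pi : R).

(** Negligibility, as opposed to zero measure, frees the notion from measurability
    conditions on A. *)
Definition carried (mu : {measure set (measurableTypeR R) -> \bar R}) A : Prop :=
  exists S, mu.-negligible (A `\` [set` S]).

Lemma carriedS mu A B : A `<=` B -> carried mu B -> carried mu A.
Proof. by move=> AB [S BS]; exists S; apply: negligibleS BS; exact: setSD. Qed.

Lemma carriedU mu A B : carried mu A -> carried mu B -> carried mu (A `|` B).
Proof.
move=> [S nS] [S' nS']; exists (S ++ S'); apply: negligibleS (negligibleU nS nS').
move=> x [[Ax|Bx] /= xS]; [left|right]; split => //= xS'; apply: xS.
  by rewrite mem_cat xS'.
by rewrite mem_cat xS' orbT.
Qed.

Lemma carried_set1 mu x : carried mu [set x].
Proof.
exists [:: x]; rewrite (_ : _ `\` _ = set0); first exact: negligible_set0.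
by apply/seteqP; split => // y [/= -> []]; rewrite mem_head.
Qed.

Lemma carried0 mu : carried mu set0.
Proof. exact: carriedS (sub0set [set 0]) (carried_set1 mu 0). Qed.

(** A finite measure splits over finitely many points and the rest, which is
    negligible; points of zero mass are dropped. *)
Lemma carried_finite_dirac_sum (mu : {measure set (measurableTypeR R) -> \bar R}) I :
  I `<=` @torus R -> (mu (@torus R) < +oo)%E -> carried mu I -> finite_dirac_sum_in I mu.
Proof.
move=> Itor fin [S nS].
have m1 x : measurable ([set x] : set (measurableTypeR R)) by exact: measurable_set1.
have mtor : measurable (@torus R : set (measurableTypeR R)) by exact: measurable_itv.
pose keep x := `[<I x /\ (0 < mu [set x])%E>].
pose S' := [seq x <- undup S | keep x].
have memS' (i : 'I_(size S')) : keep (nth 0 S' i).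
  by have := mem_nth 0 (ltn_ord i); rewrite mem_filter => /andP[].
have fin1 x : I x -> mu [set x] \is a fin_num.
  move=> Ix; rewrite ge0_fin_numE ?measure_ge0//; apply: le_lt_trans fin.
  by apply: le_measure; rewrite ?inE// => y ->; exact: Itor.
exists (size S'), (fun i => nth 0 S' i), (fun i => fine (mu [set nth 0 S' i])); split.
  move=> i; have /asboolP[Ii mi] := memS' i; split => //.
  by rewrite fine_gt0// mi ltey_eq fin1.
move=> A mA AI.
have split_off s (B : set (measurableTypeR R)) : measurable B -> uniq s ->
    mu B = (\sum_(x <- s) mu (B `&` [set x]) + mu (B `\` [set` s]))%E.
  elim: s B => [|x s IH] B mB /=.
    by move=> _; rewrite big_nil add0e set_nil setD0.
  move=> /andP[xs us]; rewrite big_cons (measureDI mu mB (m1 x)) addeC -addeA; congr (_ + _)%E.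
  rewrite [LHS](IH (B `\` [set x]) (measurableD mB (m1 x)) us); congr (_ + _)%E.
    rewrite big_seq [RHS]big_seq; apply: eq_bigr => y ys; congr (mu _).
    apply/seteqP; split => [z [[Bz _] zy]//|z [Bz /= zy]]; split => //; split => //= zx.
    by move: xs; rewrite -zx zy ys.
  congr (mu _); apply/seteqP; split => z /=.
    by move=> [[Bz zx] zs]; split => //; rewrite inE => /orP[/eqP|].
  move=> [Bz]; rewrite inE => /negP; rewrite negb_or => /andP[/eqP zx /negP zs].
  by split => //; split.
rewrite (split_off (undup S) A mA (undup_uniq S)).
rewrite (_ : mu (A `\` _) = 0%E) ?adde0; last first.
  apply: measure_negligible.
    apply: measurableD => //; apply: countable_measurable => //.
    exact/finite_set_countable/finite_seq.
  apply: negligibleS nS => x [/AI Ix] /=; rewrite mem_undup => xS.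
  by split.
have E x : mu (A `&` [set x]) = (mu [set x] * \d_(x : measurableTypeR R) A)%E.
  rewrite diracE; have [xA|xA] := boolP (x \in A).
    rewrite mule1; congr (mu _); rewrite setIidr// => y ->.
    by rewrite inE in xA.
  rewrite mule0 (_ : _ `&` _ = set0) ?measure0//.
  apply/seteqP; split => // y [Ay] /= yx; move: xA.
  by rewrite -yx notin_setE.
under eq_bigr do rewrite E.
rewrite (bigID keep)/= [X in (_ + X)%E]big1 ?adde0; last first.
  move=> x /asboolPn nk; have [->|mx] := eqVneq (mu [set x]) 0%E; first by rewrite mul0e.
  rewrite diracE memNset ?mule0// => /AI Ix; apply: nk; split => //.
  by rewrite lt_neqAle eq_sym mx measure_ge0.
rewrite -big_filter -/S' (big_nth 0) big_mkord; apply: eq_bigr => i _.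
by rewrite fineK// fin1//; have /asboolP[] := memS' i.
Qed.

End carried.

Section carried_stieltjes.
Context {R : realType} (G : cumulative R R).
Implicit Types (a b c x y z w e : R) (D K : set R) (s : seq R).
Local Notation T := (2 * pi : R).
Local Notation LS := (lebesgue_stieltjes_measure G).

(** Away from its end points D is a countable union of intervals ]p, q] with p and
    q in D, whose mass G q - G p is zero. *)
Lemma carried_constant D : is_interval D -> (forall x y, D x -> D y -> G x = G y) ->
  carried LS D.
Proof.
move=> iD cD.
pose F (n : nat) : set R := if unpickle n is Some (p, q) then
  if `[<D (ratr p) /\ D (ratr q)>] then `]ratr p, ratr q]%classic else set0 else set0.
have F0 n : LS.-negligible (F n).
  rewrite /F; case: unpickle => [[p q]|]; last exact: negligible_set0.
  case: asboolP => [[Dp Dq]|_]; last exact: negligible_set0.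
  have [pq|qp] := leP (ratr p : R) (ratr q).
    have m : measurable (`]ratr p, ratr q]%classic : set (measurableTypeR R)) by exact: measurable_itv.
    apply: (negligibleP LS m).2; apply: etrans (stieltjes_itv G pq) _.
    by rewrite (cD _ _ Dp Dq) subrr.
  rewrite set_itv_ge; first exact: negligible_set0.
  by rewrite bnd_simp -leNgt ltW.
have cF : carried LS (\bigcup_n F n).
  exists [::]; rewrite set_nil setD0; exact: negligible_bigcup.
pose lo := [set x | D x /\ forall y, D y -> x <= y].
pose hi := [set x | D x /\ forall y, D y -> y <= x].
have cend (A : set R) : (forall x y, A x -> A y -> x = y) -> carried LS A.
  move=> A1; have [[x Ax]|nA] := pselect (exists x, A x).
    by apply: carriedS (carried_set1 LS x) => y Ay; exact: A1.
  by apply: carriedS (carried0 LS) => y Ay; apply: nA; exists y.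
have clo : carried LS lo.
  by apply: cend => x y [Dx hx] [Dy hy]; apply/eqP; rewrite eq_le hx ?hy.
have chi : carried LS hi.
  by apply: cend => x y [Dx hx] [Dy hy]; apply/eqP; rewrite eq_le hx ?hy.
apply: carriedS (carriedU cF (carriedU clo chi)) => x Dx.
have [[a [Da ax]]|nlo] := pselect (exists a, D a /\ a < x); last first.
  right; left; split => // y Dy; rewrite leNgt; apply/negP => yx; apply: nlo.
  by exists y.
have [[b [Db xb]]|nhi] := pselect (exists b, D b /\ x < b); last first.
  right; right; split => // y Dy; rewrite leNgt; apply/negP => yx; apply: nhi.
  by exists y.
left; have [p] := rat_in_itvoo ax; rewrite in_itv/= => /andP[ap px].
have [q] := rat_in_itvoo xb; rewrite in_itv/= => /andP[xq qb].
exists (pickle (p, q)); first exact: I.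
rewrite /F pickleK asboolT.
  by rewrite /= in_itv/= px ltW.
split; first by apply: (iD _ _ Da Dx); rewrite !ltW.
by apply: (iD _ _ Dx Db); rewrite !ltW.
Qed.

(** Peel off the points where G is minimal on D: there G is constant, and the
    remaining points form an interval with strictly shorter chains of values. *)
Lemma carried_few_values n D : is_interval D ->
  (forall s, size s = n -> (forall x, x \in s -> D x) -> sorted (fun x y => G x < G y) s -> False) ->
  carried LS D.
Proof.
have ndG : {homo G : x y / x <= y} by exact: cumulative_is_nondecreasing.
elim: n D => [|n IH] D iD noD; first by exfalso; apply: (noD [::]).
pose D' := [set x | D x /\ exists2 y, D y & G y < G x].
have iD' : is_interval D'.
  move=> a b [Da [y Dy ya]] [Db _] c /andP[ac cb]; split.
    by apply: (iD _ _ Da Db); rewrite ac.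
  by exists y => //; apply: (lt_le_trans ya); exact: ndG.
have c1 : carried LS (D `\` D').
  have low x y : (D `\` D') x -> D y -> G x <= G y.
    move=> [Dx nx] Dy; rewrite leNgt; apply/negP => yx; apply: nx; split => //.
    by exists y.
  apply: carried_constant.
    move=> a b [Da na] [Db nb] c /andP[ac cb].
    have Dc : D c by apply: (iD _ _ Da Db); rewrite ac.
    split => // -[_ [y Dy yc]]; have := low b y (conj Db nb) Dy.
    by rewrite leNgt (lt_le_trans yc)// ndG.
  move=> x y hx hy; apply/eqP; rewrite eq_le low//; last by case: hy.
  by rewrite low//; case: hx.
have c2 : carried LS D'.
  case: n IH noD => [|n] IH noD.
    apply: carriedS (carried0 LS) => x [Dx _]; apply: (noD [:: x]) => //.
    by move=> y; rewrite inE => /eqP ->.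
  apply: IH => // -[//|x s] [ss] sD ssort.
  have [Dx [y Dy yx]] := sD x (mem_head x s).
  apply: (noD [:: y, x & s]); rewrite /= ?ss//.
    by move=> z; rewrite in_cons => /predU1P[->//|/sD[]].
  by rewrite yx.
by apply: carriedS (carriedU c1 c2) => x Dx; have [|] := pselect (D' x); [right|left].
Qed.

(** K is cut into finitely many pieces of length at most e, on which G has at most
    three values. *)
Lemma carried_interval e A K : 0 < e ->
  (forall x1 x2 x3 x4 : R,
    0 < x1 -> x1 < x2 -> x2 < x3 -> x3 < x4 -> x4 < T -> x4 - x1 <= e ->
    [set` `[x1, x4]] `<=` A -> G x1 < G x2 -> G x2 < G x3 -> G x3 < G x4 -> False) ->
  is_interval K -> K `<=` `]0, T[ -> K `<=` A -> carried LS K.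
Proof.
move=> e0 few iK K0T KA.
have ndG : {homo G : x y / x <= y} by exact: cumulative_is_nondecreasing.
have ltG x y : G x < G y -> x < y.
  by move=> xy; rewrite ltNge; apply/negP => /ndG; rewrite leNgt xy.
have piece (n : nat) : carried LS (K `&` `](n%:R * e), (n.+1%:R * e)]%classic).
  apply: (@carried_few_values 4).
    move=> a b [Ka + ] [Kb + ] c /andP[ac cb]; rewrite /= !in_itv/= => /andP[na _] /andP[_ bn].
    split; first by apply: (iK _ _ Ka Kb); rewrite ac.
    by rewrite (lt_le_trans na ac) (le_trans cb bn).
  move=> [//|x1 [//|x2 [//|x3 [//|x4 [|//]]]]] _ sK /= /and4P[G12 G23 G34 _].
  have [|K1 i1] := sK x1; first by rewrite !inE eqxx.
  have [|K4 i4] := sK x4; first by rewrite !inE eqxx !orbT.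
  have := K0T _ K1; have := K0T _ K4; move: i1 i4; rewrite /= !in_itv/=.
  move=> /andP[h1 _] /andP[_ h4] /andP[_ h4T] /andP[h10 _].
  apply: (few x1 x2 x3 x4) => //; try exact: ltG.
    by move: h4; rewrite -[n.+1%:R]natr1 mulrDl mul1r; lra.
  move=> y /=; rewrite in_itv/= => y14; apply: KA; exact: (iK _ _ K1 K4).
have all_pieces (n : nat) : carried LS (K `&` `]0, (n%:R * e)]%classic).
  elim: n => [|n IH].
    apply: carriedS (carried0 LS) => x [_]; rewrite /= in_itv/= mul0r => /andP[x0].
    by rewrite leNgt x0.
  apply: carriedS (carriedU IH (piece n)) => x [Kx]; rewrite /= in_itv/= => /andP[x0 xn].
  have [xs|xl] := leP x (n%:R * e); [left|right]; split => //=; rewrite in_itv/= ?x0 ?xs//.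
  by rewrite xl xn.
apply: carriedS (all_pieces (Num.truncn (T / e)).+1) => x Kx; split => //.
have := K0T x Kx; rewrite /= !in_itv/= => /andP[-> xT]/=.
rewrite -ler_pdivrMr// ltW// (lt_trans _ (truncnS_gt _))//.
by rewrite ltr_pM2r ?invr_gt0.
Qed.

End carried_stieltjes.

(** * Connected components on the circle *)

Section components.
Context {R : realType}.
Implicit Types (a b c x y z w : R) (A I : set R).
Local Notation T := (2 * pi : R).

Lemma sin_half_eq0 x y : torus x -> torus y -> sin ((x - y) / 2) = 0 -> x = y.
Proof.
rewrite /torus/= !in_itv/= => /andP[x0 xT] /andP[y0 yT] s0.
have [xy|yx|//] := ltgtP x y.
  have : 0 < sin ((y - x) / 2) by apply: sin_gt0_pi; apply/andP; split; lra.
  have -> : (y - x) / 2 = - ((x - y) / 2) by ring.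
  by rewrite sinN s0 oppr0 ltxx.
have : 0 < sin ((x - y) / 2) by apply: sin_gt0_pi; apply/andP; split; lra.
by rewrite s0 ltxx.
Qed.

Lemma sin_half_gt0 x y : torus x -> torus y -> y < x -> 0 < sin ((x - y) / 2).
Proof.
rewrite /torus/= !in_itv/= => /andP[x0 xT] /andP[y0 yT] yx.
by apply: sin_gt0_pi; apply/andP; split; lra.
Qed.

Lemma circle_point_inj x y : torus x -> torus y -> circle_point x = circle_point y -> x = y.
Proof.
move=> tx ty [c s]; apply: sin_half_eq0 => //; apply/eqP.
have : cos (x - y) = 1 by rewrite cosB c s -!expr2 cos2Dsin2.
rewrite [in cos _](splitr (x - y)) cosD -!expr2 cos2sin2; set q := sin _ => h.
by rewrite -sqrf_eq0; apply/eqP; lra.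
Qed.

(** The line through the points of angles z and w separates the points of the
    circle according to the sign of sin ((x - z) / 2) sin ((x - w) / 2), which
    is an affine function of (cos x, sin x). A connected set avoiding both
    points therefore meets only one of the two arcs that they cut. *)
Lemma component_arcs A I x y z w : A `<=` @torus R -> torus_component A I ->
  I x -> I y -> torus z -> torus w -> ~ I z -> ~ I w -> x < z -> z < y ->
  w < x \/ y < w -> False.
Proof.
move=> At [x0 Ax0 IE] Ix Iy tz tw nz nw xz zy wout.
set C := connected_component _ _ in IE.
pose ell (p : R * R) : R := cos ((w - z) / 2) - (p.1 * cos ((z + w) / 2) + p.2 * sin ((z + w) / 2)).
have ellE t : ell (circle_point t) = 2 * (sin ((t - z) / 2) * sin ((t - w) / 2)).
  rewrite /ell /= -cosB.
  have -> : (w - z) / 2 = (t - z) / 2 - (t - w) / 2 by field.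
  have -> : t - (z + w) / 2 = (t - z) / 2 + (t - w) / 2 by field.
  by rewrite cosB cosD; ring.
have nell p : C p -> ell p != 0.
  move=> Cp; have [t At' pE] := connected_component_sub Cp; rewrite -pE ellE.
  have tt : torus t := At _ At'.
  have It : I t by rewrite IE; split => //=; rewrite pE.
  rewrite !mulf_neq0//; apply/eqP => /(sin_half_eq0 tt) E.
    by apply: nz; rewrite -(E tz).
  by apply: nw; rewrite -(E tw).
have cell : continuous ell.
  move=> p; apply: cvgB; first exact: cvg_cst.
  by apply: cvgD; apply: cvgM; first [exact: cvg_cst|exact: cvg_fst|exact: cvg_snd].
have /connected_intervalP iC : connected (ell @` C).
  apply: connected_continuous_connected; first exact: component_connected.
  exact: continuous_subspaceT.
move: Ix Iy; rewrite IE => -[tx /= Cx] [ty /= Cy].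
have Ex : (ell @` C) (ell (circle_point x)) by exists (circle_point x).
have Ey : (ell @` C) (ell (circle_point y)) by exists (circle_point y).
have opp : ell (circle_point x) * ell (circle_point y) < 0.
  rewrite !ellE; set a := sin _; set b := sin _; set c := sin _; set d := sin _.
  have a0 : a < 0 by rewrite /a -opprB mulNr sinN oppr_lt0 sin_half_gt0.
  have c0 : 0 < c by exact: sin_half_gt0.
  have bd : 0 < b * d.
    case: wout => [wx|yw]; first by rewrite mulr_gt0// sin_half_gt0// (lt_trans wx)// (lt_trans xz).
    have yw' : x < w by rewrite (lt_trans xz)// (lt_trans zy).
    by rewrite /b /d -(opprB w x) -(opprB w y) !mulNr !sinN mulrNN mulr_gt0// sin_half_gt0.
  have -> : 2 * (a * b) * (2 * (c * d)) = 4 * (a * c) * (b * d) by ring.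
  by rewrite pmulr_llt0// pmulr_rlt0// nmulr_rlt0.
suff [p Cp p0] : (ell @` C) 0 by have := nell p Cp; rewrite p0 eqxx.
have [le0|lt0] := leP (ell (circle_point x)) 0.
  apply: (iC _ _ Ex Ey); rewrite le0 /= leNgt; apply/negP => /ltW ly.
  by move: opp; rewrite ltNge mulr_le0.
apply: (iC _ _ Ey Ex); rewrite (ltW lt0) andbT leNgt; apply/negP => ly.
by move: opp; rewrite ltNge mulr_ge0// ltW.
Qed.

(** A component other than the whole circle is an arc; cutting the circle at 0
    and at any point outside the component makes it two intervals. *)
Lemma component_intervals A I : A `<=` @torus R -> torus_component A I ->
  I `<=` A /\ exists z, [/\ torus z, is_interval (I `&` `]0, z[) & is_interval (I `&` `]z, T[)].
Proof.
move=> At IC; split.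
  case: IC => x0 Ax0 -> x [tx /= /connected_component_sub[a Aa /circle_point_inj]].
  by move=> <- //; exact: At.
have [[z [tz nz]]|all] := pselect (exists z, torus z /\ ~ I z).
  have tI c a b : torus a -> torus b -> a <= c <= b -> torus c.
    rewrite /torus/= !in_itv/= => /andP[a0 _] /andP[_ bT] /andP[ac cb].
    by rewrite (le_trans a0 ac) (le_lt_trans cb bT).
  have It a : I a -> torus a by case: IC => x0 _ -> [].
  have between a b c : I a -> I b -> a <= c <= b -> z < a \/ b < z -> I c.
    move=> Ia Ib acb zout; apply: contrapT => nIc.
    have tc : torus c by exact: (tI c a b (It _ Ia) (It _ Ib)).
    move: acb => /andP[]; rewrite !le_eqVlt => /predU1P[ac|ac]; first by rewrite -ac in nIc.
    move=> /predU1P[cb|cb]; first by rewrite cb in nIc.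
    exact: (component_arcs At IC Ia Ib tc tz).
  exists z; split => // a b [Ia ia] [Ib ib] c acb; move: ia ib (acb); rewrite /= !in_itv/=.
    move=> /andP[a0 _] /andP[_ bz] /andP[ac cb]; rewrite (lt_le_trans a0 ac) (le_lt_trans cb bz).
    by split => //; apply: (between a b) => //; right.
  move=> /andP[az _] /andP[_ bT] /andP[ac cb]; rewrite (lt_le_trans az ac) (le_lt_trans cb bT).
  by split => //; apply: (between a b) => //; left.
have It a : torus a -> I a by move=> ta; apply: contrapT => na; apply: all; exists a.
exists 0; split; first by rewrite /torus/= in_itv/= lexx period_gt0.
  by move=> a b [_ /=]; rewrite in_itv/= => /andP[a0 /(lt_trans a0)]; rewrite ltxx.
move=> a b [_ ia] [_ ib] c; move: ia ib; rewrite /= !in_itv/=.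
move=> /andP[a0 _] /andP[_ bT] /andP[ac cb].
have c0T : 0 < c < T by rewrite (lt_le_trans a0 ac) (le_lt_trans cb bT).
split => //; apply: It; rewrite /torus/= in_itv/=.
by have /andP[/ltW -> ->] := c0T.
Qed.

End components.

(** * Finiteness of u'' + u on components free of the constraints *)

Theorem theorem2p9 (R : realType) (k1 k2 : R -> \bar R)
    (j : W1inf R -> R) (u0 : W1inf R) (s alpha beta gamma : R) :
  periodic2pi k1 -> periodic2pi k2 ->
  (forall x, 0 <= k1 x)%E -> (forall x, 0 <= k2 x)%E ->
  upper_semicontinuous k1 -> lower_semicontinuous k2 ->
  (forall x, 0 < u0 x) ->
  weakly_nonneg u0 -> F_ad k1 k2 u0 ->
  (forall u : W1inf R, weakly_nonneg u -> F_ad k1 k2 u -> j u0 <= j u) ->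
  C2_around j u0 ->
  0 <= s < 1 -> 0 < alpha -> 0 <= beta -> 0 <= gamma ->
  (forall v : W1inf R, derive2 j u0 v v <=
     - alpha * Hs_semi 1 v ^+ 2 + gamma * Hs_semi 1 v * Hs_norm s v
     + beta * Hs_norm s v ^+ 2) ->
  exists mu : {measure set (measurableTypeR R) -> \bar R},
    represents_weak u0 mu /\
    forall I : set R, torus_component (torus_in k1 k2 u0) I ->
      finite_dirac_sum_in I mu.
Proof.
move=> pk1 pk2 _ _ usc lsc _ u0_nn u0F u0_min C2 s01 al0 be0 ga0 concave.
have [f uf] := W1inf_deriv u0.
have [G [fG Gper]] := weakly_nonneg_cumulative uf u0_nn.
have GT : G (2 * pi : R) - G 0 = prim u0 (2 * pi).
  by have := Gper 0; rewrite add0r => ->; rewrite addrAC subrr add0r.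
have rep : represents_weak u0 (lebesgue_stieltjes_measure G).
  apply: (represents_stieltjes uf) => //.
  by apply: (@filterS _ _ (ae_filter_ringOfSetsType lebesgue_measure)) fG => x ->.
exists (lebesgue_stieltjes_measure G); split => // I compI.
have [e e0 few] := few_values_on_short_intervals pk1 pk2 usc lsc u0F u0_min C2
  s01 al0 be0 ga0 concave uf fG GT.
have inT : torus_in k1 k2 u0 `<=` @torus R by move=> x [].
have [IA [z [tz int1 int2]]] := component_intervals inT compI.
have Itor : I `<=` @torus R by move=> x /IA/inT.
apply: carried_finite_dirac_sum => //; first by case: rep.
have carK := carried_interval e0 few.
have KA (K : set R) : I `&` K `<=` torus_in k1 k2 u0 by move=> x [/IA].
move: tz; rewrite /torus/= in_itv/= => /andP[z0 zT].
have c1 := carK _ int1 _ (KA _); have c2 := carK _ int2 _ (KA _).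
apply: carriedS (carriedU (carriedU (carried_set1 _ 0) (carried_set1 _ z)) (carriedU (c1 _) (c2 _))).
- move=> x Ix; have := Itor x Ix; rewrite /torus/= in_itv/= => /andP[x0 xT].
  have [xz|zx|->] := ltgtP x z; last by left; right.
    move: x0; rewrite le_eqVlt => /predU1P[<-|x0]; first by left; left.
    by right; left; split => //=; rewrite in_itv/= x0.
  by right; right; split => //=; rewrite in_itv/= zx.
- by move=> x [_] /=; rewrite !in_itv/= => /andP[-> /lt_trans->].
- by move=> x [_] /=; rewrite !in_itv/= => /andP[/(le_lt_trans z0) -> ->].

Qed.
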